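(* There is a function $\varepsilon:\mathbb{N}\to[0,1]$ with $\varepsilon(\tilde k)\to 0$ as $\tilde k\to\infty$ such that the following holds. Let $G$ be an abelian group with $\tilde k$ elements and let $0<p<1$ satisfy $\min(p,1-p)\ge 10^6(\log\tilde k)^{6/5}\tilde k^{-1/5}$. Let $\Lambda\subseteq G\setminus\{0\}$ be chosen by the random procedure described in the context. Then with probability at least $1-\varepsilon(\tilde k)$ the Cayley graph $\widetilde H=\mathrm{Cayley}(G,\Lambda)$ has the following property: for every induced subgraph $H$ of $\widetilde H$ on $k\ge \tilde k-\frac14\log\tilde k$ vertices and for every positive integer $n$, every $n$-vertex graph $\Gamma$ which contains the maximum possible number of induced copies of $H$ among all $n$-vertex graphs is a balanced iterated blow-up of $\widetilde H$.
   Context: $\log$ denotes the natural logarithm. For an abelian group $G$ and $\Lambda\subseteq G\setminus\{0\}$ with $\Lambda=-\Lambda$, the Cayley graph $\mathrm{Cayley}(G,\Lambda)$ has vertex set $G$, and distinct $x,y\in G$ are adjacent iff $x-y\in\Lambda$. Random procedure: for each set of the form $\{g,-g\}\subseteq G\setminus\{0\}$ (a singleton if $g=-g$), include $\{g,-g\}$ in $\Lambda$ independently with probability $p$; thus $\Lambda=-\Lambda$ always. A blow-up of a graph $F$ is a graph $\Gamma$ whose vertex set can be partitioned into non-empty sets $W_i$, $i\in V(F)$, such that for distinct $i,j\in V(F)$, $\Gamma$ is complete between $W_i$ and $W_j$ if $ij\in E(F)$ and has no edges between $W_i$ and $W_j$ otherwise (the graph inside each $W_i$ is arbitrary). It is a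 balanced blow-up if the $W_i$ can be chosen with sizes differing by at most one. A graph $\Gamma$ is a balanced iterated blow-up of $F$ if either $|V(\Gamma)|<|V(F)|$, or $\Gamma$ is a balanced blow-up of $F$ with parts $W_i$ such that each induced subgraph $\Gamma[W_i]$ is again a balanced iterated blow-up of $F$. *)

(* Defs.v *)
From HB Require Import structures.
From mathcomp Require Import all_boot all_order all_algebra.
From mathcomp Require Import boolp reals topology normedtype sequences exp.
Set Implicit Arguments.
Unset Strict Implicit.
Unset Printing Implicit Defensive.
Import Order.TTheory GRing.Theory Num.Theory.
Import numFieldNormedType.Exports.
Local Open Scope ring_scope.

Record sgraph := SGraph {
  vertex :> finType;
  adj : rel vertex;
  adj_sym : symmetric adj;
  adj_irrefl : irreflexive adj }.

Section Induced.
Variables (Gam : sgraph) (S : {set Gam}).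

Definition induced_adj : rel {x : Gam | x \in S} :=
  [rel x y | adj (val x) (val y)].

Lemma induced_adj_sym : symmetric induced_adj.
Proof. by move=> x y; apply: adj_sym. Qed.

Lemma induced_adj_irrefl : irreflexive induced_adj.
Proof. by move=> x; apply: adj_irrefl. Qed.

Definition induced : sgraph := SGraph induced_adj_sym induced_adj_irrefl.
End Induced.

Definition graph_iso (G1 G2 : sgraph) : Prop :=
  exists2 f : G1 -> G2, bijective f & forall x y, adj (f x) (f y) = adj x y.

(* Copies are counted as vertex subsets, not as embeddings. *)
Definition induced_copies (H Gam : sgraph) : nat :=
  #|[set S : {set Gam} | `[< graph_iso (induced S) H >]]|.

Definition max_induced_copies (H Gam : sgraph) : Prop :=
  forall Gam' : sgraph, #|Gam'| = #|Gam| ->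
    (induced_copies H Gam' <= induced_copies H Gam)%N.

Definition blow_up_parts (F Gam : sgraph) (W : F -> {set Gam}) : Prop :=
  [/\ forall i, W i != set0,
      forall i j, i != j -> [disjoint W i & W j],
      \bigcup_i W i = [set: Gam] &
      forall i j, i != j ->
        forall x y, x \in W i -> y \in W j -> adj x y = adj i j].

Definition balanced_parts (F Gam : sgraph) (W : F -> {set Gam}) : Prop :=
  forall i j, (#|W i| <= #|W j| + 1)%N.

Inductive balanced_iterated_blow_up (F : sgraph) : sgraph -> Prop :=
| BIB_small (Gam : sgraph) :
    (#|Gam| < #|F|)%N -> balanced_iterated_blow_up F Gam
| BIB_split (Gam : sgraph) (W : F -> {set Gam}) :
    blow_up_parts W -> balanced_parts W ->
    (forall i, balanced_iterated_blow_up F (induced (W i))) ->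
    balanced_iterated_blow_up F Gam.

Definition cayley_adj (G : finZmodType) (L : {set G}) : rel G :=
  [rel x y | (x != y) && (x - y \in L)].

Lemma cayley_adj_sym (G : finZmodType) (L : {set G}) :
  (forall x, x \in L -> - x \in L) -> symmetric (cayley_adj L).
Proof.
move=> L_opp x y; rewrite /cayley_adj /= eq_sym; congr (_ && _).
by apply/idP/idP => /L_opp; rewrite opprB.
Qed.

Lemma cayley_adj_irrefl (G : finZmodType) (L : {set G}) :
  irreflexive (cayley_adj L).
Proof. by move=> x; rewrite /cayley_adj /= eqxx. Qed.

Definition cayley (G : finZmodType) (L : {set G})
    (L_opp : forall x, x \in L -> - x \in L) : sgraph :=
  SGraph (cayley_adj_sym L_opp) (@cayley_adj_irrefl G L).

Definition opp_pairs (G : finZmodType) : {set {set G}} :=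
  [set [set g; - g] | g in [set~ 0]].

Definition opp_pair (G : finZmodType) : finType :=
  {P : {set G} | P \in opp_pairs G}.

(* An outcome of the random procedure is the set of the included pairs. *)
Definition connection_set (G : finZmodType) (S : {set opp_pair G}) : {set G} :=
  \bigcup_(P in S) val P.

Lemma connection_set_opp (G : finZmodType) (S : {set opp_pair G}) x :
  x \in connection_set S -> - x \in connection_set S.
Proof.
case/bigcupP => P PS xP; apply/bigcupP; exists P => //.
have /imsetP [g _ defP] := valP P; move: xP; rewrite defP !inE.
by case/orP => /eqP ->; rewrite ?opprK eqxx ?orbT.
Qed.

Definition random_cayley (G : finZmodType) (S : {set opp_pair G}) : sgraph :=
  cayley (@connection_set_opp G S).

(* Each pair is included independently with probability [p]. *)
Definition outcome_weight (R : realType) (G : finZmodType) (p : R)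
    (S : {set opp_pair G}) : R :=
  \prod_(P : opp_pair G) (if P \in S then p else 1 - p).

Definition outcome_prob (R : realType) (G : finZmodType) (p : R)
    (E : {set opp_pair G} -> Prop) : R :=
  \sum_(S : {set opp_pair G} | `[< E S >]) outcome_weight p S.

(* Main.v *)
Require Import Defs.
From mathcomp Require Import all_boot all_order all_algebra.
From mathcomp Require Import boolp reals sequences exp.
From mathcomp Require Import zify ring lra.
Set Implicit Arguments.
Unset Strict Implicit.
Unset Printing Implicit Defensive.
Import Order.TTheory GRing.Theory Num.Theory.


(** With high probability the host graph is pseudorandom: any two elements are
    distinguished by linearly many others, consistent partial relabellings are
    close to maps [x -> c +- x], and there is no large homogeneous pair of tuples.
    Let [Gam] be extremal on at least [K = #|G|] vertices.  Replacing a vertex by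
    a clone of another one shows that every vertex lies in about the average
    number of copies of [H].  A copy, restricted to a small separating set [Q],
    splits the vertices of [Gam] into [K] candidate classes; were these classes
    unbalanced, a potential inequality would bound the number of extensions of
    the partial copy below that of a balanced blow-up.  Pseudorandomness makes
    the partitions obtained from different copies agree up to a symmetry
    [x -> c +- x] of the host graph, which labels every vertex of [Gam] by an
    element of [G].  Flipping all pairs that contradict the labelling would
    increase the number of copies, so [Gam] is a blow-up.  Cloning between a
    largest and a smallest part gives balance, and each part is again extremal,
    so induction on the number of vertices applies. *)

(** * Copies and embeddings *)

Local Open Scope nat_scope.

(** [Gam] may have barely more than [K] vertices, so every loss has to be a factor independent of
    [n]. With [p'] the smaller of [p] and [1 - p], a set [Q] separating all labels has size [q]
    about [log K / p']. Fixing the copy on it costs a factor [K ^ O(q)], which the potential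
    inequality converts into [O(q * l)] damaged classes out of [K]. [H] lacks [r] labels, yet the
    whole host is blown up: translations spread the missing labels evenly, so each label is avoided
    by a share [r / K] of the embeddings. This comes with a factor [8 ^ r], at most [K ^ (3/4)] when
    [r] is at most a quarter of [log K]; the remaining quarter power pays for the constants. The
    exponent 1/5 stems from the greedy choice of a tuple that contradicts rigidity. To create enough
    unpreserved differences its length [rho] is about [log K / p' ^ 2]; a kept vertex has up to
    [be * a] inconsistencies, [be] being about [(log K / p') ^ 2]; and [rho * be] has to stay below
    a constant times [p' * K]. So [p' ^ 5 * K] has to beat a power of [log K]. *)

Section Embeddings.
Variables (G V : finType) (A : {set G}) (h : rel G) (e : rel V) (v0 : V).

Definition is_emb (f : G -> V) :=
  [forall x in A, forall y in A,
    (x != y) ==> (f x != f y) && (e (f x) (f y) == h x y)].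

(* Maps take the junk value [v0] outside [A], so that they are counted once. *)
Definition embs : {set {ffun G -> V}} :=
  [set f : {ffun G -> V} | [forall (x | x \notin A), f x == v0] && is_emb f].

Definition embs_in (U : {set V}) := [set f in embs | f @: A \subset U].

Lemma is_embP (f : G -> V) :
  reflect (forall x y, x \in A -> y \in A -> x != y ->
             f x != f y /\ e (f x) (f y) = h x y) (is_emb f).
Proof.
apply: (iffP forall_inP) => [H x y xA yA xy | H x xA].
  by have /forall_inP/(_ y yA)/implyP/(_ xy)/andP [-> /eqP ->] := H x xA.
apply/forall_inP => y yA; apply/implyP => xy.
by have [-> ->] := H x y xA yA xy; rewrite eqxx.
Qed.

Lemma embsP (f : {ffun G -> V}) :
  reflect ((forall x, x \notin A -> f x = v0) /\ is_emb f) (f \in embs).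
Proof.
rewrite inE; apply: (iffP andP) => -[H Hf]; split=> //.
  by move=> x xA; apply/eqP; move/forall_inP: H; apply.
by apply/forall_inP => x xA; rewrite H.
Qed.

Lemma is_emb_inj f : is_emb f -> {in A &, injective f}.
Proof.
move=> /is_embP H x y xA yA fxy; apply: contraTeq isT => xy.
by have [/eqP] := H x y xA yA xy.
Qed.

Lemma is_emb_eq f g : {in A, f =1 g} -> is_emb f = is_emb g.
Proof.
move=> fg; apply/is_embP/is_embP => H x y xA yA xy.
  by rewrite -!fg //; apply: H.
by rewrite !fg //; apply: H.
Qed.

Lemma card_emb_img f : is_emb f -> #|f @: A| = #|A|.
Proof. by move=> /is_emb_inj; apply: card_in_imset. Qed.

Lemma in_embs_in U (f : {ffun G -> V}) :
  (f \in embs_in U) = (f \in embs) && (f @: A \subset U).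
Proof. by rewrite inE. Qed.

Lemma embs_in_setT : embs_in setT = embs.
Proof. by apply/setP => f; rewrite inE subsetT andbT. Qed.

End Embeddings.

Lemma is_emb_comp (F G V : finType) (A : {set F}) (B : {set G}) h h' e
    (f : F -> G) (g : G -> V) :
  is_emb A h h' f -> is_emb B h' e g -> f @: A \subset B ->
  is_emb A h e (g \o f).
Proof.
move=> /is_embP Hf /is_embP Hg /subsetP sub; apply/is_embP => x y xA yA xy /=.
have [fxy efxy] := Hf x y xA yA xy.
by have [-> ->] := Hg (f x) (f y) (sub _ (imset_f _ xA)) (sub _ (imset_f _ yA)) fxy.
Qed.

Section Copies.
Variables (F : sgraph) (A : {set F}) (g0 : F).

Definition auts := embs_in A (@adj F) (@adj F) g0 A.

Lemma auts_gt0 : 0 < #|auts|.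
Proof.
apply/card_gt0P; exists [ffun x => if x \in A then x else g0]; rewrite in_embs_in.
apply/andP; split; last first.
  by apply/subsetP => _ /imsetP [x xA ->]; rewrite ffunE xA.
apply/embsP; split=> [x /negbTE xA|]; first by rewrite ffunE xA.
by apply/is_embP => x y xA yA xy; rewrite !ffunE xA yA.
Qed.

(** An embedding [f] with the image of [psi] differs from [psi] by the automorphism [psi^-1 o f], so
    composing [psi] with [auts] yields each of them once. *)
Lemma card_embs_onto (V : finType) (e : rel V) v0 (psi : F -> V) :
  is_emb A (@adj F) e psi ->
  #|[set f in embs A (@adj F) e v0 | f @: A == psi @: A]| = #|auts|.
Proof.
move=> Epsi; have injp := is_emb_inj Epsi.
pose T (th : {ffun F -> F}) := [ffun x => if x \in A then psi (th x) else v0].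
have T_inj : {in auts &, injective T}.
  move=> th1 th2; rewrite !in_embs_in => /andP [/embsP [D1 _] /subsetP S1].
  move=> /andP [/embsP [D2 _] /subsetP S2] /ffunP E; apply/ffunP => x.
  have := E x; rewrite !ffunE; case: ifP => xA; last first.
    by rewrite D1 ?xA // D2 ?xA.
  by apply: injp; [apply: S1 | apply: S2]; apply: imset_f.
rewrite -(card_in_imset T_inj); apply: eq_card => f.
apply/idP/imsetP => [|[th]].
  rewrite in_set => /andP [/embsP [D Ef] /eqP im].
  pose inv v := odflt g0 [pick a in A | psi a == v].
  have invP x : x \in A -> (inv (f x) \in A) * (psi (inv (f x)) = f x).
    move=> xA; rewrite /inv; case: pickP => /= [a /andP [aA /eqP] //|].
    have : f x \in psi @: A by rewrite -im imset_f.
    by case/imsetP => a aA -> /(_ a); rewrite aA eqxx.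
  exists [ffun x => if x \in A then inv (f x) else g0].
    rewrite in_embs_in; apply/andP; split; last first.
      by apply/subsetP => _ /imsetP [x xA ->]; rewrite ffunE xA invP.
    apply/embsP; split=> [x /negbTE xA|]; first by rewrite ffunE xA.
    apply/is_embP => x y xA yA xy; rewrite !ffunE xA yA.
    have [fxy efxy] := is_embP _ _ _ _ Ef x y xA yA xy.
    have ixy : inv (f x) != inv (f y).
      by apply: contraNneq fxy => E; rewrite -(invP x xA) -(invP y yA) E.
    have [_ <-] := is_embP _ _ _ _ Epsi _ _ (invP x xA).1 (invP y yA).1 ixy.
    by rewrite !invP.
  by apply/ffunP => x; rewrite !ffunE; case xA: (x \in A); [rewrite invP | rewrite D ?xA].
rewrite in_embs_in => /andP [/embsP [D Eth] /[dup] S /subsetP Ss] ->.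
have Tpsi : {in A, T th =1 psi \o th} by move=> x xA; rewrite ffunE xA.
rewrite in_set; apply/andP; split.
  apply/embsP; split=> [x /negbTE xA|]; first by rewrite ffunE xA.
  by rewrite (is_emb_eq _ _ Tpsi); apply: is_emb_comp Eth Epsi S.
rewrite (eq_in_imset Tpsi) imset_comp.
have /eqP -> // : th @: A == A by rewrite eqEcard S (card_emb_img Eth) leqnn.
Qed.

(** The injection [i] lets [Gam] sit inside a larger vertex type [V]; in this way graphs on parts of
    [V] are compared without changing the type. *)
Lemma copy_embP (Gam : sgraph) (V : finType) (e : rel V) v0 (i : Gam -> V)
    (S : {set Gam}) :
  injective i -> (forall u v, e (i u) (i v) = adj u v) ->
  reflect (exists2 f, f \in embs A (@adj F) e v0 & f @: A = i @: S)
    `[< graph_iso (induced S) (induced A) >].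
Proof.
move=> inji ei; apply: (iffP (asboolP _)) => [[g [g' gK g'K] Hg] | [f /embsP [D Ef] im]].
  pose f := [ffun x => if insub x is Some a then i (val (g' a)) else v0].
  have fE (a : {x | x \in A}) : f (val a) = i (val (g' a)) by rewrite ffunE valK.
  exists f.
    apply/embsP; split=> [x xA|]; first by rewrite ffunE insubN.
    apply/is_embP => x y xA yA xy.
    rewrite -[x]/(val (exist (fun x => x \in A) x xA)).
    rewrite -[y]/(val (exist (fun x => x \in A) y yA)) !fE ei.
    set a := exist _ x _; set b := exist _ y _; split.
      rewrite (inj_eq inji) (inj_eq val_inj) (can_eq g'K).
      by apply: contraNneq xy => E; apply/eqP; exact: (congr1 val E).
    by have := Hg (g' a) (g' b); rewrite !g'K.
  apply/setP => v; apply/imsetP/imsetP => [[x xA ->]|[u uS ->]].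
    exists (val (g' (exist _ x xA))); first exact: valP.
    by rewrite -fE.
  exists (val (g (exist _ u uS))); first exact: valP.
  by rewrite fE gK.
have fS (a : {x | x \in A}) : {u : {u | u \in S} | f (val a) = i (val u)}.
  apply: cid; have : f (val a) \in i @: S by rewrite -im imset_f ?(valP a).
  by case/imsetP => u uS E; exists (exist _ u uS).
pose g' (a : induced A) : induced S := sval (fS a).
have g'E a : f (val a) = i (val (g' a)) by rewrite /g'; case: (fS a).
have g'_inj : injective g'.
  move=> a b E; apply: val_inj.
  by apply: (is_emb_inj Ef (valP a) (valP b)); rewrite !g'E E.
have [g gK g'K] : bijective g'.
  apply: inj_card_bij => //.
  by rewrite !card_sig -!/(#|_|) -[X in (X <= _)](card_imset _ inji) -im (card_emb_img Ef).
exists g; first by exists g'.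
have g'adj (a b : induced A) : adj (val (g' a)) (val (g' b)) = adj (val a) (val b).
  have [->|ab] := eqVneq a b; first by rewrite !adj_irrefl.
  have [_ <-] := is_embP _ _ _ _ Ef (val a) (val b) (valP a) (valP b) ab.
  by rewrite !g'E ei.
by move=> x y; rewrite -[LHS]/(adj (val (g x)) (val (g y))) -g'adj !g'K.
Qed.

(** Fibring over the image: each copy is the image of [#|auts|] embeddings. Hence maximising copies
    and maximising embeddings is the same problem. *)
Lemma card_embs_in (Gam : sgraph) (V : finType) (e : rel V) v0 (i : Gam -> V) :
  injective i -> (forall u v, e (i u) (i v) = adj u v) ->
  #|embs_in A (@adj F) e v0 (i @: setT)| = #|auts| * induced_copies (induced A) Gam.
Proof.
move=> inji ei; rewrite /induced_copies mulnC -sum_nat_const -sum1_card.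
set C := [set S | _].
have imK (f : {ffun F -> V}) : f @: A \subset i @: setT -> i @: (i @^-1: (f @: A)) = f @: A.
  move=> /subsetP sub; apply/setP => v; apply/imsetP/idP => [[u]|vf].
    by rewrite inE => ? ->.
  by have /imsetP [u _ E] := sub _ vf; exists u => //; rewrite inE -E.
rewrite (partition_big (fun f : {ffun F -> V} => i @^-1: (f @: A)) (mem C)) /=; last first.
  move=> f; rewrite in_embs_in => /andP [Ef sub]; rewrite inE.
  by apply/(copy_embP v0 _ inji ei); exists f => //; rewrite imK.
apply: eq_bigr => S; rewrite inE => /(copy_embP v0 _ inji ei) [g Eg im].
have /embsP [_ Eg'] := Eg.
rewrite -(card_embs_onto v0 Eg') sum1dep_card; apply: eq_card => f; rewrite [RHS]in_set in_set in_embs_in im.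
case: (f \in embs _ _ _ _) => //=.
apply/andP/eqP => [[sub /eqP <-]|E]; first by rewrite imK.
split; first by rewrite E imsetS.
by apply/eqP/setP => u; rewrite inE E mem_imset.
Qed.

End Copies.

Lemma sum_mem (T : finType) (S : {set T}) : \sum_v (v \in S : nat) = #|S|.
Proof.
by rewrite -sum1_card [RHS]big_mkcond; apply: eq_bigr => v _; case: (v \in S).
Qed.

Lemma card_setId_sum (T : finType) (S : {set T}) (P : pred T) :
  #|[set f in S | P f]| = \sum_(f in S) P f.
Proof.
by rewrite -sum1dep_card big_mkcondr; apply: eq_bigr => f _; case: (P f).
Qed.

(** * Degrees in an extremal graph *)

Section Extremal.
Variables (G V : finType) (A : {set G}) (h : rel G) (e : rel V) (v0 : V).
Hypotheses (e_sym : symmetric e) (e_irr : irreflexive e).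

Definition extremal := forall e' : rel V, symmetric e' -> irreflexive e' ->
  #|embs A h e' v0| <= #|embs A h e v0|.
Hypothesis e_max : extremal.

Local Notation E := (embs A h e v0).

Definition deg v := #|[set f in E | v \in f @: A]|.
Definition codeg u v := #|[set f in E | (u \in f @: A) && (v \in f @: A)]|.

(* Turning [v] into a clone of [u] does not create more copies. *)
Lemma zykov u v : u != v -> deg u <= deg v + codeg u v.
Proof.
move=> uv; pose c t := if t == v then u else t.
have cV t : t != v -> c t = t by rewrite /c => /negbTE ->.
pose e' := relpre c e.
have e'_sym : symmetric e' by move=> s t; apply: e_sym.
have e'_irr : irreflexive e' by move=> s; apply: e_irr.
have := e_max e'_sym e'_irr.
set E1 := [set f in E | v \notin f @: A].
set E2 := [set f in E | (u \in f @: A) && (v \notin f @: A)].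
have -> : #|E| = deg v + #|E1|.
  rewrite -(cardsID [set f : {ffun G -> V} | v \in f @: A] E); congr (_ + _).
    by apply: eq_card => f; rewrite !in_set.
  by apply: eq_card => f; rewrite [LHS]in_setD [RHS]in_set in_set andbC.
have -> : deg u = codeg u v + #|E2|.
  rewrite /deg -(cardsID [set f : {ffun G -> V} | v \in f @: A]); congr (_ + _).
    by apply: eq_card => f; rewrite !in_set andbA.
  apply: eq_card => f; rewrite [LHS]in_setD [RHS]in_set !in_set.
  by case: (v \in _); rewrite ?andbF ?andbT.
(* Copies avoiding [v] survive, and copies through [u] but not [v] acquire a twin through the clone.
   The twins hit [v], so the two families are disjoint. *)
suff : #|E1| + #|E2| <= #|embs A h e' v0| by lia.
pose sw (f : {ffun G -> V}) := [ffun x => if (x \in A) && (f x == u) then v else f x].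
have sw_inj : {in E2 &, injective sw}.
  move=> f g; rewrite !in_set => /andP [_ /andP [_ vf]] /andP [_ /andP [_ vg]].
  move=> /ffunP H; apply/ffunP => x; have := H x; rewrite !ffunE.
  have fv (f' : {ffun G -> V}) : v \notin f' @: A -> x \in A -> f' x != v.
    by move=> nf xA; apply: contraNneq nf => <-; apply: imset_f.
  case xA: (x \in A) => //=.
  case: eqP => [->|_]; case: eqP => [-> //|_] //.
    by move=> vg'; have := fv g vg xA; rewrite -vg' eqxx.
  by move=> vf'; have := fv f vf xA; rewrite vf' eqxx.
rewrite -(card_in_imset sw_inj) -cardsUI.
have -> : E1 :&: sw @: E2 = set0.
  apply/eqP; rewrite setI_eq0 -setI_eq0; apply/eqP/setP => f; rewrite !inE.
  apply/negP => /andP [/andP [_ nv] /imsetP [g]].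
  rewrite in_set => /andP [_ /andP [/imsetP [x xA ux] _]] fE.
  by case/negP: nv; apply/imsetP; exists x => //; rewrite fE ffunE xA -ux eqxx.
rewrite cards0 addn0; apply: subset_leq_card; apply/subsetP => f /setUP [].
  rewrite in_set => /andP [/embsP [D /is_embP Ef] vf]; apply/embsP; split=> //.
  apply/is_embP => x y xA yA xy; have [-> <-] := Ef x y xA yA xy.
  by rewrite /e' /= !cV //; apply: contraNneq vf => <-; apply: imset_f.
case/imsetP => g; rewrite in_set => /andP [/embsP [D /is_embP Eg] /andP [_ vg]] ->.
apply/embsP; split=> [x /[dup] /negbTE xA /D <-|]; first by rewrite ffunE xA.
have gv x : x \in A -> g x != v by move=> xA; apply: contraNneq vg => <-; apply: imset_f.
have cs x : x \in A -> c (sw g x) = g x.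
  move=> xA; rewrite ffunE xA /=; case: eqP => [->|_]; first by rewrite /c eqxx.
  by rewrite cV ?gv.
apply/is_embP => x y xA yA xy; have [gxy <-] := Eg x y xA yA xy.
rewrite /e' /= !cs //; split=> //.
by apply: contraNneq gxy => H; rewrite -(cs x) // -(cs y) // H.
Qed.

Lemma sum_deg : \sum_v deg v = #|A| * #|E|.
Proof.
transitivity (\sum_v \sum_(f in E) (v \in f @: A)).
  by apply: eq_bigr => v _; rewrite /deg card_setId_sum.
rewrite exchange_big mulnC -sum_nat_const; apply: eq_bigr => f /embsP [_ Ef].
by rewrite -(card_emb_img Ef) sum_mem.
Qed.

Lemma sum_codeg v : \sum_(u | u != v) codeg u v + deg v = #|A| * deg v.
Proof.
have -> : deg v = codeg v v by apply: eq_card => f; rewrite !in_set andbb.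
transitivity (\sum_u codeg u v); first by rewrite [RHS](bigD1 v) //= addnC.
transitivity (\sum_u \sum_(f in [set f in E | v \in f @: A]) (u \in f @: A)).
  apply: eq_bigr => u _; rewrite /codeg -card_setId_sum.
  by apply: eq_card => f; rewrite !inE -!andbA; do !bool_congr.
rewrite exchange_big mulnC.
have -> : codeg v v = #|[set f in E | v \in f @: A]|.
  by apply: eq_card => f; rewrite !in_set andbb.
rewrite -sum_nat_const; apply: eq_bigr => f; rewrite in_set => /andP [/embsP [_ Ef] _].
by rewrite -(card_emb_img Ef) sum_mem.
Qed.

(** [zykov] summed over [u]: the degrees add up to [#|A| * #|E|], and the codegrees with [v] to at
    most [#|A| * deg v]. *)
Lemma min_deg v : #|A| * #|E| <= (#|V| + #|A|) * deg v.
Proof.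
rewrite -sum_deg (bigD1 v) //=.
have : \sum_(u | u != v) deg u <= \sum_(u | u != v) (deg v + codeg u v).
  by apply: leq_sum => u uv; apply: zykov.
rewrite big_split /= sum_nat_const cardC1.
have := sum_codeg v; have : 0 < #|V| by apply/card_gt0P; exists v.
by case: #|V| => // m _; rewrite mulnDl mulSn /=; lia.
Qed.

(** [min_deg] averaged over the roles that [v] can play in a copy, with [n + #|A| <= 2 * n]. It
    supplies the large family of copies from which the label of an arbitrary vertex is read. *)
Lemma exists_image_at v : 0 < #|A| <= #|V| ->
  exists2 a, a \in A & #|E| <= 2 * #|V| * #|[set f in E | f a == v]|.
Proof.
move=> /andP [A0 AV]; apply/exists_inP; apply: contraT; rewrite negb_exists_in.
move=> /forall_inP H.
have d : deg v <= \sum_(a in A) #|[set f in E | f a == v]|.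
  under eq_bigr do rewrite card_setId_sum.
  rewrite exchange_big /deg card_setId_sum; apply: leq_sum => f _ /=.
  by case: imsetP => // -[a aA ->]; rewrite (bigD1 a) //= eqxx.
have : \sum_(a in A) (2 * #|V| * #|[set f in E | f a == v]|).+1 <= \sum_(a in A) #|E|.
  by apply: leq_sum => a aA; have := H a aA; rewrite -ltnNge.
rewrite sum_nat_const.
under eq_bigr do rewrite -addn1.
rewrite big_split /= sum_nat_const muln1 -big_distrr /=.
have nk : #|V| + #|A| <= 2 * #|V| by lia.
move=> h3; have := leq_trans h3 (leq_trans (min_deg v) (leq_mul nk d)).
by rewrite -[leqRHS]addn0 leq_add2l leqNgt A0.
Qed.

End Extremal.

(** * The potential inequality *)

Local Open Scope ring_scope.

Section Potential.
Variables (R : realType) (a : nat).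
Hypothesis a_gt0 : (0 < a)%N.

(** With this base, [w <= a * lam ^ (w - a)] is an equality at [w = a] and at [w = a + 1], the part
    sizes of a balanced blow-up, so the product bound loses nothing there. *)
Definition lam : R := 1 + a%:R^-1.

Let aR_gt0 : 0 < a%:R :> R. Proof. by rewrite ltr0n. Qed.
Let aV_gt0 : 0 < a%:R^-1 :> R. Proof. by rewrite invr_gt0. Qed.

Lemma bernoulli (x : R) n : -1 <= x -> 1 + n%:R * x <= (1 + x) ^+ n.
Proof.
move=> x1; elim: n => [|n IH]; first by rewrite mul0r addr0 expr0.
rewrite exprSr; have x0 : 0 <= 1 + x by lra.
apply: le_trans (ler_wpM2r x0 IH).
by rewrite -natr1; have := sqr_ge0 x; have : 0 <= n%:R :> R by []; rewrite expr2; nra.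
Qed.

Lemma lam_ge1 : 1 <= lam. Proof. by rewrite /lam lerDl ltW. Qed.
Lemma lam_gt0 : 0 < lam. Proof. exact: lt_le_trans ltr01 lam_ge1. Qed.
Lemma lam_le2 : lam <= 2.
Proof.
rewrite /lam (_ : 2 = 1 + 1 :> R) //; apply: lerD => //.
by rewrite invf_le1 // ler1n.
Qed.

Lemma lamX_ge n : 1 + n%:R / a%:R <= lam ^+ n.
Proof. by apply: bernoulli; rewrite (le_trans _ (ltW aV_gt0)) // lerN10. Qed.

Lemma lam_ge2 : 2 <= lam ^+ a.
Proof. by apply: le_trans (lamX_ge a); rewrite divff ?gt_eqF //; lra. Qed.

Lemma lamVX_ge n : 1 - n%:R / a.+1%:R <= lam ^- n.
Proof.
have -> : lam ^- n = (1 - a.+1%:R^-1) ^+ n.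
  rewrite -exprVn; congr (_ ^+ _); rewrite /lam -natr1; field.
  by rewrite -[1]/(1%:R) -!natrD !pnatr_eq0 !addn1 ?andbT -?lt0n.
rewrite -[- (n%:R / _)]mulrN; apply: bernoulli.
by rewrite lerN2 invf_le1 ?ltr0Sn // ler1n.
Qed.

(** Bernoulli for [lam^-1 = 1 - 1 / (a + 1)] bounds the power with exponent [a / 2], rounded up, by
    2; then square. *)
Lemma lam_le4 : lam ^+ a <= 4.
Proof.
have H : lam ^+ uphalf a <= 2.
  have := lamVX_ge (uphalf a); set x := lam ^+ _ => Hx.
  have x0 : 0 < x by rewrite exprn_gt0 // lam_gt0.
  have : (uphalf a)%:R / a.+1%:R <= 2^-1 :> R.
    rewrite ler_pdivrMr ?ltr0Sn // mulrC ler_pdivlMr ?ltr0n //.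
    rewrite -natrM ler_nat uphalf_half; have := odd_double_half a.
    by case: (odd a) => /=; lia.
  move=> H2; have : 2^-1 <= x^-1 by apply: le_trans Hx; move: H2; set y := _ / _ => H2; lra.
  by rewrite lef_pV2 // posrE.
have -> : 4 = 2 * 2 :> R by rewrite -natrM.
apply: le_trans (_ : lam ^+ (uphalf a + uphalf a) <= _).
  apply: ler_weXn2l; first exact: lam_ge1.
  rewrite uphalf_half; have := odd_double_half a.
  by case: (odd a) => /=; lia.
by rewrite exprD ler_pM ?exprn_ge0 // ltW // lam_gt0.
Qed.

(** As functions of [w], the right side is convex, the left side is linear, and they meet at [a] and
    [a + 1]. The proof uses Bernoulli upwards and downwards from [a]. *)
Lemma pot_basic (w : nat) : w%:R * lam ^+ a <= a%:R * lam ^+ w.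
Proof.
have [aw|/ltnW wa] := leqP a w.
  have -> : lam ^+ w = lam ^+ (w - a) * lam ^+ a by rewrite -exprD subnK.
  rewrite mulrA ler_pM2r ?exprn_gt0 ?lam_gt0 //.
  apply: le_trans (ler_wpM2l (ltW aR_gt0) (lamX_ge _)).
  by rewrite mulrDr mulr1 mulrCA divff ?gt_eqF // mulr1 -natrD ler_nat; lia.
have -> : lam ^+ a = lam ^+ (a - w) * lam ^+ w by rewrite -exprD subnK.
rewrite mulrA ler_pM2r ?exprn_gt0 ?lam_gt0 //.
rewrite -ler_pdivlMr ?exprn_gt0 ?lam_gt0 //.
apply: le_trans (ler_wpM2l (ltW aR_gt0) (lamVX_ge _)).
rewrite mulrBr mulr1 natrB //.
have : a%:R * ((a%:R - w%:R) / a.+1%:R) <= a%:R - w%:R :> R.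
  rewrite mulrCA ler_piMr ?subr_ge0 ?ler_nat //.
  by rewrite ler_pdivrMr ?ltr0Sn // mul1r ler_nat.
by set y := a%:R * _ => ?; lra.
Qed.

Lemma pot_small (w : nat) : (10 * w < a)%N -> 2 * (w%:R * lam ^+ a) <= a%:R * lam ^+ w.
Proof.
move=> wa; apply: le_trans (_ : a%:R * 1 <= _); last first.
  by rewrite ler_pM2l // exprn_ege1 // lam_ge1.
have w0 : 0 <= w%:R :> R by [].
have : 10 * w%:R <= a%:R :> R by rewrite -natrM ler_nat ltnW.
by have := lam_le4; nra.
Qed.

Lemma pot_large (w : nat) : (16 * a < w)%N ->
  w%:R * lam ^+ a * lam ^+ w./2 <= a%:R * lam ^+ w.
Proof.
move=> aw; set c := (w - w./2 - a)%N.
have -> : lam ^+ w = lam ^+ c * (lam ^+ a * lam ^+ w./2).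
  by rewrite -!exprD; congr (_ ^+ _); rewrite /c; lia.
rewrite -mulrA [leRHS]mulrA ler_pM2r ?mulr_gt0 ?exprn_gt0 ?lam_gt0 //.
(* Bernoulli for [lam ^ c] itself yields only [w / 2] where [w] is needed. The square of the bound
   for half the exponent is quadratic in [w], which suffices beyond [16 * a]. *)
pose j := c./2.
apply: le_trans (_ : a%:R * (1 + j%:R / a%:R) ^+ 2 <= _); last first.
  rewrite ler_pM2l //; apply: le_trans (_ : (lam ^+ j) ^+ 2 <= _).
    rewrite lerXn2r ?nnegrE ?exprn_ge0 ?(ltW lam_gt0) ?lamX_ge //.
    by rewrite addr_ge0 // divr_ge0.
  by rewrite -exprM; apply: ler_weXn2l; [exact: lam_ge1 | rewrite /j; lia].
have jw : 7 * w%:R <= 32 * j%:R + 16 * a%:R :> R.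
  rewrite -!natrM -natrD ler_nat /j /c; have := odd_double_half w.
  have := odd_double_half (w - w./2 - a)%N; move: a_gt0 aw; lia.
have aw' : 16 * a%:R <= w%:R :> R by rewrite -natrM ler_nat ltnW.
rewrite -(ler_pM2l aR_gt0) mulrA -expr2 -exprMn mulrDr mulr1 mulrCA divff ?gt_eqF // mulr1.
have jg : 0 <= j%:R :> R by [].
move: jw aw' aR_gt0 jg; set x := w%:R; set y := a%:R; set z := j%:R => *.
have : (7 * x + 16 * y) / 32 <= y + z by lra.
have p0 : 0 <= (7 * x + 16 * y) / 32 by lra.
move=> H; have : ((7 * x + 16 * y) / 32) ^+ 2 <= (y + z) ^+ 2.
  by rewrite lerXn2r // nnegrE; lra.
apply: le_trans; rewrite expr2; nra.
Qed.

Section Product.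
Variables (I : finType) (X : {set I}) (w : I -> nat).

(** The gain over the plain product bound: a factor 2 for each class below [a / 10], and [lam] to
    half its size for each class above [16 * a]. An upper bound on this gain will limit both kinds
    of classes. *)
Lemma pot_prod_slack :
  2 ^+ #|[set x in X | (10 * w x < a)%N]|
    * lam ^+ (\sum_(x in X | (16 * a < w x)%N) (w x)./2)%N
    * \prod_(x in X) (w x)%:R * lam ^+ (a * #|X|)
  <= a%:R ^+ #|X| * lam ^+ (\sum_(x in X) w x)%N.
Proof.
have -> : 2 ^+ #|[set x in X | (10 * w x < a)%N]| =
    \prod_(x in X) (if (10 * w x < a)%N then 2 else 1) :> R.
  rewrite -big_mkcondr /= -prodr_const; apply: eq_bigl => x; by rewrite inE.
rewrite big_mkcondr /= !expr_sum.
have -> : lam ^+ (a * #|X|) = \prod_(x in X) lam ^+ a by rewrite prodr_const exprM.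
rewrite -[a%:R ^+ #|X|]prodr_const -!big_split /=.
apply: ler_prod => x _; apply/andP; split.
  by rewrite !mulr_ge0 ?exprn_ge0 ?(ltW lam_gt0) //; case: ifP.
case: ltnP => sm; case: ltnP => lg.
- by exfalso; move: a_gt0 sm lg; lia.
- by rewrite expr0 mulr1 -mulrA pot_small.
- by rewrite mul1r mulrC mulrA -mulrC mulrC -mulrA [_ * (_ * _)]mulrA; apply: le_trans (pot_large lg); rewrite le_eqVlt; apply/orP; left; apply/eqP; ring.
- by rewrite expr0 !mul1r pot_basic.
Qed.

Lemma pot_prod :
  \prod_(x in X) (w x)%:R * lam ^+ (a * #|X|)
  <= a%:R ^+ #|X| * lam ^+ (\sum_(x in X) w x)%N.
Proof.
apply: le_trans pot_prod_slack; rewrite ler_wpM2r ?exprn_ge0 ?(ltW lam_gt0) //.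
rewrite ler_peMl ?prodr_ge0 // mulr_ege1 ?exprn_ege1 ?lam_ge1 //.
by rewrite ler1n.
Qed.

End Product.
End Potential.

(** * Extensions of partial embeddings *)

Local Open Scope nat_scope.

Lemma card_eq_sum (T : finType) (P : pred T) : #|[set x | P x]| = \sum_x P x.
Proof. by rewrite -sum_mem; apply: eq_bigr => x _; rewrite inE. Qed.

Section Structure.
Variables (R : realType) (G : finZmodType) (V : finType) (A : {set G}).
Variables (h : rel G) (e : rel V) (v0 : V).
Local Notation K := #|G|.
Local Notation n := #|V|.
Local Notation a := (#|V| %/ #|G|).
Local Notation r := (#|G| - #|A|).
Local Notation E := (embs A h e v0).

(* Up to a factor [2 ^ r], the number of transversal copies in a balanced
   blow-up with parts of sizes [a] and [a + 1]. *)
Definition optimum : R := a%:R ^+ #|A| * lam R a ^+ (#|V| %% #|G|).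

(* [cand f Q x]: the vertices that see [f @: Q] as [x] sees [Q]. *)
Definition cand (f : G -> V) (Q : {set G}) (x : G) : {set V} :=
  [set v | [forall z in Q, (v != f z) && (e v (f z) == h x z)]].

Definition ext (f : G -> V) (Q : {set G}) : {set {ffun G -> V}} :=
  [set g in E | [forall z in Q, g z == f z]].

Lemma candP f (Q : {set G}) x v :
  reflect (forall z, z \in Q -> v != f z /\ e v (f z) = h x z) (v \in cand f Q x).
Proof.
rewrite inE; apply: (iffP forall_inP) => H z zQ; have := H z zQ.
  by case/andP => -> /eqP ->.
by case=> -> ->; rewrite eqxx.
Qed.

Lemma extP f (Q : {set G}) g :
  reflect (g \in E /\ forall z, z \in Q -> g z = f z) (g \in ext f Q).
Proof.
apply: (iffP setIdP) => -[gE H]; split=> //.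
  by move=> z zQ; apply/eqP; move/forall_inP: H; apply.
by apply/forall_inP => z zQ; rewrite H.
Qed.

Lemma ext_cand (f : G -> V) (Q : {set G}) g x : Q \subset A -> g \in ext f Q -> x \in A :\: Q -> g x \in cand f Q x.
Proof.
move=> /subsetP QA /extP [/embsP [_ /is_embP Eg] gf] /setDP [xA xQ].
apply/candP => z zQ; rewrite -gf //; apply: Eg => //; first exact: QA.
by apply: contraNneq xQ => ->.
Qed.

Lemma ext_self (f : {ffun G -> V}) (Q : {set G}) : f \in E -> f \in ext f Q.
Proof. by move=> fE; apply/extP. Qed.

Lemma card_ext_le (f : G -> V) (Q : {set G}) : Q \subset A ->
  #|ext f Q| <= \prod_(x in A :\: Q) #|cand f Q x|.
Proof.
move=> QA; pose F x := if x \in A :\: Q then cand f Q x else [set (if x \in Q then f x else v0)].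
apply: leq_trans (_ : #|[set g : {ffun G -> V} in family F]| <= _).
  apply: subset_leq_card; apply/subsetP => g gE; rewrite inE; apply/familyP => x.
  rewrite /F; case: ifP => xX; first exact: ext_cand gE xX.
  have /extP [/embsP [D _] gf] := gE; rewrite inE.
  case: ifP => xQ; first by rewrite gf.
  by rewrite D //; move: xX; rewrite inE xQ => /negbT.
rewrite cardsE card_family foldrE big_image /= (bigID (mem (A :\: Q))) /=.
rewrite [X in _ * X]big1 ?muln1; last by move=> x /negbTE xX; rewrite /F xX cards1.
by rewrite leq_eqVlt; apply/orP; left; apply/eqP/eq_bigr => x xX; rewrite /F xX.
Qed.

Variables (q l : nat) (Q0 : {set G}).

(** [q] is the scale of all losses, which are bounded by powers [K ^ (c * q)]; [r + 10 <= q] lets it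
    absorb factors such as [2 ^ r] and [K ^ 2]. The number [l] turns powers of [K] into powers of
    2. *)
Record setup : Prop := Setup {
  K_l : K <= 2 ^ l;
  K_big : 2 ^ 10 <= K;
  r_q : r + 10 <= q;
  K_n : K <= n;
  sep : forall x y, x \in A :\: Q0 -> y \in A :\: Q0 -> x != y ->
    exists2 z, z \in Q0 & h x z != h y z;
  h_sym : symmetric h;
  e_sym : symmetric e }.
Hypothesis hyp : setup.
Let K_l := K_l hyp.
Let K_big := K_big hyp.
Let r_q := r_q hyp.
Let K_n := K_n hyp.
Let sep := sep hyp.

(** The restriction of [f] to [Q] has its fair share of extensions: [n ^ #|Q|] counts the maps on
    [Q], and [K ^ (5 * q)] is the tolerated loss. The bound [q + 2] leaves room for two vertices
    beside a separating set. *)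
Definition good (f : {ffun G -> V}) (Q : {set G}) := [/\ f \in E, Q0 \subset Q, Q \subset A, #|Q| <= q + 2 &
  (optimum <= (#|ext f Q| * n ^ #|Q| * K ^ (5 * q))%:R)%R].

Lemma a_gt0 : 0 < a. Proof. by rewrite divn_gt0 ?K_n // (leq_trans _ K_big). Qed.
Lemma n_le : n <= 2 * a * K.
Proof. by rewrite {1}(divn_eq n K); have := ltn_mod n K; have := a_gt0; nia. Qed.

Lemma cand_disj f (Q : {set G}) x y v : Q0 \subset Q -> x \in A :\: Q -> y \in A :\: Q ->
  v \in cand f Q x -> v \in cand f Q y -> x = y.
Proof.
move=> /subsetP sQ /setDP [xA xQ] /setDP [yA yQ] /candP vx /candP vy.
apply: contraTeq isT => xy.
have [||z zQ /eqP] := sep _ _ xy; rewrite ?inE ?xA ?yA ?andbT //.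
- by apply: contra xQ; apply: sQ.
- by apply: contra yQ; apply: sQ.
- by have [_ <-] := vx z (sQ _ zQ); have [_ <-] := vy z (sQ _ zQ).
Qed.

Lemma sum_cand f (Q : {set G}) (P : pred G) : Q0 \subset Q ->
  \sum_(x in A :\: Q | P x) #|cand f Q x| =
  #|[set v | [exists x, [&& x \in A :\: Q, P x & v \in cand f Q x]]]|.
Proof.
move=> sQ; rewrite card_eq_sum.
under eq_bigr do rewrite -sum_mem.
rewrite exchange_big; apply: eq_bigr => v _ /=.
case: existsP => [[x /and3P [xX Px vx]]|H].
  rewrite (bigD1 x) ?xX //= vx big1 // => y /andP [/andP [yX Py] yx].
  by case: (boolP (v \in _)) => // vy; rewrite (cand_disj sQ yX xX vy vx) eqxx in yx.
rewrite big1 // => x /andP [xX Px]; case: (boolP (v \in _)) => // vx.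
by case: H; exists x; rewrite xX Px.
Qed.

Lemma cand_gt0 f Q x : good f Q -> x \in A :\: Q -> 0 < #|cand f Q x|.
Proof.
case=> fE _ QA _ _ xX; apply/card_gt0P; exists (f x).
by apply: ext_cand xX => //; apply: ext_self.
Qed.

(** The price of replacing [n] by [a] on [Q], where [n <= 2 * a * K], and of the [r + m] labels
    without a class, each worth [lam ^ a <= 4]. *)
Lemma thr_bound m : m <= q + 2 -> (2 * K) ^ m * 4 ^ (r + m) <= K ^ (3 * q).
Proof.
move=> mq; apply: leq_trans (_ : (2 * K) ^ (q + 2) * 4 ^ (r + (q + 2)) <= _).
  by apply: leq_mul; rewrite leq_pexp2l //; lia.
rewrite expnMn -(expnM 2 2) mulnAC -expnD.
apply: leq_trans (_ : (2 ^ 10) ^ q * K ^ (q + 2) <= _).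
  by rewrite leq_mul2r -expnM leq_pexp2l ?orbT //; lia.
apply: leq_trans (_ : K ^ q * K ^ (q + 2) <= _); first by rewrite leq_mul2r leq_exp2r ?K_big ?orbT; lia.
by rewrite -expnD leq_pexp2l //; lia.
Qed.

Local Open Scope ring_scope.
Local Notation lm := (lam R a).

(** [pot_prod_slack] for the candidate classes: they are disjoint, so their sizes sum to at most
    [n], and uncovered vertices add to the gain. The 8 is the 5 of [good] plus the 3 of
    [thr_bound]. *)
Lemma good_slack f Q : good f Q ->
  2 ^+ #|[set x in A :\: Q | (10 * #|cand f Q x| < a)%N]|
    * lm ^+ (n - \sum_(x in A :\: Q) #|cand f Q x|
             + \sum_(x in A :\: Q | (16 * a < #|cand f Q x|)%N) #|cand f Q x|./2)%N
    * \prod_(x in A :\: Q) #|cand f Q x|%:R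
  <= (K ^ (8 * q))%:R * #|ext f Q|%:R.
Proof.
move=> [fE sQ QA cQ Hopt]; set X := A :\: Q; set w := fun x => #|cand f Q x|.
have a0 := a_gt0; have lm0 := lam_gt0 R a0.
have cX : (#|X| + #|Q| = #|A|)%N by rewrite /X cardsD (setIidPr QA); have := subset_leq_card QA; lia.
have AK : (#|A| <= K)%N by apply: max_card.
have wn : (\sum_(x in X) w x <= n)%N.
  by have := sum_cand f xpredT sQ; rewrite (eq_bigl (mem X)) => [->|x]; rewrite ?max_card ?andbT.
have := pot_prod_slack R a0 X w; set S := 2 ^+ _; set g := (\sum_(x in X | _) _)%N; set P := \prod_(x in X) _.
set W := (\sum_(x in X) w x)%N in wn *; move=> H.
have K0 : 0 < K%:R :> R by rewrite ltr0n (leq_trans _ K_big).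
have aR0 : 0 < a%:R :> R by rewrite ltr0n.
have S1 : S * lm ^+ (n - W + g) * P <= a%:R ^+ #|X| * lm ^+ (n %% K) * 4 ^+ (r + #|Q|).
  rewrite -(ler_pM2r (_ : 0 < lm ^+ (a * #|X|))); last by rewrite exprn_gt0.
  apply: le_trans (_ : a%:R ^+ #|X| * lm ^+ W * lm ^+ (n - W) <= _).
    rewrite exprD; apply: le_trans (ler_wpM2r (exprn_ge0 (n - W) (ltW lm0)) H).
    by rewrite le_eqVlt; apply/orP; left; apply/eqP; ring.
  rewrite -[leLHS]mulrA -exprD subnKC // -!mulrA ler_pM2l ?exprn_gt0 //.
  have -> : lm ^+ n = lm ^+ (n %% K) * lm ^+ (a * K).
    by rewrite -exprD addnC; congr (_ ^+ _); exact: divn_eq.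
  rewrite ler_pM2l ?exprn_gt0 //.
  have -> : (a * K = a * (r + #|Q|) + a * #|X|)%N by rewrite -mulnDr; congr (_ * _)%N; clear -cX AK; lia.
  rewrite exprD ler_pM2r ?exprn_gt0 // exprM.
  by rewrite lerXn2r ?nnegrE ?exprn_ge0 ?(ltW lm0) // lam_le4.
apply: le_trans S1 _.
rewrite -(ler_pM2r (_ : 0 < a%:R ^+ #|Q|)); last by rewrite exprn_gt0.
have -> : a%:R ^+ #|X| * lm ^+ (n %% K) * 4 ^+ (r + #|Q|) * a%:R ^+ #|Q| = optimum * (4 ^ (r + #|Q|))%:R.
  have -> : optimum = a%:R ^+ #|X| * a%:R ^+ #|Q| * lm ^+ (n %% K) by rewrite -exprD cX.
  by rewrite natrX mulrAC -!mulrA; congr (_ * _); rewrite mulrCA.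
apply: le_trans (ler_wpM2r (ler0n R _) Hopt) _.
rewrite -natrX -!natrM ler_nat.
apply: leq_trans (_ : #|ext f Q| * (2 * a * K) ^ #|Q| * K ^ (5 * q) * 4 ^ (r + #|Q|) <= _)%N.
  have := n_le; rewrite !leq_mul2r => nle; apply/orP; right; apply/orP; right.
  by rewrite leq_mul2l; case: (#|Q|) => [|m]; rewrite ?orbT // leq_exp2r // nle orbT.
have -> : (2 * a * K = a * (2 * K))%N by rewrite [RHS]mulnCA mulnA.
rewrite -[8%N]/(5 + 3)%N mulnDl.
rewrite (expnD K (5 * q)) expnMn; have := thr_bound cQ.
move: (#|ext _ _|) (K ^ (3 * q))%N (K ^ (5 * q))%N (a ^ _)%N ((2 * K) ^ _)%N (4 ^ _)%N.
move=> x y z u v t Hy.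
have -> : (x * (u * v) * z * t = (z * x * u) * (v * t))%N by ring.
by have -> : (z * y * x * u = (z * x * u) * y)%N by [ring]; rewrite leq_mul2l Hy orbT.
Qed.

(** Among all ways to pick one candidate per class, a share of at least [K ^ - (8 * q)] are
    extensions. This lower bound is what makes wrong adjacencies between classes rare. *)
Lemma good_dense f Q : good f Q ->
  \prod_(x in A :\: Q) #|cand f Q x|%:R <= (K ^ (8 * q))%:R * #|ext f Q|%:R :> R.
Proof.
move=> /good_slack; apply: le_trans; rewrite ler_peMl ?prodr_ge0 //.
by rewrite mulr_ege1 ?exprn_ege1 ?lam_ge1 ?a_gt0 // ler1n.
Qed.

Lemma good_slack2 f Q : good f Q ->
  2 ^+ #|[set x in A :\: Q | (10 * #|cand f Q x| < a)%N]|
    * lm ^+ (n - \sum_(x in A :\: Q) #|cand f Q x|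
             + \sum_(x in A :\: Q | (16 * a < #|cand f Q x|)%N) #|cand f Q x|./2)%N
  <= (2 ^ (8 * q * l))%:R.
Proof.
move=> gf; have [fE sQ QA cQ Hopt] := gf.
have P0 : 0 < \prod_(x in A :\: Q) #|cand f Q x|%:R :> R.
  by apply: prodr_gt0 => x xX; rewrite ltr0n cand_gt0.
rewrite -(ler_pM2r P0); apply: le_trans (good_slack gf) _.
apply: ler_pM => //; first by rewrite ler_nat [(8 * q * l)%N]mulnC (expnM 2) leq_exp2r //; clear -r_q; lia.
by rewrite -natr_prod ler_nat card_ext_le.
Qed.

Lemma good_small f Q : good f Q ->
  (#|[set x in A :\: Q | (10 * #|cand f Q x| < a)%N]| <= 8 * q * l)%N.
Proof.
move=> /good_slack2 H; rewrite -(leq_exp2l (m := 2)) // -(ler_nat R) [leLHS]natrX.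
apply: le_trans H; rewrite ler_peMr ?exprn_ge0 // exprn_ege1 // lam_ge1 //.
exact: a_gt0.
Qed.

Definition regular f Q x := (#|cand f Q x| <= 16 * a)%N.

(** As [lam ^ a >= 2], the exponent in [good_slack2] is below [(8 * q * l + 1) * a]. The 3 comes
    from the rounded half of an irregular class, which is at least a third of it. *)
Lemma good_mass f Q : good f Q ->
  (n <= \sum_(x in A :\: Q | regular f Q x) #|cand f Q x| + 3 * (8 * q * l + 1) * a)%N.
Proof.
move=> gf; have := good_slack2 gf; set mu := (n - _ + _)%N => H.
have a0 := a_gt0.
have H2 : (2 : R) ^+ (mu %/ a) <= 2 ^+ (8 * q * l).
  rewrite -[leRHS]natrX; apply: le_trans H; apply: le_trans (_ : lm ^+ mu <= _).
    apply: le_trans (_ : (lm ^+ a) ^+ (mu %/ a) <= _).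
      by rewrite lerXn2r ?nnegrE ?exprn_ge0 ?(ltW (lam_gt0 R a0)) ?lam_ge2.
    by rewrite -exprM; apply: ler_weXn2l; [exact: lam_ge1 | rewrite mulnC leq_trunc_div].
  by rewrite ler_peMl ?exprn_ge0 ?(ltW (lam_gt0 R a0)) // exprn_ege1 // ler1n.
have {H2} : (mu %/ a < 8 * q * l + 1)%N.
  by move: H2; rewrite ler_eXn2l ?ltr1n // addn1 ltnS.
rewrite ltn_divLR // => mu_lt.
have : (\sum_(x in A :\: Q) #|cand f Q x| <= \sum_(x in A :\: Q | regular f Q x) #|cand f Q x|
   + 3 * \sum_(x in A :\: Q | (16 * a < #|cand f Q x|)%N) #|cand f Q x|./2)%N.
  rewrite (bigID (regular f Q)) /= leq_add2l big_distrr /=.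
  under eq_bigl do rewrite -ltnNge.
  by apply: leq_sum => x /andP [_ xl]; have := odd_double_half #|cand f Q x|; lia.
by move: mu_lt; rewrite /mu; lia.
Qed.

End Structure.

(** * Wrong adjacencies between candidate classes *)

Section Matching.
Variables (R : realType) (G : finZmodType) (V : finType) (A : {set G}).
Variables (h : rel G) (e : rel V) (v0 : V).
Local Notation K := #|G|.
Local Notation n := #|V|.
Local Notation a := (#|V| %/ #|G|).
Local Notation r := (#|G| - #|A|).
Variables (q l : nat) (Q0 : {set G}).
Hypothesis hyp : setup A h e q l Q0.
Let h_sym := h_sym hyp.
Let e_sym := e_sym hyp.

Local Notation ext := (ext A h e v0).
Local Notation cand := (cand h e).
Local Notation good := (good R A h e v0 q Q0).
Local Notation regular := (regular h e).

Definition good_pairs f Q x y : {set V * V} :=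
  [set p | [&& p.1 \in cand f Q x, p.2 \in cand f Q y & e p.1 p.2 == h x y]].
Definition bad_pairs f Q x y : {set V * V} :=
  [set p | [&& p.1 \in cand f Q x, p.2 \in cand f Q y & e p.1 p.2 != h x y]].

Lemma card_good_bad f Q x y :
  #|good_pairs f Q x y| + #|bad_pairs f Q x y| = #|cand f Q x| * #|cand f Q y|.
Proof.
rewrite -cardsX -(cardsID [set p | e p.1 p.2 == h x y] (setX _ _)).
congr (_ + _); apply: eq_card => -[u v].
  rewrite [LHS]in_set in_setI in_setX andbA; congr (_ && _).
  by rewrite in_set.
rewrite [LHS]in_set in_setD in_setX andbA andbC; congr (~~ _ && _).
by rewrite in_set.
Qed.

Lemma card_bad_sym f Q x y : #|bad_pairs f Q x y| = #|bad_pairs f Q y x|.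
Proof.
have sK : cancel (fun p : V * V => (p.2, p.1)) (fun p => (p.2, p.1)) by case.
rewrite -(card_imset _ (can_inj sK)); apply: eq_card => p; apply/imsetP/idP.
  case=> p'; rewrite in_set => /and3P [p1 p2 ep] ->.
  by rewrite in_set /= p1 p2 e_sym h_sym.
rewrite in_set => /and3P [p1 p2 ep]; exists (p.2, p.1); last by rewrite -surjective_pairing.
by rewrite in_set /= p1 p2 e_sym h_sym.
Qed.

Section Fixed.
Variables (f : {ffun G -> V}) (Q : {set G}) (j : G).
Hypothesis gf : good f Q.
Let X := A :\: Q.

(* One endpoint of each edge of the matching [x <-> j - x]. *)
Definition half := [set x in X | (j - x \in X)%R && (enum_rank x < enum_rank (j - x)%R)].
Let half' := [set (j - x)%R | x in half].

Let jK : involutive (fun x : G => j - x)%R.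
Proof. by move=> x; rewrite opprB addrC subrK. Qed.

Let half'X : half' \subset X.
Proof. by apply/subsetP => _ /imsetP [x + ->]; rewrite !inE => /and3P [_ -> _]. Qed.
Let halfX : half \subset X.
Proof. by apply/subsetP => x; rewrite inE => /andP []. Qed.

Let half_disj x : x \in half -> x \notin half'.
Proof.
rewrite inE => /and3P [_ _ lt]; apply/imsetP => -[y]; rewrite inE => /and3P [_ _ lt'] E.
by move: lt lt'; rewrite E jK => /ltn_trans lt /lt; rewrite ltnn.
Qed.

(** The edges of a matching involve disjoint pairs of classes, so the extensions inject into
    independent choices: a good pair for each edge and a candidate for each unmatched class. *)
Lemma ext_matching :
  #|ext f Q| * \prod_(x in half) (#|cand f Q x| * #|cand f Q (j - x)%R|) <=
  \prod_(x in X) #|cand f Q x| * \prod_(x in half) #|good_pairs f Q x (j - x)%R|.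
Proof.
have [fE sQ QA _ _] := gf.
pose F x : {set V * V} :=
  if x \in half then good_pairs f Q x (j - x)%R
  else if (x \in X) && (x \notin half') then setX (cand f Q x) [set v0]
  else [set (if x \in half' then v0 else f x, v0)].
(* The pair sits at the endpoint in [half]; its partner stores the constant [(v0, v0)] and so
   contributes a factor 1. *)
pose T (g : {ffun G -> V}) : {ffun G -> V * V} :=
  [ffun x => if x \in half then (g x, g (j - x)%R)
             else if x \in half' then (v0, v0) else (g x, v0)].
have T_inj : {in ext f Q &, injective T}.
  move=> g1 g2 _ _ /ffunP ET; apply/ffunP => x; have := ET x; rewrite !ffunE.
  case: ifP => [_ [] //|xh]; case: ifP => [|_ [] //] /imsetP [y yh ->] _.
  by have := ET y; rewrite !ffunE yh => -[].
have extF : #|ext f Q| <= \prod_x #|F x|.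
  rewrite -(card_in_imset T_inj).
  apply: leq_trans (_ : #|[set g : {ffun G -> V * V} in family F]| <= _); last first.
    by rewrite cardsE card_family foldrE big_image /=.
  apply: subset_leq_card; apply/subsetP => _ /imsetP [g gE ->].
  have /extP [/embsP [D /is_embP Eg] gf'] := gE.
  rewrite inE; apply/familyP => x; rewrite /F ffunE; case: ifP => xh.
    have xX : x \in X by apply: (subsetP halfX).
    have jX : (j - x)%R \in X by apply/(subsetP half'X)/imset_f.
    rewrite inE /= !(ext_cand QA gE) //=.
    have [||| _ ->] // := Eg x (j - x)%R; try by [case/setDP: xX | case/setDP: jX].
    by apply: contraTneq xh => E; rewrite inE -E ltnn !andbF.
  case xh': (x \in half'); rewrite /= ?andbF ?andbT; first by rewrite inE.
  case: ifP => xX; first by rewrite in_setX (ext_cand QA gE) //= inE.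
  move: xX; rewrite in_setD => /negbT; rewrite negb_and negbK => /orP [xQ|xA].
    by rewrite gf' // set11.
  by have /embsP [Df _] := fE; rewrite D // Df // set11.
apply: leq_trans (leq_mul extF (leqnn _)) _; rewrite [leqRHS]mulnC.
rewrite (bigID (mem half)) /= -mulnA leq_mul //.
  by rewrite leq_eqVlt; apply/orP; left; apply/eqP/eq_bigr => x xh; rewrite /F xh.
rewrite [leqRHS](big_setID half) /= (setIidPr halfX) [X in _ <= _ * X](big_setID half') /=.
have -> : (X :\: half) :&: half' = half'.
  apply/setIidPr/subsetP => x xh'; rewrite inE (subsetP half'X) // andbT.
  by apply: contraL xh'; apply: half_disj.
rewrite big_split /= mulnCA leq_mul // mulnC.
rewrite [X in _ <= X * _]big_imset /=; last by move=> x y _ _; apply: (can_inj jK).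
rewrite leq_mul // [leqLHS](bigID (mem (X :\: half :\: half'))) /=.
rewrite [X in _ * X]big1 ?muln1 => [|x /andP [xh nX]]; last first.
  rewrite /F (negbTE xh); case: ifP => [/andP [xX xh'] | _]; last by rewrite cards1.
  by case/negP: nX; apply/setDP; split=> //; apply/setDP.
rewrite leq_eqVlt; apply/orP; left; apply/eqP.
apply: eq_big => x.
  by apply: andb_idl => /setDP [/setDP []].
move=> /andP [xh]; rewrite in_setD => /andP [xh' /setDP [xX _]].
by rewrite /F (negbTE xh) xX xh' /= cardsX cards1 muln1.
Qed.

(** If a share [d] of the pairs on an edge is bad, the good share is [1 - d <= exp (- d)]. Comparing
    [ext_matching] with [good_dense] bounds the sum of these [d] by [8 * q * l], and two regular
    classes form at most [256 * a ^ 2] pairs. *)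
Lemma half_regular_bad :
  \sum_(x in half | regular f Q x && regular f Q (j - x)%R) #|bad_pairs f Q x (j - x)%R|
  <= 256 * a ^ 2 * (8 * q * l).
Proof.
have a0 := a_gt0 hyp.
have [fE sQ QA _ _] := gf.
have cpos x : x \in X -> 0 < #|cand f Q x| by apply: (cand_gt0 gf).
have hX x : x \in half -> x \in X by apply: (subsetP halfX).
have hX' x : x \in half -> (j - x)%R \in X by move=> xh; apply/(subsetP half'X)/imset_f.
pose c x : R := ((#|cand f Q x| * #|cand f Q (j - x)%R|)%N%:R)%R.
have c0 x : x \in half -> (0 < c x)%R.
  by move=> xh; rewrite ltr0n muln_gt0 (cpos _ (hX x xh)) (cpos _ (hX' x xh)).
pose d x : R := (#|bad_pairs f Q x (j - x)%R|%:R / c x)%R.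
have cE x : (c x = #|good_pairs f Q x (j - x)%R|%:R + #|bad_pairs f Q x (j - x)%R|%:R)%R.
  by rewrite /c -card_good_bad natrD.
have dsum : (\sum_(x in half) d x <= (8 * q * l)%:R)%R.
  rewrite -ler_expR; apply: le_trans (_ : (2 ^ (8 * q * l))%:R <= _)%R; last first.
    rewrite natrX -[X in expR X]mulr1 expRM_natl lerXn2r ?nnegrE ?expR_ge0 //.
    by apply: le_trans (expR_ge1Dx 1); lra.
  have P1 : (0 < \prod_(x in X) #|cand f Q x|%:R :> R)%R.
    by apply: prodr_gt0 => x xX; rewrite ltr0n cpos.
  have P2 : (0 < \prod_(x in half) c x)%R by apply: prodr_gt0.
  have dens := good_dense hyp gf.
  have mat : (#|ext f Q|%:R * \prod_(x in half) c x <=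
    \prod_(x in X) #|cand f Q x|%:R * \prod_(x in half) #|good_pairs f Q x (j - x)%R|%:R :> R)%R.
    by rewrite -!natr_prod -!natrM ler_nat ext_matching.
  rewrite expR_sum -(ler_pM2r P2).
  have key : (\prod_(x in half) expR (d x) * \prod_(x in half) #|good_pairs f Q x (j - x)%R|%:R
      <= \prod_(x in half) c x)%R.
    rewrite -big_split /=; apply: ler_prod => x xh; rewrite mulr_ge0 ?expR_ge0 //=.
    have := expR_ge1Dx (- d x); rewrite expRN => H.
    rewrite -ler_pdivlMl ?expR_gt0 // mulrC; apply: le_trans (ler_wpM2l (ltW (c0 x xh)) H).
    by rewrite mulrDr mulr1 mulrN /d mulrCA divff ?gt_eqF ?c0 // mulr1 cE addrK.
  have e8 : (0 < #|ext f Q|%:R :> R)%R by rewrite ltr0n; apply/card_gt0P; exists f; apply: ext_self.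
  have D0 : (0 <= \prod_(x in half) expR (d x))%R by apply: prodr_ge0 => x _; apply: expR_ge0.
  have K8 : ((K ^ (8 * q))%:R <= (2 ^ (8 * q * l))%:R :> R)%R.
    have rq := r_q hyp.
    by rewrite ler_nat [(8 * q * l)%N]mulnC (expnM 2) leq_exp2r ?(K_l hyp) //; clear -rq; lia.
  apply: le_trans (_ : (K ^ (8 * q))%:R * \prod_(x in half) c x <= _)%R; last first.
    by rewrite ler_pM2r.
  rewrite -(ler_pM2l e8) mulrCA; apply: le_trans (ler_wpM2l D0 mat) _.
  rewrite mulrCA; apply: le_trans (ler_wpM2l (ltW P1) key) _.
  by rewrite mulrA ler_pM2r // mulrC.
rewrite -(ler_nat R) natr_sum.
apply: le_trans (_ : \sum_(x in half) (256 * a ^ 2)%:R * d x <= _)%R; last first.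
  by rewrite -big_distrr /= [leRHS]natrM ler_wpM2l.
rewrite [leRHS](bigID (fun x => regular f Q x && regular f Q (j - x)%R)) /=.
rewrite -[leLHS]addr0 lerD ?sumr_ge0 // => [|x _]; last first.
  by rewrite mulr_ge0 // divr_ge0 // ler0n.
apply: ler_sum => x /andP [xh /andP [R1 R2]].
rewrite mulrCA ler_peMr // ler_pdivlMr ?c0 // mul1r ler_nat.
by have -> : 256 * a ^ 2 = (16 * a) * (16 * a) by [ring]; apply: leq_mul.
Qed.

End Fixed.

(** The restriction to regular classes keeps every fibre of size at most [16 * a], which the greedy
    argument needs. *)
Definition pos f Q v := [pick x in A :\: Q | regular f Q x && (v \in cand f Q x)].

Lemma posP f (Q : {set G}) v x : Q0 \subset Q ->
  pos f Q v = Some x <-> [/\ x \in A :\: Q, regular f Q x & v \in cand f Q x].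
Proof.
move=> sQ; rewrite /pos; case: pickP => [y /and3P [yX yr yv]|H]; split=> //.
- by case=> <-.
- by case=> xX xr xv; rewrite (cand_disj hyp sQ yX xX yv xv).
- by case=> xX xr xv; have := H x; rewrite /= xX xr xv.
Qed.

Lemma card_pos_None f Q : good f Q ->
  #|[set v | pos f Q v == None]| <= 3 * (8 * q * l + 1) * a.
Proof.
move=> gf; have [_ sQ _ _ _] := gf; have := good_mass hyp gf.
rewrite (sum_cand hyp f (regular f Q) sQ); set S := [set v | _].
have -> : [set v | pos f Q v == None] = ~: S.
  apply/setP => v; rewrite !inE /pos; case: pickP => [x /and3P [? ? ?]|H].
    by apply/esym/negbTE; rewrite negbK; apply/existsP; exists x; apply/and3P.
  by rewrite eqxx; apply/esym/existsP => -[x Hx]; have := H x; rewrite /= Hx.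
by have := cardsC S; lia.
Qed.

Definition pos_conflict f Q (u v : V) :=
  if pos f Q u is Some x then
    if pos f Q v is Some y then (x != y) && (e u v != h x y) else false
  else false.

(** Two labels [x] and [y] are matched for exactly one [j], namely [x + y], so [half_regular_bad] is
    summed over [K] values of [j]. In [4096 = 2 * 256 * 8] the 2 accounts for ordered pairs. *)
Lemma card_pos_conflict f Q : good f Q ->
  #|[set p : V * V | pos_conflict f Q p.1 p.2]| <= 4096 * a ^ 2 * K * (q * l).
Proof.
move=> gf; have [_ sQ _ _ _] := gf; set X := A :\: Q.
pose b x y := if regular f Q x && regular f Q y then #|bad_pairs f Q x y| else 0.
apply: leq_trans (_ : \sum_(x in X) \sum_(y in X | x != y) b x y <= _).
  rewrite -sum1_card.
  apply: leq_trans (_ : \sum_(p in [set p : V * V | pos_conflict f Q p.1 p.2])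
     \sum_(x in X) \sum_(y in X | x != y) (regular f Q x && regular f Q y && (p \in bad_pairs f Q x y)) <= _).
    apply: leq_sum => p; rewrite inE /pos_conflict.
    case Eu: (pos f Q p.1) => [x|//]; case Ev: (pos f Q p.2) => [y|//] /andP [xy exy].
    have [xX xr xc] := (posP _ _ _ sQ).1 Eu; have [yX yr yc] := (posP _ _ _ sQ).1 Ev.
    by rewrite (bigD1 x) //= (bigD1 y) ?yX //= xr yr inE xc yc exy.
  rewrite exchange_big; apply: leq_sum => x _.
  rewrite exchange_big; apply: leq_sum => y _; rewrite /b; case: ifP => _ /=; last by rewrite big1.
  rewrite -[leqRHS]sum_mem [leqLHS]big_mkcond; apply: leq_sum => p _; by case: ifP.
have bS x y : b x y = b y x by rewrite /b andbC card_bad_sym.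
pose lt (x y : G) := (enum_rank x < enum_rank y)%N.
have -> : \sum_(x in X) \sum_(y in X | x != y) b x y =
          2 * \sum_(x in X) \sum_(y in X | lt x y) b x y.
  rewrite mul2n -addnn; transitivity
    (\sum_(x in X) (\sum_(y in X | lt x y) b x y + \sum_(y in X | lt y x) b x y)).
    apply: eq_bigr => x _; rewrite (bigID (lt x)) /=; congr (_ + _); apply: eq_bigl => y.
      rewrite /lt -andbA; case: (y \in X) => //=; case: ltngtP; rewrite ?andbF ?andbT //.
      by move=> H; apply: contraTneq H => ->; rewrite ltnn.
    rewrite /lt -andbA; case: (y \in X) => //=; case: ltngtP; rewrite ?andbF ?andbT //.
      by move=> H; apply: contraTneq H => ->; rewrite ltnn.
    by move=> H; apply/negbTE; rewrite negbK; apply/eqP/enum_rank_inj/val_inj.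
  rewrite big_split /=; congr (_ + _).
  rewrite (exchange_big_dep (mem X)) /=; last by move=> x y _ /andP [].
  apply: eq_bigr => y yX; apply: eq_big => [x|x _]; last exact: bS.
  by rewrite yX.
have -> : \sum_(x in X) \sum_(y in X | lt x y) b x y =
          \sum_j \sum_(x in half Q j) b x (j - x)%R.
  rewrite [RHS](exchange_big_dep (mem X)) /=; last by move=> j x _; rewrite inE => /andP [].
  apply: eq_bigr => x xX; rewrite (reindex_inj (addIr (- x)%R)) /=.
  by apply: eq_bigl => j; rewrite [RHS]in_set xX.
have -> : 4096 * a ^ 2 * K * (q * l) = 2 * (K * (256 * a ^ 2 * (8 * q * l))) by ring.
rewrite leq_mul2l /= -sum_nat_const; apply: leq_sum => j _.
by rewrite -big_mkcondr; apply: half_regular_bad.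
Qed.

End Matching.

(** * Alignment of two labellings *)

Lemma card_bigcup_seq (T : eqType) (T' : finType) (F : T -> {set T'}) m s :
  (forall u, u \in s -> #|F u| <= m) -> #|\bigcup_(u <- s) F u| <= size s * m.
Proof.
elim: s => [|u s IH] H; first by rewrite big_nil cards0.
rewrite big_cons mulSn; apply: leq_trans (leq_card_setU _ _) _.
by rewrite leq_add ?H ?mem_head // IH // => x xs; rewrite H // inE xs orbT.
Qed.

Lemma card_imset_le2 (T T' : finType) (f : T -> T') (S : {set T}) :
  (forall x, x \in S -> #|[set y in S | f y == f x]| <= 2) -> #|S| <= 2 * #|f @: S|.
Proof.
move=> H; rewrite -sum1_card (partition_big f (mem (f @: S))) /=; last first.
  by move=> x xS; apply: imset_f.
rewrite mulnC -sum_nat_const; apply: leq_sum => _ /imsetP [x xS ->].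
by rewrite sum1dep_card -[X in X <= _]/(#|_|); have := H x xS; rewrite cardsE.
Qed.

Lemma exists_ge_average (T : finType) (D : {set T}) (f : T -> nat) :
  0 < #|D| -> exists2 x, x \in D & \sum_(y in D) f y <= #|D| * f x.
Proof.
case/card_gt0P => x0 x0D; case: (arg_maxnP f x0D) => x xD Hx; exists x => //.
by rewrite -sum_nat_const; apply: leq_sum => y; apply: Hx.
Qed.

Lemma mem_bigcup_seq (T : eqType) (T' : finType) (s : seq T) (F : T -> {set T'}) x y :
  x \in s -> y \in F x -> y \in \bigcup_(x <- s) F x.
Proof. by move=> xs yF; rewrite (big_rem x) //= inE yF. Qed.

Lemma uniq_map_inj (T T' : eqType) (f : T -> T') s :
  uniq (map f s) -> {in s &, injective f}.
Proof.
elim: s => //= x s IH /andP [nx us] y z; rewrite !inE.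
move=> /orP [/eqP ->|ys] /orP [/eqP ->|zs] E //; last exact: IH.
  by rewrite E map_f in nx.
by rewrite -E map_f in nx.
Qed.

Section Types.
Variables (G : finZmodType).
Implicit Types (s : seq (G * G)).
Local Open Scope ring_scope.

Definition cl (d : G) : {set G} := [set d; - d].

Lemma cl_eq d d' : (cl d == cl d') = (d' == d) || (d' == - d).
Proof.
apply/eqP/idP => [E|/orP [] /eqP ->].
- by have : d' \in cl d'; [rewrite !inE eqxx | rewrite -E !inE].
- by [].
- by rewrite /cl opprK setUC.
Qed.

(** A pair in [G * G] is an argument and its value under a partial map. When [NG] holds, the two
    differences are not equal up to sign, so the adjacencies before and after the map are decided by
    different random choices and agree only by chance. *)
Definition NG (u v : G * G) := [&& u.1 != v.1, u.2 != v.2, u.2 - v.2 != u.1 - v.1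
  & u.2 - v.2 != v.1 - u.1].

Lemma NG_sym : symmetric NG.
Proof.
move=> u v; rewrite /NG ![_ == v.1]eq_sym ![_ == v.2]eq_sym.
rewrite -[u.2 - v.2 == _]eqr_opp -[u.2 - v.2 == v.1 - _]eqr_opp !opprB.
by [].
Qed.

Definition NGc s : {set {set G}} :=
  [set cl (p.1.1 - p.2.1) | p in [set p : (G * G) * (G * G) |
     [&& p.1 \in s, p.2 \in s & NG p.1 p.2]]].

Variable h : rel G.

Definition inc (u v : G * G) := [&& u.1 != v.1, u.2 != v.2 & h u.1 v.1 != h u.2 v.2].
Definition consistent s := all (fun u => all (fun v => ~~ inc u v) s) s.

Lemma NGcP s c : reflect (exists u v, [/\ u \in s, v \in s, NG u v & c = cl (u.1 - v.1)])
  (c \in NGc s).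
Proof.
apply: (iffP imsetP) => [[[u v]]|[u [v [us vs uv ->]]]].
  by rewrite inE /= => /and3P [us vs uv] ->; exists u, v.
by exists (u, v); rewrite // inE /= us vs.
Qed.

Lemma card_NGc s : (#|NGc s| <= size s ^ 2)%N.
Proof.
apply: leq_trans (leq_imset_card _ _) _.
apply: leq_trans (_ : #|setX [set u in s] [set u in s]| <= _)%N.
  apply: subset_leq_card; apply/subsetP => -[u v]; rewrite !inE /=.
  by case/and3P => -> ->.
by rewrite cardsX cardsE expnS expn1 leq_mul // card_size.
Qed.

Hypothesis h_sym : symmetric h.
Lemma inc_sym : symmetric inc.
Proof. by move=> u v; rewrite /inc ![_ == v.1]eq_sym ![_ == v.2]eq_sym ![h v.1 _]h_sym ![h v.2 _]h_sym. Qed.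

Local Open Scope nat_scope.

Section Greedy.
Variables (V : finType) (ty : V -> G * G) (U : {set V}) (N th be ka rho : nat).
Hypothesis NG_deg : forall v, v \in U -> th <= #|[set w in U | NG (ty v) (ty w)]|.
Hypothesis inc_deg : forall v, v \in U -> #|[set w in U | inc (ty v) (ty w)]| <= be.
Hypothesis mult : forall g, #|[set w in U | (ty w).1 == g]| <= ka.
Hypotheses (UN : #|U| <= N) (U0 : 0 < #|U|).
Hypothesis small : 2 * (3 * rho ^ 2 * ka + rho * be) <= th.

(** A class [{d, -d}] leaves two possible first coordinates, each taken at most [ka] times. *)
Let stale_le g (C : {set {set G}}) :
  #|[set w in U | cl ((ty w).1 - g)%R \in C]| <= 2 * #|C| * ka.
Proof.
rewrite -sum1dep_card (partition_big (fun w => cl ((ty w).1 - g)%R) (mem C)) /=; last first.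
  by move=> w /andP [].
have -> : 2 * #|C| * ka = \sum_(c in C) (2 * ka) by rewrite sum_nat_const; ring.
apply: leq_sum => c cC; rewrite sum1dep_card.
have [w0|no] := pickP [pred w | (w \in U) && (cl ((ty w).1 - g)%R == c)]; last first.
  by rewrite eq_card0 // => w; rewrite !inE; have := no w; rewrite /= -!andbA; case: (w \in U); rewrite //= => ->; rewrite andbF.
move=> /andP [w0U /eqP Ec].
apply: leq_trans (_ : #|[set w in U | (ty w).1 == (ty w0).1] :|:
    [set w in U | (ty w).1 == g - ((ty w0).1 - g)]%R| <= _).
  apply: subset_leq_card; apply/subsetP => w; rewrite !inE => /andP [/andP [wU _]].
  rewrite wU -Ec cl_eq /= => /orP [] /eqP E.
    by rewrite (can_inj (subrK g) E) eqxx.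
  by apply/orP; right; rewrite E opprK addrC subrK.
by apply: leq_trans (leq_card_setU _ _) _; rewrite mul2n -addnn leq_add.
Qed.

(** The next element is a compatible vertex that creates the most new [NG] differences. Averaging
    over at most [N] vertices gives [i * th / (2 * N)] of them, at most two members of [s] share a
    class, and the increments [i * th / (4 * N)] add up to the binomial coefficient. *)
Lemma greedy i : i <= rho -> exists s, [/\ size s = i, uniq [seq u.1 | u <- s],
  consistent s, forall u, u \in s -> exists2 v, v \in U & u = ty v
  & th * 'C(i, 2) <= 4 * N * #|NGc s|].
Proof.
elim: i => [_|i IH ir]; first by exists [::]; split; rewrite // bin_small ?muln0.
have [s [sz us cs sU Hs]] := IH (ltnW ir).
pose I := \bigcup_(u <- s) [set w in U | inc u (ty w)].
pose X := \bigcup_(u <- s) [set w in U | (ty w).1 == u.1].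
pose D := U :\: (I :|: X).
have cI : #|I| <= i * be.
  by rewrite -sz; apply: card_bigcup_seq => u /sU [v vU ->]; apply: inc_deg.
have cX : #|X| <= i * ka by rewrite -sz; apply: card_bigcup_seq => u _; apply: mult.
pose fr u w := NG u (ty w) && (cl ((ty w).1 - u.1)%R \notin NGc s).
pose use w := \sum_(u <- s) fr u w.
have use_le w : use w <= i.
  by rewrite /use -sz -sum1_size; apply: leq_sum => u _; apply: leq_b1.
(* Pairs whose class is already used, and vertices excluded by [I] or [X], are charged here; by
   [small] the charge is at most half of [i * th]. *)
have tot : i * th <= \sum_(w in D) use w + i * (2 * i ^ 2 * ka) + i * (i * be + i * ka).
  apply: leq_trans (_ : \sum_(w in U) use w + i * (2 * i ^ 2 * ka) <= _); last first.
    rewrite addnAC leq_add2r (big_setID (I :|: X)) /= addnC leq_add2l.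
    apply: leq_trans (_ : \sum_(w in U :&: (I :|: X)) i <= _); first exact: leq_sum.
    rewrite sum_nat_const mulnC leq_mul2l; apply/orP; right.
    apply: leq_trans (subset_leq_card (subsetIr _ _)) _.
    by apply: leq_trans (leq_card_setU _ _) _; apply: leq_add.
  have cst m : i * m = \sum_(u <- s) m.
    by rewrite big_const_seq count_predT iter_addn_0 sz mulnC.
  rewrite /use exchange_big /= (cst th) (cst (2 * i ^ 2 * ka)) -big_split /=.
  rewrite big_seq [leqRHS]big_seq; apply: leq_sum => u us'.
  have [v vU Eu] := sU u us'; apply: leq_trans (NG_deg vU) _; rewrite -Eu.
  rewrite card_setId_sum.
  apply: leq_trans (_ : \sum_(w in U) (fr u w + (cl ((ty w).1 - u.1)%R \in NGc s)) <= _).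
    by apply: leq_sum => w _; rewrite /fr; case: (NG _ _) => //=; case: (_ \in _).
  rewrite big_split leq_add2l -card_setId_sum; apply: leq_trans (stale_le _ _) _.
  by rewrite leq_mul2r leq_mul2l -sz card_NGc !orbT.
have ib : i <= rho by apply: ltnW.
have ib2 : i ^ 2 <= rho ^ 2 by rewrite leq_sqr.
have tot2 : i * th <= 2 * \sum_(w in D) use w.
  have : 2 * (2 * i ^ 2 * ka + (i * be + i * ka)) <= th.
    apply: leq_trans small; rewrite leq_mul2l /=.
    have : i * ka <= rho ^ 2 * ka by rewrite leq_mul2r; case: (i) ib => [|j] ib; rewrite ?orbT //; nia.
    have : i ^ 2 * ka <= rho ^ 2 * ka by rewrite leq_mul2r ib2 orbT.
    have : i * be <= rho * be by rewrite leq_mul2r ib orbT.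
    lia.
  by move=> /(leq_mul (leqnn i)); lia.
have D0 : 0 < #|D|.
  have [v vU] := card_gt0P U0; have thU : th <= #|U|.
    by apply: leq_trans (NG_deg vU) (subset_leq_card _); apply/subsetP => w; rewrite inE => /andP [].
  have : #|U| <= #|D| + #|I :|: X|.
    by rewrite -(cardsID (I :|: X) U) addnC leq_add2l subset_leq_card // subsetIr.
  have := (leq_card_setU I X).1.
  have : i * ka <= rho ^ 2 * ka by rewrite leq_mul2r; case: (i) ib => [|j] ib; rewrite ?orbT //; nia.
  have : i * be <= rho * be by rewrite leq_mul2r ib orbT.
  by lia.
have [w wD Hw] := exists_ge_average use D0.
move: (wD); rewrite !inE negb_or -andbA => /and3P [wI wX wU].
have nI u : u \in s -> ~~ inc u (ty w).
  move=> u_s; apply: contra wI => uw; apply: (mem_bigcup_seq u_s).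
  by rewrite inE wU uw.
have nX u : u \in s -> (ty w).1 != u.1.
  move=> u_s; apply: contra wX => uw; apply: (mem_bigcup_seq u_s).
  by rewrite inE wU uw.
exists (ty w :: s); split=> /=.
- by rewrite sz.
- by rewrite us andbT; apply/mapP => -[u u_s E]; have := nX u u_s; rewrite E eqxx.
- rewrite /consistent /= {1}/inc eqxx /=; apply/andP; split.
    by apply/allP => u u_s; rewrite inc_sym nI.
  apply/allP => u u_s /=; rewrite nI //=.
  by move/allP: cs; apply.
- by move=> u; rewrite inE => /orP [/eqP ->|/sU //]; exists w.
pose Su := [set u in s | fr u w].
have cSu : use w = #|Su|.
  have us' : uniq s := map_uniq us.
  rewrite /use /Su cardsE; transitivity (\sum_(u <- s | fr u w) 1).
    by rewrite [RHS]big_mkcond; apply: eq_bigr => u _; case: (fr u w).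
  rewrite sum1_count -size_filter -(card_uniqP (filter_uniq _ us')).
  by apply: eq_card => u; rewrite mem_filter andbC.
have img : #|NGc s| + #|[set cl ((ty w).1 - u.1)%R | u in Su]| <= #|NGc (ty w :: s)|.
  rewrite -cardsUI (_ : _ :&: _ = set0) ?cards0 ?addn0; last first.
    apply/setP => c; rewrite !inE; apply/negP => /andP [cN /imsetP [u]].
    by rewrite inE => /andP [_ /andP [_ nN]] Ec; rewrite -Ec cN in nN.
  apply: subset_leq_card; apply/subsetP => c /setUP [/NGcP [u [v [u_s v_s uv ->]]]|].
    by apply/NGcP; exists u, v; rewrite !inE u_s v_s !orbT.
  case/imsetP => u; rewrite inE => /andP [u_s /andP [uw _]] ->.
  by apply/NGcP; exists (ty w), u; rewrite !inE eqxx u_s orbT NG_sym.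
have half : #|Su| <= 2 * #|[set cl ((ty w).1 - u.1)%R | u in Su]|.
  apply: card_imset_le2 => u uS.
  have inj1 : {in Su &, injective (fun u : G * G => u.1)}.
    move=> u1 u2; rewrite !inE => /andP [s1 _] /andP [s2 _] E.
    by apply: (uniq_map_inj us s1 s2).
  rewrite -(card_in_imset (f := fun u : G * G => u.1)); last first.
    by move=> u1 u2; rewrite !inE => /andP [S1 _] /andP [S2 _]; apply: inj1; rewrite !inE.
  apply: leq_trans (_ : #|[set u.1; (ty w).1 - (u.1 - (ty w).1)]%R| <= _).
    apply: subset_leq_card; apply/subsetP => _ /imsetP [u' + ->]; rewrite !inE => /andP [_].
    rewrite cl_eq => /orP [] /eqP E.
      by rewrite (can_inj (subKr (ty w).1) E) eqxx.
    by apply/orP; right; rewrite opprB E opprB addrCA subrr addr0.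
  by rewrite cards2; case: (_ != _).
rewrite binS bin1 mulnDr.
have : i * th <= 2 * (N * use w).
  apply: leq_trans tot2 _; rewrite leq_mul2l /=; apply: leq_trans Hw _.
  by rewrite leq_mul2r (leq_trans _ UN) ?orbT // subset_leq_card // subsetDl.
rewrite cSu => H1.
have fin (c T N' x y z u j : nat) : T * c <= 4 * N' * x -> N' * (x + y) <= N' * z ->
    N' * u <= N' * (2 * y) -> j * T <= 2 * (N' * u) -> T * c + T * j <= 4 * N' * z.
  by clear; nia.
exact: fin Hs (leq_mul (leqnn N) img) (leq_mul (leqnn N) half) H1.
Qed.

End Greedy.

Definition dih (b : bool) (c x : G) : G := ((if b then - x else x) + c)%R.

Section Align.
Variables (V : finType) (ty : V -> G * G) (W : {set V}) (N E th be ka rho t : nat).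
Hypothesis rigid : forall s, size s = rho -> consistent s -> #|NGc s| < t.
Hypothesis inc_deg : forall v, v \in W -> #|[set w in W | inc (ty v) (ty w)]| <= be.
Hypothesis mult1 : forall g, #|[set w in W | (ty w).1 == g]| <= ka.
Hypothesis mult2 : forall g, #|[set w in W | (ty w).2 == g]| <= ka.
Hypotheses (WN : #|W| <= N) (rho0 : 0 < rho) (E_th : 8 * th <= E).
Hypothesis small : 2 * (3 * rho ^ 2 * ka + rho * be) <= th.
Hypothesis large : 4 * N * t <= th * 'C(rho, 2).

(** Otherwise [greedy] produces a consistent tuple of length [rho] with at least [t] unpreserved
    differences, against [rigid]. *)
Let no_spread (U : {set V}) : U \subset W -> 0 < #|U| ->
  ~ (forall v, v \in U -> th <= #|[set w in U | NG (ty v) (ty w)]|).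
Proof.
move=> UW U0 H.
have cle (P : pred V) : #|[set w in U | P w]| <= #|[set w in W | P w]|.
  apply: subset_leq_card; apply/subsetP => w; rewrite !inE => /andP [/(subsetP UW) ->].
  by [].
have [|||s [sz _ cs _]] := @greedy V ty U N th be ka rho H _ _ _ U0 small rho (leqnn _).
- by move=> v vU; apply: leq_trans (cle _) (inc_deg (subsetP UW _ vU)).
- by move=> g; apply: leq_trans (cle _) (mult1 _).
- by apply: leq_trans (subset_leq_card UW) WN.
have N0 : 0 < N by apply: leq_trans U0 (leq_trans (subset_leq_card UW) WN).
move=> H2; have := leq_trans large H2; rewrite leq_pmul2l ?muln_gt0 //.
by rewrite leqNgt rigid.
Qed.

(** By [no_spread] some [v0] forms few [NG] pairs, so nearly all differences to it are kept ([Sp])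
    or negated ([Sm]). If both kinds were frequent, vertices of different kinds would form [NG]
    pairs, against [no_spread] for [(Sp :\: Sm) :|: (Sm :\: Sp)]. So one map [dih] fits nearly
    everywhere. *)
Lemma align_types : exists b c, #|[set v in W | (ty v).2 != dih b c (ty v).1]| <= E.
Proof.
have ka_th : 6 * ka <= th.
  apply: leq_trans small; have : ka <= rho ^ 2 * ka by rewrite leq_pmull // expn_gt0 rho0.
  lia.
have [W0|W0] := posnP #|W|.
  exists false, 0%R; apply: leq_trans (_ : #|W| <= _); last by rewrite W0.
  by apply: subset_leq_card; apply/subsetP => v; rewrite inE => /andP [].
have [/forall_inP H|] := boolP [forall v in W, th <= #|[set w in W | NG (ty v) (ty w)]|].
  by case: (no_spread (subxx W) W0 H).
rewrite negb_forall_in => /exists_inP [v0 v0W]; rewrite -ltnNge => few.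
set x0 := (ty v0).1; set y0 := (ty v0).2.
pose Sp := [set v in W | (ty v).2 - y0 == (ty v).1 - x0]%R.
pose Sm := [set v in W | (ty v).2 - y0 == x0 - (ty v).1]%R.
have rest : #|W :\: (Sp :|: Sm)| <= th + 2 * ka.
  apply: leq_trans (_ : #|[set w in W | NG (ty v0) (ty w)] :|:
    ([set w in W | (ty w).1 == x0] :|: [set w in W | (ty w).2 == y0])| <= _).
    apply: subset_leq_card; apply/subsetP => w /setDP [wW].
    rewrite in_setU negb_or !in_set wW /= => /andP [n1 n2]; rewrite ?in_setU ?in_set ?wW /=.
    case: (eqVneq (ty w).1 x0) => [|e1]; rewrite ?orbT //.
    case: (eqVneq (ty w).2 y0) => [|e2]; rewrite ?orbT //.
    apply/orP; left; apply/and4P; split.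
    - by rewrite eq_sym.
    - by rewrite eq_sym.
    - by rewrite -eqr_opp !opprB.
    - by rewrite -eqr_opp !opprB.
  apply: leq_trans (leq_card_setU _ _) _; apply: leq_add (ltnW few) _.
  by apply: leq_trans (leq_card_setU _ _) _; rewrite mul2n -addnn leq_add.
have [Ms|Ml] := leqP #|Sm :\: Sp| (2 * th + 2 * ka).
  exists false, (y0 - x0)%R.
  apply: leq_trans (_ : #|(W :\: (Sp :|: Sm)) :|: (Sm :\: Sp)| <= _).
    apply: subset_leq_card; apply/subsetP => w; rewrite !inE => /andP [-> /=] nE.
    have -> : ((ty w).2 - y0 == (ty w).1 - x0)%R = false.
      by apply: contraNF nE => /eqP E1; apply/eqP; rewrite /dih addrCA -E1 addrC subrK.
    by case: eqP.
  by apply: leq_trans (leq_card_setU _ _) _; lia.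
have [Ps|Pl] := leqP #|Sp :\: Sm| (2 * th + 2 * ka).
  exists true, (y0 + x0)%R.
  apply: leq_trans (_ : #|(W :\: (Sp :|: Sm)) :|: (Sp :\: Sm)| <= _).
    apply: subset_leq_card; apply/subsetP => w; rewrite !inE => /andP [-> /=] nE.
    have -> : ((ty w).2 - y0 == x0 - (ty w).1)%R = false.
      apply: contraNF nE => /eqP E1; apply/eqP.
      by rewrite /dih addrCA [(- _ + _)%R]addrC -E1 addrC subrK.
    by case: eqP.
  by apply: leq_trans (leq_card_setU _ _) _; lia.
(* If the differences agreed up to sign, one of the two vertices would lie in both [Sp] and [Sm]. *)
have ng v w : v \in Sp :\: Sm -> w \in Sm :\: Sp -> (ty v).1 != (ty w).1 ->
    (ty v).2 != (ty w).2 -> NG (ty v) (ty w).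
  rewrite !inE => /andP [nv /andP [vW /eqP Ev]] /andP [nw /andP [wW /eqP Ew]] n1 n2.
  rewrite vW /= Ev in nv; rewrite wW /= Ew in nw.
  rewrite /NG n1 n2 /=.
  have -> : ((ty v).2 - (ty w).2 = ((ty v).1 - x0) - (x0 - (ty w).1))%R.
    by rewrite -Ev -Ew opprB addrA subrK.
  apply/andP; split; [apply: contra nw | apply: contra nv] => /eqP E1; apply/eqP.
    by rewrite -[LHS](subKr ((ty v).1 - x0)%R) E1 opprB addrC addrA subrK.
  by rewrite -[LHS](subrK (x0 - (ty w).1)%R) E1 addrC addrA subrK.
have [] := @no_spread ((Sp :\: Sm) :|: (Sm :\: Sp)).
- by apply/subsetP => w; rewrite !inE => /orP [] /andP [_ /andP []].
- by rewrite (leq_trans _ (subset_leq_card (subsetUl _ _))) //; lia.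
have side (S : {set V}) (v : V) : S \subset W -> 2 * th + 2 * ka < #|S| ->
   th <= #|[set w in S | ((ty v).1 != (ty w).1) && ((ty v).2 != (ty w).2)]|.
  move=> SW cS.
  have : #|S| <= #|[set w in S | ((ty v).1 != (ty w).1) && ((ty v).2 != (ty w).2)]
     :|: ([set w in W | (ty w).1 == (ty v).1] :|: [set w in W | (ty w).2 == (ty v).2])|.
    apply: subset_leq_card; apply/subsetP => w wS; rewrite !inE wS (subsetP SW _ wS) /=.
    by rewrite ![_ == (ty v).1]eq_sym ![_ == (ty v).2]eq_sym; do 2 case: eqP.
  have := (leq_card_setU [set w in W | (ty w).1 == (ty v).1] [set w in W | (ty w).2 == (ty v).2]).1.
  have := mult1 (ty v).1; have := mult2 (ty v).2.
  set A1 := [set w in S | _]; set A2 := _ :|: _; have := (leq_card_setU A1 A2).1; lia.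
have SpW : Sp :\: Sm \subset W by apply/subsetP => w; rewrite !inE => /andP [_ /andP []].
have SmW : Sm :\: Sp \subset W by apply/subsetP => w; rewrite !inE => /andP [_ /andP []].
move=> v /setUP [vS|vS].
  apply: leq_trans (side _ v SmW Ml) _; apply: subset_leq_card; apply/subsetP => w.
  rewrite in_set => /andP [wS /andP [n1 n2]].
  by rewrite in_set inE wS orbT ng.
apply: leq_trans (side _ v SpW Pl) _; apply: subset_leq_card; apply/subsetP => w.
rewrite in_set => /andP [wS /andP [n1 n2]].
by rewrite in_set inE wS NG_sym ng // eq_sym.
Qed.

End Align.
End Types.

(** * A common labelling *)

(* [ps_rigid]: [NGc s] collects the differences, up to sign, that the partial
   map [s] does not preserve up to sign. *)
Record pseudorandom (G : finZmodType) (h : rel G) (de rho t s3 : nat) : Prop := Pseudorandom {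
  ps_sym : symmetric h;
  ps_irr : irreflexive h;
  ps_add : forall c x y, h (x + c)%R (y + c)%R = h x y;
  ps_opp : forall x y, h (- x)%R (- y)%R = h x y;
  ps_sep : forall x y, x != y ->
    de <= #|[set z | [&& z != x, z != y & h x z != h y z]]|;
  ps_rigid : forall s, size s = rho -> consistent h s -> #|NGc s| < t;
  ps_prime : forall xs ys : s3.-tuple G,
    (forall i j, tnth xs i != tnth ys j) ->
    (forall i j j', h (tnth xs i) (tnth ys j) = h (tnth xs i) (tnth ys j')) ->
    2 * #|[set cl (tnth xs p.1 - tnth ys p.2)%R | p : 'I_s3 * 'I_s3]| < s3 ^ 2 }.

(* With [a] the quotient of the number of vertices by [K]: [q] is the size of a
   separating set, [E1 * a] bounds the number of misaligned vertices, [be * a]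
   the inconsistencies at a vertex that is kept, and [th] bounds from below the gain at each
   step of the greedy choice of a rigid tuple. *)
Record numeric (K r q l de rho t s3 E1 th be : nat) : Prop := Numeric {
  nu_rho : 0 < rho;
  nu_be : 0 < be;
  nu_th : 8 * th <= E1;
  nu_small : 2 * (48 * rho ^ 2 + rho * be) <= th;
  nu_large : 8 * K * t <= th * 'C(rho, 2);
  nu_bad : 8192 * K * (q * l) <= be * E1;
  nu_none : 6 * (8 * q * l + 1) <= E1;
  nu_de : 60 * E1 + 8 * q * l + r + q + 2 < de;
  nu_s3 : 0 < s3;
  nu_prime : 2 * (2 * s3 ^ 3 + s3 + r) < de;
  nu_eta : 100 * (r + 1) ^ 2 * 8 ^ r <= K }.

Section Labelling.
Variables (R : realType) (G : finZmodType) (V : finType) (A : {set G}).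
Variables (h : rel G) (e : rel V) (v0 : V).
Local Notation K := #|G|.
Local Notation n := #|V|.
Local Notation a := (#|V| %/ #|G|).
Local Notation r := (#|G| - #|A|).
Variables (q l de rho t s3 E1 th be : nat) (Q0 : {set G}).
Hypothesis hyp : setup A h e q l Q0.
Hypothesis psr : pseudorandom h de rho t s3.
Hypothesis num : numeric K r q l de rho t s3 E1 th be.

Local Notation E := (embs A h e v0).
Local Notation ext := (ext A h e v0).
Local Notation cand := (cand h e).
Local Notation good := (good R A h e v0 q Q0).
Local Notation regular := (regular h e).
Local Notation pos := (pos A h e).

Lemma h_dih b c x y : h (dih b c x) (dih b c y) = h x y.
Proof. by case: b; rewrite /dih (ps_add psr) ?(ps_opp psr). Qed.

Definition Cov f0 f Q b c := [set v | if pos f Q v is Some x then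
  pos f0 Q0 v == Some (dih b c x) else false].

(** An inconsistency between the two labellings is a conflict of one of them with [e], so
    [card_pos_conflict] bounds their number. Three sets of at most [E1 * a] vertices are lost:
    unlabelled ones, those with more than [be * a] inconsistencies, and those misaligned by
    [align_types]. *)
Lemma alignment f0 f Q : good f0 Q0 -> good f Q ->
  exists b c, n <= #|Cov f0 f Q b c| + 3 * (E1 * a).
Proof.
move=> g0 g1; have a0 := a_gt0 hyp.
have [_ s0 _ _ _] := g0; have [_ s1 _ _ _] := g1.
pose ty v := (odflt 0%R (pos f Q v), odflt 0%R (pos f0 Q0 v)).
pose Vb := [set v | (pos f Q v != None) && (pos f0 Q0 v != None)].
pose W := [set v in Vb | #|[set w in Vb | inc h (ty v) (ty w)]| <= be * a].
have cVb : #|~: Vb| <= E1 * a.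
  apply: leq_trans (_ : #|[set v | pos f Q v == None] :|: [set v | pos f0 Q0 v == None]| <= _).
    by apply: subset_leq_card; apply/subsetP => v; rewrite !inE negb_and !negbK.
  apply: leq_trans (leq_card_setU _ _) _.
  apply: leq_trans (leq_add (card_pos_None hyp g1) (card_pos_None hyp g0)) _.
  rewrite -mulnDl leq_mul2r; apply/orP; right; apply: leq_trans (nu_none num).
  by rewrite -mulnDl.
have cW : #|Vb :\: W| <= E1 * a.
  have tot : \sum_(v in Vb) #|[set w in Vb | inc h (ty v) (ty w)]| <= 8192 * a ^ 2 * K * (q * l).
    pose S := [set p : V * V | pos_conflict A h e f Q p.1 p.2] :|:
       [set p : V * V | pos_conflict A h e f0 Q0 p.1 p.2].
    apply: leq_trans (_ : #|S| <= _); last first.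
      apply: leq_trans (leq_card_setU _ _) _.
      have -> : 8192 * a ^ 2 * K * (q * l) = 4096 * a ^ 2 * K * (q * l) + 4096 * a ^ 2 * K * (q * l).
        by ring.
      exact: leq_add (card_pos_conflict hyp g1) (card_pos_conflict hyp g0).
    under eq_bigr do rewrite card_setId_sum.
    have -> : #|S| = \sum_v \sum_w ((v, w) \in S).
      by rewrite -sum_mem pair_bigA; apply: eq_bigr => -[].
    rewrite [leqLHS]big_mkcond; apply: leq_sum => v _ /=; case: ifP => // vVb.
    rewrite [leqLHS]big_mkcond; apply: leq_sum => w _ /=; case: ifP => // wVb.
    case: (boolP (inc _ _ _)) => // iw; rewrite lt0b /S in_setU !in_set /=.
    move: vVb wVb iw; rewrite !inE /pos_conflict /inc /ty.
    case: (pos f Q v) => [x|//]; case: (pos f0 Q0 v) => [y|//] _.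
    case: (pos f Q w) => [x'|//]; case: (pos f0 Q0 w) => [y'|//] _ /=.
    case/and3P => -> -> /=; case: (e v w); case: (h x x'); by case: (h y y').
  have : \sum_(v in Vb :\: W) (be * a) <= \sum_(v in Vb) #|[set w in Vb | inc h (ty v) (ty w)]|.
    rewrite [leqRHS](big_setID W) /= addnC; apply: leq_trans (leq_addr _ _).
    apply: leq_sum => v; rewrite in_setD in_set => /andP [+ vVb].
    by rewrite vVb /= -ltnNge => /ltnW.
  rewrite sum_nat_const => H; have := leq_trans H tot => {tot} H2.
  rewrite -(leq_pmul2r (_ : 0 < be * a)); last by rewrite muln_gt0 (nu_be num).
  apply: leq_trans H2 _.
  have -> : 8192 * a ^ 2 * K * (q * l) = (8192 * K * (q * l)) * a ^ 2 by ring.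
  have -> : E1 * a * (be * a) = (be * E1) * a ^ 2 by ring.
  by rewrite leq_mul2r (nu_bad num) orbT.
have WVb : W \subset Vb by apply/subsetP => v; rewrite in_set => /andP [].
have tyE v : v \in Vb -> pos f Q v = Some (ty v).1 /\ pos f0 Q0 v = Some (ty v).2.
  by rewrite in_set /ty; case: (pos f Q v) => [x|//]; case: (pos f0 Q0 v).
have mult f' (Q' : {set G}) (p : V -> G) : Q0 \subset Q' -> (forall v, v \in Vb -> pos f' Q' v = Some (p v)) ->
    forall g, #|[set w in W | p w == g]| <= 16 * a.
  move=> s' H g; have [v|no] := pickP [pred v | (v \in W) && (p v == g)]; last first.
    by rewrite eq_card0 // => w; rewrite in_set; apply: no.
  move=> /andP [vW /eqP vg].
  have [_ + _] := (posP hyp _ _ _ s').1 (H v (subsetP WVb _ vW)); rewrite vg /regular; apply: leq_trans.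
  apply: subset_leq_card; apply/subsetP => w; rewrite in_set => /andP [wW /eqP <-].
  by have [_ _] := (posP hyp _ _ _ s').1 (H w (subsetP WVb _ wW)).
have [|||||||||b [c H]] := @align_types G h (ps_sym psr) V ty W (2 * a * K) (E1 * a) (th * a) (be * a) (16 * a) rho t.
- exact: (ps_rigid psr).
- move=> v; rewrite in_set => /andP [_]; apply: leq_trans; apply: subset_leq_card.
  by apply/subsetP => w /setIdP [wW iw]; apply/setIdP; split=> //; apply: (subsetP WVb).
- by move=> g; apply: (mult f Q (fun v => (ty v).1) s1 _ g) => v /tyE [].
- by move=> g; apply: (mult f0 Q0 (fun v => (ty v).2) s0 _ g) => v /tyE [].
- by apply: leq_trans (max_card _) (n_le hyp).
- exact: (nu_rho num).
- by rewrite mulnA leq_mul2r (nu_th num) orbT.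
- have -> : 2 * (3 * rho ^ 2 * (16 * a) + rho * (be * a)) = 2 * (48 * rho ^ 2 + rho * be) * a by ring.
  by rewrite leq_mul2r (nu_small num) orbT.
- have -> : 4 * (2 * a * K) * t = 8 * K * t * a by ring.
  by rewrite [th * a * _]mulnAC leq_mul2r (nu_large num) orbT.
exists b, c; set C := Cov _ _ _ _ _.
have sub : ~: C \subset ~: Vb :|: ((Vb :\: W) :|: [set v in W | (ty v).2 != dih b c (ty v).1]).
  apply/subsetP => v; rewrite in_setU in_setC => vC.
  case: (boolP (v \in Vb)) => vVb; last by rewrite in_setC vVb.
  rewrite in_setU in_setD vVb andbT; case: (boolP (v \in W)) => vW; last by rewrite orbT.
  rewrite [X in _ || (_ || X)]in_set vW /=; apply/orP; right; apply: contraNneq vC => tv.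
  by rewrite in_set; have [-> ->] := tyE v vVb; apply/eqP; congr Some; exact: tv.
have fin n' c0 c1 v1 u w s x : c0 + c1 = n' -> c1 <= v1 + u -> u <= w + s ->
  v1 <= x -> w <= x -> s <= x -> n' <= c0 + 3 * x by clear; lia.
exact: fin (cardsC C) (leq_trans (subset_leq_card sub) (leq_card_setU _ _))
  (leq_card_setU _ _) cVb cW H.
Qed.

(** Two different labels are separated by at least [de] elements [z]. A vertex in the class of [z]
    covered by both alignments would see the common vertex [f1 a1] in two ways, so such a class is
    below [a / 10] or mostly uncovered. Uncovered vertices fill at most [10 * 6 * E1] classes of
    size [a / 10], and with the small classes, [Q0] and the complement of [A] this stays below
    [de]. *)
Lemma label_unique f0 f1 Q1 b1 c1 a1 f2 Q2 b2 c2 a2 : good f0 Q0 ->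
  good f1 Q1 -> good f2 Q2 ->
  n <= #|Cov f0 f1 Q1 b1 c1| + 3 * (E1 * a) -> n <= #|Cov f0 f2 Q2 b2 c2| + 3 * (E1 * a) ->
  a1 \in Q1 -> a2 \in Q2 -> f1 a1 = f2 a2 -> dih b1 c1 a1 = dih b2 c2 a2.
Proof.
move=> g0 g1 g2 cov1 cov2 aQ1 aQ2 fa; apply: contraTeq isT => /(ps_sep psr) sp.
have [_ s0 QA0 cQ0 _] := g0; have [_ s1 _ _ _] := g1; have [_ s2 _ _ _] := g2.
set C1 := Cov _ _ _ _ _ in cov1; set C2 := Cov _ _ _ _ _ in cov2.
have hE f (Q : {set G}) b c a' v y : Q0 \subset Q -> a' \in Q -> v \in Cov f0 f Q b c ->
    pos f0 Q0 v = Some y -> h (dih b c a') y = e v (f a').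
  move=> sQ aQ; rewrite in_set; case Ex: (pos f Q v) => [x|//] /eqP -> [<-].
  have [_ _ /candP vx] := (posP hyp _ _ _ sQ).1 Ex.
  by rewrite h_dih; have [_ ->] := vx _ aQ; rewrite (ps_sym psr).
pose bad y := (a <= 10 * #|cand f0 Q0 y|) && (h (dih b1 c1 a1) y != h (dih b2 c2 a2) y).
have cbad : #|[set y in A :\: Q0 | bad y]| <= 60 * E1.
  have a0 := a_gt0 hyp; rewrite -(leq_pmul2r a0).
  apply: leq_trans (_ : 10 * \sum_(y in A :\: Q0 | bad y) #|cand f0 Q0 y| <= _).
    rewrite big_distrr /= -sum1dep_card big_distrl /=.
    by apply: leq_sum => y /andP [_ /andP [+ _]]; rewrite mul1n.
  rewrite (sum_cand hyp f0 bad s0).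
  apply: leq_trans (_ : 10 * #|~: (C1 :&: C2)| <= _); last first.
    have : #|~: (C1 :&: C2)| <= #|~: C1| + #|~: C2| by rewrite setCI; apply: leq_card_setU.
    have := cardsC C1; have := cardsC C2; move: cov1 cov2; nia.
  rewrite leq_mul2l /=; apply: subset_leq_card; apply/subsetP => v.
  rewrite in_set => /existsP [y /and3P [yX /andP [_ hy] vy]].
  rewrite in_setC in_setI; apply/negP => /andP [v1 v2].
  have [y' Ey] : exists y', pos f0 Q0 v = Some y'.
    by move: v1; rewrite in_set; case: (pos f1 Q1 v) => // x /eqP ->; eexists.
  have [yX' _ vy'] := (posP hyp _ _ _ s0).1 Ey.
  have Ey' := cand_disj hyp s0 yX yX' vy vy'; rewrite -Ey' in Ey.
  by move: hy; rewrite (hE _ _ _ _ _ _ _ s1 aQ1 v1 Ey) (hE _ _ _ _ _ _ _ s2 aQ2 v2 Ey) fa eqxx.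
have sub : [set z | [&& z != dih b1 c1 a1, z != dih b2 c2 a2 & h (dih b1 c1 a1) z != h (dih b2 c2 a2) z]]
    \subset [set y in A :\: Q0 | bad y] :|: ([set y in A :\: Q0 | (10 * #|cand f0 Q0 y| < a)%N] :|: (~: A :|: Q0)).
  apply/subsetP => z; rewrite in_set => /and3P [_ _ hz].
  rewrite !inE /bad hz andbT.
  by case: (z \in A); case: (z \in Q0); rewrite ?orbT //= orbF [a <= _]leqNgt; case: (_ < a).
have fin d u1 u2 b' s' w c0 k x y z : d <= u1 -> u1 <= b' + u2 -> u2 <= s' + w -> w <= c0 + x ->
  b' <= y -> s' <= z -> x <= q + 2 -> k + c0 = K -> y + z + (K - k) + q + 2 < d -> False by clear; lia.
case: (fin _ _ _ _ _ _ _ _ _ _ _ (leq_trans sp (subset_leq_card sub))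
  (leq_card_setU _ _) (leq_card_setU _ _) (leq_card_setU _ _)
  cbad (good_small hyp g0) cQ0 (cardsC A) (nu_de num)).
Qed.

(** Pigeonhole over the restrictions to [Q :\: P], of which there are at most [n ^ #|Q :\: P|]. *)
Lemma fiber_good (F : {set {ffun G -> V}}) (P Q : {set G}) : F \subset E ->
  Q0 \subset Q -> P \subset Q -> Q \subset A -> #|Q| <= q + 2 ->
  (forall f g z, f \in F -> g \in F -> z \in P -> f z = g z) -> 0 < #|F| ->
  (optimum R V A <= (#|F| * n ^ #|P| * K ^ (5 * q))%:R)%R ->
  exists2 f, f \in F & good f Q.
Proof.
move=> FE sQ PQ QA cQ cst F0 HF.
pose rs (f : {ffun G -> V}) : {ffun G -> option V} :=
  [ffun z => if z \in Q :\: P then Some (f z) else None].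
have img : #|rs @: F| <= n ^ #|Q :\: P|.
  pose D z : {set option V} := if z \in Q :\: P then Some @: setT else [set None].
  apply: leq_trans (_ : #|[set g : {ffun G -> option V} in family D]| <= _).
    apply: subset_leq_card; apply/subsetP => _ /imsetP [f fF ->].
    rewrite inE; apply/familyP => z; rewrite /D ffunE; case: ifP => _; first exact: imset_f.
    by rewrite inE.
  rewrite cardsE card_family foldrE big_image /= (bigID (mem (Q :\: P))) /=.
  rewrite [X in _ * X]big1 ?muln1; last by move=> z /negbTE zP; rewrite /D zP cards1.
  rewrite -prod_nat_const; apply: leq_prod => z zP; rewrite /D zP.
  by rewrite card_imset ?cardsT // => x y [].
have [y yI Hy] : exists2 y, y \in rs @: F & \sum_(z in rs @: F) #|[set f in F | rs f == z]|
     <= #|rs @: F| * #|[set f in F | rs f == y]|.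
  apply: exists_ge_average; have [f fF] := card_gt0P F0.
  by apply/card_gt0P; exists (rs f); apply: imset_f.
have {Hy} cF : #|F| <= n ^ #|Q :\: P| * #|[set f in F | rs f == y]|.
  apply: leq_trans (_ : #|rs @: F| * #|[set f in F | rs f == y]| <= _); last by rewrite leq_mul2r img orbT.
  apply: leq_trans Hy; rewrite -sum1_card (partition_big rs (mem (rs @: F))) /=; last first.
    by move=> f fF; apply: imset_f.
  by apply: leq_sum => z _; rewrite sum1dep_card.
have [f fF Ey] := imsetP yI.
exists f => //; split=> //; first exact: (subsetP FE).
apply: le_trans HF _; rewrite ler_nat leq_mul2r; apply/orP; right.
have sub : #|[set g in F | rs g == y]| <= #|ext f Q|.
  apply: subset_leq_card; apply/subsetP => g; rewrite in_set => /andP [gF /eqP gy].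
  apply/extP; split=> [|z zQ]; first exact: (subsetP FE).
  case: (boolP (z \in P)) => zP; first exact: cst.
  have : rs g z = rs f z by rewrite gy Ey.
  by rewrite !ffunE in_setD zP zQ => -[].
have -> : #|Q| = #|Q :\: P| + #|P|.
  by rewrite cardsD (setIidPr PQ) subnK // subset_leq_card.
rewrite expnD mulnA leq_mul2r; apply/orP; right; apply: leq_trans cF _.
by rewrite mulnC leq_mul2r sub orbT.
Qed.

Hypothesis e_irr : irreflexive e.
Hypothesis e_max : extremal A h e v0.
Hypothesis QA0 : Q0 \subset A.
Hypothesis cQ0 : #|Q0| <= q.
Hypothesis opt_le : (optimum R V A <= (2 ^ r * #|E|)%:R)%R.

Lemma opt_gt0 : (0 < optimum R V A)%R.
Proof.
have a0 := a_gt0 hyp.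
by rewrite mulr_gt0 ?exprn_gt0 ?ltr0n // lam_gt0.
Qed.

Lemma embs_gt0 : 0 < #|E|.
Proof.
rewrite lt0n; apply: contraTneq (lt_le_trans opt_gt0 opt_le) => ->.
by rewrite muln0 ltxx.
Qed.

Lemma pow2_le : 2 ^ r * 2 <= K ^ (5 * q).
Proof.
have := r_q hyp; have Kb := K_big hyp => rq.
apply: leq_trans (_ : 2 ^ (5 * q) <= _); first by rewrite -expnSr leq_pexp2l //; lia.
by rewrite leq_exp2r ?(leq_trans _ Kb) //; lia.
Qed.

(* The label of a vertex [u] is read off from any large family of copies
   through [u]: it does not depend on the family by [label_unique]. *)
Lemma labelling : exists pi : V -> G, forall u v x y, x \in A -> y \in A -> x != y ->
  0 < #|[set f in E | (f x == u) && (f y == v)]| ->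
  (optimum R V A <= (#|[set f in E | (f x == u) && (f y == v)]| * n ^ 2 * K ^ (5 * q))%:R)%R ->
  exists b c, pi u = dih b c x /\ pi v = dih b c y.
Proof.
have Kb := K_big hyp.
(* The reference copy: all labels are expressed in its frame, which settles the choice among the
   symmetries once and for all. *)
have [f0 _ g0] : exists2 f, f \in E & good f Q0.
  apply: (@fiber_good _ set0); rewrite ?sub0set ?embs_gt0 //; first by lia.
    by move=> f g z _ _; rewrite inE.
  apply: le_trans opt_le _; rewrite ler_nat cards0 muln1 mulnC leq_mul2l.
  by apply/orP; right; apply: leq_trans pow2_le; rewrite leq_pmulr.
have AK : 0 < #|A| <= n.
  rewrite (leq_trans (max_card _) (K_n hyp)) andbT lt0n; apply/negP => /eqP A0.
  have := nu_eta num; rewrite A0 subn0 leqNgt => /negP; apply.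
  apply: leq_trans (ltn_expl K (isT : 1 < 8)) _.
  by rewrite leq_pmull // muln_gt0 expn_gt0 addn1.
pose lab v (g : G) := exists f Q b c x, [/\ good f Q, n <= #|Cov f0 f Q b c| + 3 * (E1 * a),
   x \in Q, f x = v & g = dih b c x].
have labE v : exists g, lab v g.
  have [x xA Hx] := exists_image_at (e_sym hyp) e_irr e_max v AK.
  set F := [set f in E | f x == v] in Hx.
  have F0 : 0 < #|F| by rewrite lt0n; apply: contraTneq Hx => ->; rewrite muln0 -ltnNge embs_gt0.
  have [f fF gf] : exists2 f, f \in F & good f (x |: Q0).
    apply: (@fiber_good _ [set x]) => //.
    - by apply/subsetP => f; rewrite in_set => /andP [].
    - exact: subsetUr.
    - exact: subsetUl.
    - by rewrite subUset sub1set xA.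
    - by rewrite cardsU1 addnC leq_add //; case: (_ \notin _).
    - by move=> f g z /setIdP [_ /eqP fx] /setIdP [_ /eqP gx] /set1P ->; rewrite fx.
    - apply: le_trans opt_le _; rewrite ler_nat cards1 expn1.
      apply: leq_trans (leq_mul (leqnn _) Hx) _.
      have -> : 2 ^ r * (2 * n * #|F|) = (#|F| * n) * (2 ^ r * 2) by ring.
      by rewrite leq_mul2l pow2_le orbT.
  have [b [c H]] := alignment g0 gf.
  exists (dih b c x), f, (x |: Q0), b, c, x; split=> //; first by rewrite !inE eqxx.
  by move: fF; rewrite in_set => /andP [_ /eqP].
pose pi v := sval (cid (labE v)).
exists pi => u v x y xA yA xy F0 HF.
set F := [set f in E | _] in F0 HF.
have [f fF gf] : exists2 f, f \in F & good f (x |: (y |: Q0)).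
  apply: (@fiber_good _ [set x; y]) => //.
  - by apply/subsetP => f; rewrite in_set => /andP [].
  - by apply/subsetP => z zQ; rewrite !inE zQ !orbT.
  - by apply/subsetP => z; rewrite !inE => /orP [] ->; rewrite ?orbT.
  - by rewrite !subUset !sub1set xA yA.
  - by rewrite !cardsU1 addnA addnC leq_add //; do 2 case: (_ \notin _).
  - move=> f g z /setIdP [_ /andP [/eqP fx /eqP fy]] /setIdP [_ /andP [/eqP gx /eqP gy]].
    by case/set2P => ->; rewrite ?fx ?fy ?gx ?gy.
  - by rewrite cards2 xy.
have [b [c H]] := alignment g0 gf.
move: fF; rewrite in_set => /andP [_ /andP [/eqP fx /eqP fy]].
exists b, c; split.
  rewrite /pi; case: cid => g /= [f' [Q' [b' [c' [x' [g' H' xQ' fx' ->]]]]]].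
  by apply: (label_unique g0 g' gf H' H xQ' _ _); rewrite ?fx' ?fx // !inE eqxx.
rewrite /pi; case: cid => g /= [f' [Q' [b' [c' [x' [g' H' xQ' fx' ->]]]]]].
by apply: (label_unique g0 g' gf H' H xQ' _ _); rewrite ?fx' ?fy // !inE eqxx orbT.
Qed.

End Labelling.

(** * Blow-up extremal_blow_up *)

Section Weights.
Variables (G : finZmodType) (V : finType) (A : {set G}) (h : rel G) (v0 : V) (pi : V -> G).

Definition part y : {set V} := [set v | pi v == y].
Local Notation w y := #|part y|.
Definition hembs : {set {ffun G -> G}} := embs A h h 0%R.
(** Defined without the edges on [V]: these are the transversal copies contained in every blow-up
    along [pi]. Before [e] is known to be such a blow-up, they serve as the count that [e] ought to
    reach. *)
Definition trans : {set {ffun G -> V}} :=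
  [set f : {ffun G -> V} | [forall (x | x \notin A), f x == v0] && is_emb A h h (pi \o f)].
Definition lift (f : {ffun G -> V}) : {ffun G -> G} :=
  [ffun x => if x \in A then pi (f x) else 0%R].

Lemma transP (f : {ffun G -> V}) :
  reflect ((forall x, x \notin A -> f x = v0) /\ is_emb A h h (pi \o f)) (f \in trans).
Proof.
rewrite inE; apply: (iffP (@andP _ _)) => -[H Hf]; split=> //.
  by move=> x xA; apply/eqP; move/forall_inP: H; apply.
by apply/forall_inP => x xA; rewrite H.
Qed.

Lemma lift_hembs f : f \in trans -> lift f \in hembs.
Proof.
case/transP => _ Hf; apply/embsP; split=> [x /negbTE xA|]; first by rewrite ffunE xA.
by rewrite -(is_emb_eq _ _ (_ : {in A, pi \o f =1 lift f})) // => x xA; rewrite ffunE xA.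
Qed.

Lemma sum_part : \sum_y w y = #|V|.
Proof.
rewrite -sum1_card (partition_big pi xpredT) //=; apply: eq_bigr => y _.
by rewrite sum1dep_card.
Qed.

Lemma card_lift_fiber (th : {ffun G -> G}) (B : {set G}) (c : G -> V) :
  th \in hembs -> B \subset A -> (forall x, x \in B -> pi (c x) = th x) ->
  #|[set f in trans | (lift f == th) && [forall x in B, f x == c x]]| =
  \prod_(x in A :\: B) w (th x).
Proof.
move=> /embsP [D Hth] /subsetP BA Hc.
pose F x : {set V} := if x \in A then (if x \in B then [set c x] else part (th x)) else [set v0].
transitivity #|[set f : {ffun G -> V} in family F]|.
  apply: eq_card => f; rewrite [RHS]inE; apply/setIdP/familyP.
    case=> /transP [off _] /andP [/eqP lf /forall_inP fc] x; rewrite /F.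
    case: ifP => xA; last by rewrite off ?xA ?set11.
    case: ifP => xB; first by rewrite inE fc.
    by rewrite inE -lf ffunE xA.
  move=> H.
  have off x : x \notin A -> f x = v0.
    by move=> /negbTE xA; have := H x; rewrite /F xA => /set1P.
  have fc x : x \in B -> f x = c x.
    by move=> xB; have := H x; rewrite /F (BA _ xB) xB => /set1P.
  have fp x : x \in A -> pi (f x) = th x.
    move=> xA; case: (boolP (x \in B)) => xB; first by rewrite fc // Hc.
    by have := H x; rewrite /F xA (negbTE xB) inE => /eqP.
  have lf : lift f = th.
    by apply/ffunP => x; rewrite ffunE; case: ifP => xA; rewrite ?fp // D ?xA.
  split; last by rewrite lf eqxx; apply/forall_inP => x /fc ->.
  by apply/transP; split=> //; rewrite (is_emb_eq _ _ (_ : {in A, _ =1 th})).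
rewrite cardsE card_family foldrE big_image /= (bigID (mem (A :\: B))) /=.
rewrite [X in _ * X]big1 ?muln1 => [|x]; last first.
  by rewrite in_setD negb_and negbK /F => /orP [xB|/negbTE ->]; rewrite ?(BA _ xB) ?xB cards1.
by apply: eq_bigr => x /setDP [xA /negbTE xB]; rewrite /F xA xB.
Qed.

Definition wprod (th : {ffun G -> G}) := \prod_(x in th @: A) w x.
Definition rprod (X : {set G}) (th : {ffun G -> G}) := \prod_(x in (th @: A) :\: X) w x.

Lemma wprodE (X : {set G}) (th : {ffun G -> G}) : X \subset th @: A -> wprod th = (\prod_(x in X) w x) * rprod X th.
Proof. by move=> XA; rewrite /wprod (big_setID X) /= (setIidPr XA). Qed.

(** A transversal map is a label map [th] together with a vertex from each part in its image; the
    parts met by [U] leave no choice. *)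
Lemma trans_count (U : {set V}) : {in U &, injective pi} ->
  #|[set f in trans | U \subset f @: A]| =
  \sum_(th in hembs | pi @: U \subset th @: A) rprod (pi @: U) th.
Proof.
move=> injU; rewrite -sum1_card.
rewrite (partition_big lift (mem hembs)) /=; last first.
  by move=> f /setIdP [ft _]; apply: lift_hembs.
rewrite [RHS]big_mkcondr; apply: eq_bigr => th thH.
have /embsP [D Hth] := thH.
have injth := is_emb_inj Hth.
case: ifP => sub; last first.
  rewrite big1 // => f /andP [/setIdP [ft Uf] /eqP lf]; move/negP: sub; case.
  apply/subsetP => _ /imsetP [u uU ->]; have /imsetP [x xA ->] := subsetP Uf u uU.
  by apply/imsetP; exists x => //; rewrite -lf ffunE xA.
pose B := [set x in A | th x \in pi @: U].
have BA : B \subset A by apply/subsetP => x /setIdP [].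
pose c x := odflt v0 [pick u in U | pi u == th x].
have cP x : x \in B -> c x \in U /\ pi (c x) = th x.
  case/setIdP => xA /imsetP [u uU Eu]; rewrite /c; case: pickP => /= [u' /andP [u'U /eqP] //|/(_ u)].
  by rewrite uU Eu eqxx.
rewrite sum1dep_card /rprod.
transitivity (\prod_(x in A :\: B) w (th x)); last first.
  rewrite -(@big_imset _ _ _ _ _ th (mem (A :\: B)) (fun y => w y)) /=; last first.
    by move=> x y /setDP [xA _] /setDP [yA _]; apply: injth.
  apply: eq_bigl => y; apply/imsetP/setDP => [[x /setDP [xA xB] ->]|[/imsetP [x xA ->] nU]].
    by split; [apply: imset_f | apply: contra xB => xU; apply/setIdP].
  by exists x => //; apply/setDP; split=> //; apply: contra nU => /setIdP [].
rewrite -(card_lift_fiber thH BA (fun x xB => (cP x xB).2)); apply: eq_card => f.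
rewrite !in_set -andbA; case: (boolP (f \in trans)) => ft; rewrite !in_set in ft; rewrite ?ft ?(negbTE ft) //=.
rewrite andbC; case: eqP => //= lf.
have fpi x : x \in A -> pi (f x) = th x by move=> xA; rewrite -lf ffunE xA.
apply/subsetP/forall_inP => [Uf x xB|fc u uU].
  have [cU pc] := cP x xB; have /imsetP [x' x'A E] := Uf _ cU.
  have xA := subsetP BA x xB.
  by rewrite E; apply/eqP; congr (f _); apply: injth => //; rewrite -pc E fpi.
have /imsetP [x xA Ex] := subsetP sub _ (imset_f pi uU).
have xB : x \in B by apply/setIdP; rewrite -Ex imset_f.
apply/imsetP; exists x => //; rewrite (eqP (fc x xB)).
by have [cU pc] := cP x xB; apply: injU => //; rewrite pc.
Qed.

Lemma card_trans : #|trans| = \sum_(th in hembs) wprod th.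
Proof.
have := @trans_count set0; rewrite imset0 => H.
transitivity #|[set f in trans | set0 \subset f @: A]|.
  by apply: eq_card => f; rewrite [RHS]in_set sub0set andbT.
rewrite H; last by move=> u v; rewrite inE.
by apply: eq_big => th; rewrite ?sub0set ?andbT // /rprod setD0.
Qed.

Definition blowup (e : rel V) := forall u v, pi u != pi v -> e u v = h (pi u) (pi v).

Lemma trans_embs e : blowup e -> trans \subset embs A h e v0.
Proof.
move=> He; apply/subsetP => f /transP [off /is_embP Hf]; apply/embsP; split=> //.
apply/is_embP => x y xA yA xy; have [pxy /= <-] := Hf x y xA yA xy.
by split; [apply: contraNneq pxy => /= -> | rewrite He].
Qed.

End Weights.

Lemma sum_mod_count m d j : j < d -> \sum_(0 <= i < m) (i %% d == j) = m %/ d + (j < m %% d).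
Proof.
move=> jd; have d0 : 0 < d by apply: leq_ltn_trans jd.
elim: m => [|m IH]; first by rewrite big_geq // div0n mod0n.
rewrite big_nat_recr //= IH divnS // modnS; have := ltn_mod m d; rewrite d0 => md.
case: ifP => dv; last first.
  by rewrite ltnS leq_eqVlt eq_sym; case: ltngtP => /=; lia.
have : m %% d = d.-1.
  have : (m %% d).+1 %% d == 0 by rewrite -addn1 modnDml addn1.
  rewrite -/(dvdn _ _) => /dvdn_leq -/(_ isT); lia.
by move=> ->; case: ltngtP => /=; lia.
Qed.

Lemma balanced_map (G V : finType) : 0 < #|G| -> exists pi : V -> G,
  forall y, #|[set v | pi v == y]| = #|V| %/ #|G| + (enum_rank y < #|V| %% #|G|).
Proof.
move=> G0; have m_lt (i : nat) : i %% #|G| < #|G| by rewrite ltn_mod.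
exists (fun v => enum_val (Ordinal (m_lt (enum_rank v)))) => y.
rewrite -sum_mod_count // big_mkord card_eq_sum.
rewrite (reindex (@enum_val V xpredT)) /=; last by apply: onW_bij; apply: enum_val_bij.
apply: eq_bigr => i _; congr nat_of_bool; apply/eqP/eqP => [<-|E].
  by rewrite enum_valK /= enum_valK.
by apply: enum_rank_inj; apply: val_inj; rewrite enum_valK /= enum_valK.
Qed.

(** * Comparison with the balanced blow-up *)

Section Rigidity.
Variables (R : realType) (G : finZmodType) (V : finType) (A : {set G}).
Variables (h : rel G) (e : rel V) (v0 : V).
Local Notation K := #|G|.
Local Notation n := #|V|.
Local Notation a := (#|V| %/ #|G|).
Local Notation r := (#|G| - #|A|).
Variables (q l de rho t s3 E1 th be : nat) (Q0 : {set G}).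
Hypothesis hyp : setup A h e q l Q0.
Hypothesis psr : pseudorandom h de rho t s3.
Hypothesis num : numeric K r q l de rho t s3 E1 th be.
Hypothesis e_irr : irreflexive e.
Hypothesis e_max : extremal A h e v0.
Hypothesis QA0 : Q0 \subset A.
Hypothesis cQ0 : #|Q0| <= q.

Local Notation E := (embs A h e v0).
Local Notation Hm := (hembs A h).
Local Notation opt := (optimum R V A).

Lemma hembs_gt0 : 0 < #|Hm|.
Proof.
apply/card_gt0P; exists [ffun x => if x \in A then x else 0%R].
apply/embsP; split=> [x /negbTE xA|]; first by rewrite ffunE xA.
by apply/is_embP => x y xA yA xy; rewrite !ffunE xA yA.
Qed.

Lemma card_hembs_img th' : th' \in Hm -> #|th' @: A| = #|A|.
Proof. by case/embsP => _; apply: card_emb_img. Qed.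

(** [pot_prod] on the image of [th']; the [r] labels outside it cost [lam ^ (a * r) <= 4 ^ r]. *)
Lemma wprod_le (pi : V -> G) th' : th' \in Hm ->
  ((wprod A pi th')%:R <= 4 ^+ r * opt)%R.
Proof.
move=> tH; have a0 := a_gt0 hyp; have l0 := lam_gt0 R a0.
have := pot_prod R a0 (th' @: A) (fun y => #|part pi y|); rewrite card_hembs_img // => H.
rewrite -(ler_pM2r (_ : (0 < lam R a ^+ (a * #|A|))%R)); last by rewrite exprn_gt0.
rewrite natr_prod; apply: le_trans H _.
apply: le_trans (_ : (a%:R ^+ #|A| * lam R a ^+ n <= _)%R).
  rewrite ler_wpM2l ?exprn_ge0 //; apply: ler_weXn2l; first exact: lam_ge1.
  by rewrite -(sum_part pi) [leqRHS](bigID (mem (th' @: A))) /= leq_addr.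
have -> : (lam R a ^+ n = lam R a ^+ (n %% K) * lam R a ^+ (a * r) * lam R a ^+ (a * #|A|))%R.
  rewrite -!exprD -addnA -mulnDr subnK ?max_card // addnC.
  by congr (_ ^+ _)%R; exact: divn_eq.
rewrite !mulrA ler_pM2r ?exprn_gt0 // -mulrA /optimum -[leRHS]mulrA [leRHS]mulrCA ler_wpM2l ?exprn_ge0 //.
rewrite [leRHS]mulrC ler_wpM2l ?exprn_ge0 ?(ltW l0) // exprM.
by rewrite lerXn2r ?nnegrE ?exprn_ge0 ?(ltW l0) // lam_le4.
Qed.

(** Extremality against the balanced blow-up along [balanced_map]. A label map misses [r] labels,
    hence at most [r] of the larger parts, each worth a factor [lam <= 2]. *)
Lemma opt_hembs : (#|Hm|%:R * opt <= (2 ^ r * #|E|)%:R)%R.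
Proof.
have a0 := a_gt0 hyp; have l0 := lam_gt0 R a0.
have K0 : 0 < K by apply: leq_trans (K_big hyp).
have [pi Hpi] := @balanced_map G V K0.
pose e' : rel V := fun u v => h (pi u) (pi v).
have := e_max (e' := e') (fun u v => ps_sym psr _ _) (fun u => ps_irr psr _).
have blow : blowup h pi e' by [].
move=> /(leq_trans (subset_leq_card (trans_embs A v0 blow))); rewrite card_trans => H.
apply: le_trans (_ : (\sum_(th' in Hm) opt <= _)%R).
  by rewrite big_const iter_addr_0 mulr_natl.
rewrite natrM natrX; apply: le_trans (ler_wpM2l _ (_ : ((\sum_(i in Hm) wprod A pi i)%:R <= _)%R)); last 2 first.
- by rewrite exprn_ge0.
- by rewrite ler_nat; exact: H.
rewrite natr_sum big_distrr /=; apply: ler_sum => th' tH.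
pose c := #|[set y in th' @: A | enum_rank y < n %% K]|.
have -> : ((wprod A pi th')%:R = a%:R ^+ #|A| * lam R a ^+ c :> R)%R.
  rewrite /wprod natr_prod -(card_hembs_img tH) -prodr_const /c.
  have -> : (lam R a ^+ #|[set y in th' @: A | (enum_rank y < n %% K)%N]| =
     \prod_(y in th' @: A) (if (enum_rank y < n %% K)%N then lam R a else 1))%R.
    by rewrite -big_mkcondr /= -prodr_const; apply: eq_bigl => y; rewrite inE.
  rewrite -big_split; apply: eq_bigr => y _ /=; rewrite /part Hpi natrD.
  case: ifP => _; rewrite ?mulr1 ?addr0 // /lam mulrDr mulr1 divff //.
  by rewrite pnatr_eq0 -lt0n.
rewrite mulrCA /optimum ler_wpM2l ?exprn_ge0 //.
have cb : n %% K <= r + c.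
  have cK : #|[set y : G | enum_rank y < n %% K]| = n %% K.
    rewrite card_eq_sum (reindex (@enum_val G xpredT)) /=; last by apply: onW_bij; apply: enum_val_bij.
    under eq_bigr do rewrite enum_valK.
    rewrite -(big_mkord xpredT (fun i => nat_of_bool (i < n %% K))).
    rewrite (big_cat_nat _ (n := n %% K)) //=; last by rewrite ltnW // ltn_mod.
    rewrite [X in _ + X]big1_seq ?addn0; last first.
      by move=> i /andP [_]; rewrite mem_index_iota => /andP [+ _]; rewrite leqNgt => /negbTE ->.
    rewrite big_nat (eq_bigr (fun=> 1)) => [|i /andP [_ ->] //].
    by rewrite -big_nat sum_nat_const_nat subn0 muln1.
  rewrite -{1}cK -(cardsID (th' @: A)) addnC; apply: leq_add.
    apply: leq_trans (_ : #|~: (th' @: A)| <= _).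
      by apply: subset_leq_card; apply/subsetP => y; rewrite !inE => /andP [].
    by rewrite -(card_hembs_img tH) -(cardsC (th' @: A)) addKn.
  by apply: subset_leq_card; apply/subsetP => y; rewrite !inE andbC.
apply: le_trans (_ : (lam R a ^+ (r + c) <= _)%R).
  by apply: ler_weXn2l => //; exact: lam_ge1.
rewrite exprD ler_wpM2r ?exprn_ge0 ?(ltW l0) // lerXn2r ?nnegrE ?(ltW l0) //.
exact: lam_le2.
Qed.

Lemma opt_le : (opt <= (2 ^ r * #|E|)%:R)%R.
Proof.
apply: le_trans opt_hembs; rewrite ler_peMl ?(ltW (opt_gt0 _ hyp)) // ler1n.
exact: hembs_gt0.
Qed.

Lemma hembs_translate c th' : th' \in Hm ->
  [ffun x => if x \in A then (th' x + c)%R else 0%R] \in Hm.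
Proof.
case/embsP => D /is_embP H; apply/embsP; split=> [x /negbTE xA|]; first by rewrite ffunE xA.
apply/is_embP => x y xA yA xy; have [n1 n2] := H x y xA yA xy.
by rewrite !ffunE xA yA (inj_eq (addIr c)) (ps_add psr).
Qed.

(** Translations act on the label maps and move any label to any other, so all labels are avoided
    equally often, while each map avoids exactly [r]. *)
Lemma avoid_count z : (#|[set th' in Hm | z \notin th' @: A]| * K = #|Hm| * r)%N.
Proof.
have le z1 z2 : #|[set th' in Hm | z1 \notin th' @: A]| <= #|[set th' in Hm | z2 \notin th' @: A]|.
  pose T (th' : {ffun G -> G}) : {ffun G -> G} :=
    [ffun x => if x \in A then (th' x + (z2 - z1))%R else 0%R].
  have T_inj : {in [set th' in Hm | z1 \notin th' @: A] &, injective T}.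
    move=> f g /setIdP [/embsP [Df _] _] /setIdP [/embsP [Dg _] _] /ffunP H; apply/ffunP => x.
    have := H x; rewrite !ffunE; case: ifP => xA; first by move/addIr.
    by rewrite Df ?Dg ?xA.
  rewrite -(card_in_imset T_inj); apply: subset_leq_card; apply/subsetP => _ /imsetP [f /setIdP [fH zf] ->].
  apply/setIdP; split; first exact: hembs_translate.
  apply: contra zf => /imsetP [x xA]; rewrite ffunE xA => E; apply/imsetP; exists x => //.
  by apply: (addIr (z2 - z1)%R); rewrite -E addrC subrK.
have -> : #|[set th' in Hm | z \notin th' @: A]| * K = \sum_(y : G) #|[set th' in Hm | y \notin th' @: A]|.
  by rewrite mulnC -sum_nat_const; apply: eq_bigr => y _; apply/eqP; rewrite eqn_leq !le.
under eq_bigr do rewrite card_setId_sum.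
rewrite exchange_big -sum_nat_const; apply: eq_bigr => th' tH /=.
rewrite -(card_hembs_img tH) -(cardsC (th' @: A)) addKn -sum_mem.
by apply: eq_bigr => y _; rewrite inE.
Qed.

(** [8 ^ r] is the product of [4 ^ r] from [wprod_le] and [2 ^ r] from [opt_hembs]. *)
Lemma avoid_le (pi : V -> G) z :
  \sum_(th' in Hm | z \notin th' @: A) wprod A pi th' * K <= r * 8 ^ r * #|E|.
Proof.
rewrite -(ler_nat R) natr_sum.
apply: le_trans (_ : \sum_(th' in Hm | z \notin th' @: A) (4 ^+ r * opt * K%:R) <= _)%R.
  by apply: ler_sum => th' /andP [tH _]; rewrite natrM ler_wpM2r ?wprod_le.
rewrite big_const iter_addr_0 -[leLHS]mulr_natl.
have -> : #|[pred th' | (th' \in Hm) && (z \notin th' @: A)]| = #|[set th' in Hm | z \notin th' @: A]|.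
  by rewrite cardsE.
have cE (c : nat) : (c%:R * (4 ^+ r * opt * K%:R) = (c * K)%:R * (4 ^+ r * opt) :> R)%R.
  by rewrite natrM; ring.
rewrite cE avoid_count natrM.
have -> : (#|Hm|%:R * r%:R * (4 ^+ r * opt) = r%:R * 4 ^+ r * (#|Hm|%:R * opt) :> R)%R by ring.
apply: le_trans (ler_wpM2l _ opt_hembs) _; first by rewrite mulr_ge0 ?exprn_ge0.
rewrite -natrX -!natrM ler_nat; have -> : 8 ^ r = 4 ^ r * 2 ^ r by rewrite -expnMn.
by rewrite !mulnA.
Qed.

Lemma avoid_small (pi : V -> G) z :
  100 * (r + 1) * (\sum_(th' in Hm | z \notin th' @: A) wprod A pi th') <= #|E|.
Proof.
have K0 : 0 < K by apply: leq_trans (K_big hyp).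
rewrite -(leq_pmul2r K0) -mulnA big_distrl /=.
apply: leq_trans (leq_mul (leqnn _) (avoid_le pi z)) _.
have := nu_eta num; move: (r) (8 ^ r) (#|E|) => m x y H.
apply: leq_trans (_ : 100 * (m + 1) ^ 2 * x * y <= _); last by rewrite [leqRHS]mulnC leq_mul2r H orbT.
have -> : 100 * (m + 1) * (m * x * y) = 100 * (m + 1) * x * y * m by ring.
have -> : 100 * (m + 1) ^ 2 * x * y = 100 * (m + 1) * x * y * (m + 1) by ring.
by rewrite leq_mul2l leq_addr orbT.
Qed.

(** A label map using both labels has weight at most [n ^ 2] times its [rprod]; the others go to the
    two avoidance sums. So vertices with different labels share about [#|E| / n ^ 2] transversal
    maps, once nearly all copies are known to be transversal. *)
Lemma rprod_both (pi : V -> G) u v : pi u != pi v ->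
  #|trans A h v0 pi| <= n ^ 2 * #|[set f in trans A h v0 pi | [set u; v] \subset f @: A]|
    + \sum_(th' in Hm | pi u \notin th' @: A) wprod A pi th'
    + \sum_(th' in Hm | pi v \notin th' @: A) wprod A pi th'.
Proof.
move=> uv; have injU : {in [set u; v] &, injective pi}.
  move=> x y /set2P [] -> /set2P [] -> // E.
    by rewrite E eqxx in uv.
  by rewrite -E eqxx in uv.
rewrite trans_count // card_trans big_distrr /= imsetU !imset_set1.
rewrite [X in _ <= X + _ + _]big_mkcondr /= ![X in _ <= _ + X]big_mkcondr /= [X in _ <= _ + X + _]big_mkcondr /= -!big_split /=.
apply: leq_sum => th' tH; rewrite subUset !sub1set.
case: (boolP (pi u \in th' @: A)) => pu; last by rewrite /= addnAC leq_addl.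
case: (boolP (pi v \in th' @: A)) => pv; last by rewrite /= leq_addl.
rewrite /= !addn0 (@wprodE _ _ A pi [set pi u; pi v]); last first.
  by rewrite subUset !sub1set pu.
rewrite leq_mul2r; apply/orP; right.
rewrite big_setU1 ?inE //= big_set1 expnS expn1 leq_mul ?max_card //.
Qed.

Lemma extremal_blow_up : exists2 pi : V -> G, blowup h pi e &
  #|E :\: trans A h v0 pi| * K ^ q <= #|E|.
Proof.
have e_sym := e_sym hyp; have rq := r_q hyp.
have Kb := K_big hyp; have K0 : 0 < K by apply: leq_trans Kb.
have K1 : 1 < K by apply: leq_trans Kb.
have M0 : 0 < #|E| := embs_gt0 hyp opt_le.
have n0 : 0 < n by apply: leq_trans (K_n hyp).
have [pi Hpi] := labelling hyp psr num e_irr e_max QA0 cQ0 opt_le.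
set C := trans A h v0 pi.
pose F (p : (G * G) * (V * V)) := [set f in E | (f p.1.1 == p.2.1) && (f p.1.2 == p.2.2)].
pose off p := [&& p.1.1 \in A, p.1.2 \in A, p.1.1 != p.1.2 &
  ~~ ((pi p.2.1 != pi p.2.2) && (h (pi p.2.1) (pi p.2.2) == h p.1.1 p.1.2))].
have K4 : K ^ 2 * 2 ^ r <= K ^ (4 * q).
  apply: leq_trans (_ : K ^ 2 * K ^ r <= _).
    by rewrite leq_mul2l; apply/orP; right; case: (r) => [|m]; rewrite ?expn0 // leq_exp2r.
  by rewrite -expnD leq_pexp2l //; clear -rq; lia.
(* The contrapositive of [labelling]: a large family of copies through [u] and [v] would make the
   two labels the image of [x] and [y] under one symmetry. *)
have off_small p : off p -> #|F p| * n ^ 2 * K ^ (5 * q) <= 2 ^ r * #|E|.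
  case: p => -[x y] [u v] /and4P /= [xA yA xy no].
  have [->|F0] := posnP #|F (x, y, (u, v))|; first by rewrite !mul0n.
  rewrite leqNgt; apply: contra no => big.
  have [|b [c [-> ->]]] := Hpi u v x y xA yA xy F0.
    by apply: le_trans opt_le _; rewrite ler_nat ltnW.
  rewrite (h_dih psr) eqxx andbT; apply: contra xy.
  by rewrite /dih (inj_eq (addIr c)); case: (b); rewrite ?(inj_eq oppr_inj).
(* Of [K ^ (5 * q)], a part [K ^ (4 * q)] pays for the [K ^ 2] pairs of roles and for [2 ^ r]; the
   gain [K ^ q] remains. *)
have cover (S : {set {ffun G -> V}}) (P : {set (G * G) * (V * V)}) m : #|P| <= K ^ 2 * m ->
    (forall f, f \in S -> exists2 p, p \in P & f \in F p) ->
    (forall p, p \in P -> 0 < #|F p| -> off p) -> #|S| * n ^ 2 * K ^ q <= m * #|E|.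
  move=> cP Scov Poff.
  have : #|S| * (n ^ 2 * K ^ (5 * q)) <= K ^ 2 * m * (2 ^ r * #|E|).
    apply: leq_trans (_ : (\sum_(p in P) #|F p|) * (n ^ 2 * K ^ (5 * q)) <= _).
      rewrite leq_mul2r; apply/orP; right; rewrite -sum1_card.
      apply: leq_trans (_ : \sum_(f in S) \sum_(p in P) (f \in F p) <= _).
        by apply: leq_sum => f /Scov [p pP fp]; rewrite (bigD1 p) //= fp.
      rewrite exchange_big; apply: leq_sum => p _.
      by rewrite -[leqRHS]sum_mem [leqLHS]big_mkcond; apply: leq_sum => f _; case: ifP.
    rewrite big_distrl /=; apply: leq_trans (_ : \sum_(p in P) (2 ^ r * #|E|) <= _).
      apply: leq_sum => p pP; have [->|F0] := posnP #|F p|; first by rewrite mul0n.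
      by rewrite mulnA off_small ?Poff.
    by rewrite sum_nat_const leq_mul2r cP orbT.
  have -> : K ^ (5 * q) = K ^ (4 * q) * K ^ q by rewrite -expnD; congr (_ ^ _); clear; lia.
  move=> H; rewrite -(leq_pmul2r (_ : 0 < K ^ (4 * q))); last by rewrite expn_gt0 K0.
  have -> : #|S| * n ^ 2 * K ^ q * K ^ (4 * q) = #|S| * (n ^ 2 * (K ^ (4 * q) * K ^ q)) by ring.
  apply: leq_trans H _.
  have -> : K ^ 2 * m * (2 ^ r * #|E|) = (m * #|E|) * (K ^ 2 * 2 ^ r) by ring.
  by rewrite leq_mul2l K4 orbT.
have cEC : #|E :\: C| * K ^ q <= #|E|.
  have : #|E :\: C| * n ^ 2 * K ^ q <= n ^ 2 * #|E|.
    apply: (cover _ [set p | off p]) => [|f /setDP [fE fC]|p]; last by rewrite inE.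
      by apply: leq_trans (max_card _) _; rewrite !card_prod !expnS !expn0 !muln1.
    have /embsP [offA Ef] := fE.
    have : ~~ is_emb A h h (pi \o f).
      by apply: contra fC => H; apply/transP.
    rewrite negb_forall_in => /exists_inP [x xA]; rewrite negb_forall_in => /exists_inP [y yA].
    rewrite negb_imply => /andP [xy no].
    exists (x, y, (f x, f y)); first by rewrite inE /off /= xA yA xy.
    by apply/setIdP; rewrite !eqxx.
  rewrite mulnAC [n ^ 2 * _]mulnC leq_pmul2r // expn_gt0.
  by rewrite n0.
exists pi => //.
(* Correcting the bad pairs makes the maps in [B] copies, about [#|E| / n ^ 2] for each bad pair up
   to a factor [K ^ 2]. Only copies in [D] can be destroyed, and these are fewer by a factor
   [K ^ q]. *)
pose Bad := [set p : V * V | (pi p.1 != pi p.2) && (e p.1 p.2 != h (pi p.1) (pi p.2))].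
pose hasbad (f : {ffun G -> V}) := [exists x in A, exists y in A, (f x, f y) \in Bad].
pose D := [set f in E | hasbad f].
have cD : #|D| * n ^ 2 * K ^ q <= #|Bad| * #|E|.
  apply: (cover _ [set p | [&& p.1.1 \in A, p.1.2 \in A, p.1.1 != p.1.2 & p.2 \in Bad]]).
  - apply: leq_trans (_ : #|setX [set: G * G] Bad| <= _).
      by apply: subset_leq_card; apply/subsetP => -[p b]; rewrite !inE => /and4P [_ _ _ ->].
    by rewrite cardsX cardsT card_prod mulnn.
  - move=> f /setIdP [fE /exists_inP [x xA /exists_inP [y yA fB]]].
    exists (x, y, (f x, f y)); last by apply/setIdP; rewrite !eqxx.
    rewrite inE /= xA yA fB andbT; apply: contraTneq fB => ->.
    by rewrite inE eqxx.
  - move=> [[x y] [u v]]; rewrite inE /= => /and4P [xA yA xy].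
    rewrite inE /= => /andP [_ euv] /card_gt0P [f /setIdP [/embsP [_ /is_embP Ef] /andP [/eqP fx /eqP fy]]].
    rewrite /off /= xA yA xy /= negb_and; apply/orP; right.
    have [_] := Ef x y xA yA xy; rewrite /= in fx fy; rewrite fx fy => <-.
    by rewrite eq_sym.
pose e' u v := if pi u != pi v then h (pi u) (pi v) else e u v.
have e'_sym : symmetric e' by move=> u v; rewrite /e' eq_sym (ps_sym psr) e_sym.
have e'_irr : irreflexive e' by move=> u; rewrite /e' eqxx e_irr.
have blow' : blowup h pi e' by move=> u v uv; rewrite /e' uv.
set E' := embs A h e' v0.
pose B := [set f in C | hasbad f].
(* Maximality of [e]: the copies lost in passing to [e'] lie in [D], and all of [B] is gained. *)
have cBD : #|B| <= #|D|.
  have sub1 : E :\: E' \subset D.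
    apply/subsetP => f /setDP [fE fE']; apply/setIdP; split=> //.
    have /embsP [offA /is_embP Ef] := fE.
    have : ~~ is_emb A h e' f by apply: contra fE' => H; apply/embsP.
    rewrite negb_forall_in => /exists_inP [x xA]; rewrite negb_forall_in => /exists_inP [y yA].
    rewrite negb_imply => /andP [xy no]; have [fxy efxy] := Ef x y xA yA xy.
    apply/exists_inP; exists x => //; apply/exists_inP; exists y => //.
    move: no; rewrite fxy -efxy /= /e' inE /=; case: (pi (f x) != pi (f y)); rewrite ?eqxx //=.
    by rewrite eq_sym.
  have sub2 : B \subset E' :\: E.
    apply/subsetP => f /setIdP [fC /exists_inP [x xA /exists_inP [y yA]]].
    rewrite inE /= => /andP [pxy bad]; apply/setDP; split.
      exact: (subsetP (trans_embs A v0 blow')).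
    apply/negP => /embsP [_ /is_embP Ef].
    have xy : x != y by apply: contraNneq pxy => ->.
    have [_ efxy] := Ef x y xA yA xy.
    have /transP [_ /is_embP Hf] := fC; have [_ /= hfxy] := Hf x y xA yA xy.
    by rewrite efxy hfxy eqxx in bad.
  apply: leq_trans (subset_leq_card sub2) (leq_trans _ (subset_leq_card sub1)).
  have := e_max e'_sym e'_irr.
  by rewrite -(cardsID E E') -(cardsID E' E) setIC leq_add2l.
have cB : \sum_(p in Bad) #|[set f in C | [set p.1; p.2] \subset f @: A]| <= #|B| * K ^ 2.
  under eq_bigr do rewrite card_setId_sum.
  rewrite exchange_big /= (big_setID [set f | hasbad f]) /=.
  rewrite [X in _ + X]big1 ?addn0; last first.
    move=> f /setDP [fC]; rewrite inE => nb; apply: big1 => p pB.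
    rewrite subUset !sub1set; case: imsetP => //= -[x xA Ex]; case: imsetP => //= -[y yA Ey].
    case/negP: nb; apply/exists_inP; exists x => //; apply/exists_inP; exists y => //.
    by rewrite -Ex -Ey -surjective_pairing.
  have -> : C :&: [set f | hasbad f] = B by apply/setP => f; rewrite !inE.
  rewrite -sum_nat_const; apply: leq_sum => f fB.
  apply: leq_trans (_ : \sum_(p : V * V) (p \in setX (f @: A) (f @: A)) <= _).
    rewrite [leqLHS]big_mkcond; apply: leq_sum => -[u v] _ /=.
    by rewrite in_setX subUset !sub1set; case: ifP.
  rewrite sum_mem cardsX -mulnn leq_mul //; apply: leq_trans (leq_imset_card _ _) (max_card _).
have each p : p \in Bad ->
    97 * #|E| <= 100 * (n ^ 2 * #|[set f in C | [set p.1; p.2] \subset f @: A]|).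
  rewrite inE => /andP [pp _]; have := rprod_both pp.
  have := avoid_small pi (pi p.1); have := avoid_small pi (pi p.2).
  have : #|E| <= #|C| + #|E :\: C|.
    by rewrite -(cardsID C E) leq_add2r subset_leq_card // subsetIr.
  have : 100 * #|E :\: C| <= #|E|.
    apply: leq_trans cEC; rewrite mulnC leq_mul2l; apply/orP; right.
    apply: leq_trans (_ : 2 ^ 10 <= _) => //; apply: leq_trans Kb _.
    by rewrite -{1}(expn1 K) leq_pexp2l //; clear -rq; lia.
  rewrite -/C; move: (\sum_(_ in _ | _) _) (\sum_(_ in _ | _) _) => s1 s2.
  move: (n ^ 2 * _) => X H1 H2 H3 H4 H5.
  have : 100 * s1 <= #|E| by apply: leq_trans H4; rewrite leq_mul2r leq_pmulr ?orbT // addn1.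
  have : 100 * s2 <= #|E| by apply: leq_trans H3; rewrite leq_mul2r leq_pmulr ?orbT // addn1.
  by move: H1 H2 H5; clear; lia.
have Bad0 : #|Bad| = 0.
  apply: contraTeq isT; rewrite -lt0n => Bpos.
  have : #|Bad| * (97 * #|E|) <= 100 * n ^ 2 * (#|D| * K ^ 2).
    apply: leq_trans (_ : 100 * n ^ 2 * (#|B| * K ^ 2) <= _); last first.
      by rewrite !leq_mul2l leq_mul2r cBD !orbT.
    apply: leq_trans (leq_mul (leqnn _) cB); rewrite -sum_nat_const big_distrr /=.
    by apply: leq_sum => p /each; rewrite mulnA.
  move=> /(leq_mul (leqnn (K ^ q))).
  have -> : K ^ q * (100 * n ^ 2 * (#|D| * K ^ 2)) = 100 * K ^ 2 * (#|D| * n ^ 2 * K ^ q) by ring.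
  move=> H; have := leq_trans H (leq_mul (leqnn (100 * K ^ 2)) cD).
  have -> : K ^ q * (#|Bad| * (97 * #|E|)) = (97 * K ^ q) * (#|Bad| * #|E|) by ring.
  rewrite leq_pmul2r ?muln_gt0 ?Bpos ?M0 //.
  have -> : K ^ q = K ^ 2 * K ^ (q - 2) by rewrite -expnD; congr (_ ^ _); clear -rq; lia.
  rewrite mulnA leqNgt; case/negP.
  have : 1024 <= K ^ (q - 2).
    by apply: leq_trans Kb _; rewrite -{1}(expn1 K) leq_pexp2l //; clear -rq; lia.
  have : 0 < K ^ 2 by rewrite expn_gt0 K0.
  by move: (K ^ 2) (K ^ (q - 2)) => x y; clear; nia.
move=> u v uv; apply/eqP; apply: contraTT isT => ne.
have : 0 < #|Bad| by apply/card_gt0P; exists (u, v); rewrite inE /= uv.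
by rewrite Bad0.
Qed.

End Rigidity.

(** * Modules of the host graph and copies inside one part *)

Section Primality.
Variables (G : finZmodType) (V : finType) (A : {set G}) (h : rel G) (v0 : V) (pi : V -> G).
Local Notation K := #|G|.
Local Notation r := (#|G| - #|A|).
Variables (q l de rho t s3 E1 th be : nat).
Hypothesis psr : pseudorandom h de rho t s3.
Hypothesis num : numeric K r q l de rho t s3 E1 th be.

Let h_sym := ps_sym psr.

(** By translation all these counts are equal, and an element separating [x] from [y] has the value
    [b] at one of the two. *)
Lemma degree_large (b : bool) (c x y : G) : x != y -> de <= 2 * #|[set z | (z != c) && (h c z == b)]|.
Proof.
move=> xy; pose S c := [set z | (z != c) && (h c z == b)].
have cS c1 c2 : #|S c1| <= #|S c2|.
  rewrite -(card_imset _ (addIr (c2 - c1)%R)); apply: subset_leq_card.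
  apply/subsetP => _ /imsetP [z + ->]; rewrite !inE => /andP [zc /eqP <-].
  have E : c2 = (c1 + (c2 - c1))%R by rewrite addrC subrK.
  by rewrite {2 3}E (ps_add psr) (inj_eq (addIr _)) zc eqxx.
rewrite mul2n -addnn; apply: leq_trans (ps_sep psr xy) _.
apply: leq_trans (_ : #|S x :|: S y| <= _); last first.
  by apply: leq_trans (leq_card_setU _ _) _; apply: leq_add; apply: cS.
apply: subset_leq_card; apply/subsetP => z; rewrite !inE => /and3P [-> -> /=].
by case: (h x z); case: (h y z); case: (b).
Qed.

Definition rows (cs ds : seq G) : {set {set G}} :=
  [set cl (p.1 - p.2)%R | p in [set p : G * G | (p.1 \in cs) && (p.2 \in ds)]].

Lemma card_rows cs ds : #|rows cs ds| <= size cs * size ds.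
Proof.
apply: leq_trans (leq_imset_card _ _) _.
apply: leq_trans (_ : #|setX [set u in cs] [set u in ds]| <= _).
  by apply: subset_leq_card; apply/subsetP => -[u v]; rewrite !inE /=.
by rewrite cardsX !cardsE leq_mul // card_size.
Qed.

(** Greedy choice of rows. For each [d] in [ds] a used class excludes two elements of [C], so some
    [c] has only fresh differences; its row adds at least [size ds / 2] classes. *)
Lemma many_rows (C : {set G}) (ds : seq G) i : uniq ds ->
  2 * i * size ds ^ 2 < #|C| ->
  exists cs, [/\ size cs = i, {subset cs <= C} & i * size ds <= 2 * #|rows cs ds|].
Proof.
move=> uds; elim: i => [_|i IH iC]; first by exists [::].
have [|cs [sz csC Hcs]] := IH; first by apply: leq_ltn_trans iC; rewrite leq_mul2r leq_mul2l leqnSn !orbT.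
pose stale := \bigcup_(d <- ds) [set c in C | cl (c - d)%R \in rows cs ds].
have stale1 d : #|[set c in C | cl (c - d)%R \in rows cs ds]| <= 2 * (i * size ds).
  apply: leq_trans (_ : 2 * #|rows cs ds| <= _); last by rewrite leq_mul2l -sz card_rows.
  apply: leq_trans (@card_imset_le2 _ _ (fun c => cl (c - d)%R) _ _) _.
    move=> c _; apply: leq_trans (_ : #|[set c; d - (c - d)]%R| <= _).
      apply: subset_leq_card; apply/subsetP => c'; rewrite !inE => /andP [_].
      rewrite cl_eq => /orP [] /eqP E; first by rewrite (can_inj (subrK d) E) eqxx.
      by rewrite E opprK addrC subrK eqxx orbT.
    by rewrite cards2; case: (_ != _).
  rewrite leq_mul2l /=; apply: subset_leq_card; apply/subsetP => _ /imsetP [c + ->].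
  by rewrite inE => /andP [].
have stale_le : #|stale| <= size ds * (2 * (i * size ds)).
  by apply: card_bigcup_seq => d _; apply: stale1.
have [c cC cs'] : exists2 c, c \in C & c \notin stale.
  apply/subsetPn; apply/negP => /subset_leq_card H.
  have := leq_trans (leq_trans iC H) stale_le; rewrite expnS expn1; nia.
have fresh d : d \in ds -> cl (c - d)%R \notin rows cs ds.
  by move=> dd; apply: contra cs' => cr; apply: (mem_bigcup_seq dd); rewrite inE cC.
exists (c :: cs); split=> /=; first by rewrite sz.
  by move=> u; rewrite inE => /orP [/eqP ->|/csC].
have new : size ds <= 2 * #|[set cl (c - d)%R | d in [set d in ds]]|.
  have -> : size ds = #|[set d in ds]| by rewrite cardsE (card_uniqP uds).
  apply: card_imset_le2 => d _; apply: leq_trans (_ : #|[set d; c - (d - c)]%R| <= _).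
    apply: subset_leq_card; apply/subsetP => d'; rewrite !inE => /andP [_].
    rewrite cl_eq => /orP [] /eqP E; first by rewrite (can_inj (subKr c) E) eqxx.
    by rewrite opprB E opprB addrCA subrr addr0 eqxx orbT.
  by rewrite cards2; case: (_ != _).
have img : #|rows cs ds| + #|[set cl (c - d)%R | d in [set d in ds]]| <= #|rows (c :: cs) ds|.
  rewrite -cardsUI (_ : _ :&: _ = set0) ?cards0 ?addn0; last first.
    apply/setP => s; rewrite inE in_set0; apply/negP => /andP [sr /imsetP [d]].
    by rewrite inE => dd Es; have := fresh d dd; rewrite -Es sr.
  apply: subset_leq_card; apply/subsetP => s /setUP [] /imsetP [].
    move=> [u v]; rewrite inE /= => /andP [us vs] ->; apply/imsetP; exists (u, v) => //.
    by rewrite !inE us vs orbT.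
  move=> d; rewrite inE => dd ->; apply/imsetP; exists (c, d) => //.
  by rewrite !inE eqxx dd.
have fin j k x y z : j * k <= 2 * x -> k <= 2 * y -> x + y <= z -> j.+1 * k <= 2 * z.
  by clear; nia.
exact: fin Hcs new img.
Qed.

(** Elements of [A] outside a module [D] cannot separate [x] from [y], so [D] is large. A vertex
    [c0] outside sees all of [D] alike, so every vertex it sees the other way lies outside [D], and
    [A :\: D] is large too. Then [many_rows] finds tuples forbidden by [ps_prime]. *)
Lemma no_module (D : {set G}) x y : D \subset A -> D != A -> x \in D -> y \in D -> x != y ->
  ~ (forall c d d', c \in A :\: D -> d \in D -> d' \in D -> h c d = h c d').
Proof.
move=> DA nDA xD yD xy homog.
have [c0 c0C] : exists c, c \in A :\: D.
  by apply/set0Pn; rewrite setD_eq0; apply: contra nDA => AD; rewrite eqEsubset DA.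
have cA : #|~: A| = r by rewrite -(cardsC A) addKn.
have cD : de <= #|D| + r.
  rewrite -cA; apply: leq_trans (leq_card_setU D (~: A)).
  apply: leq_trans (ps_sep psr xy) _; apply: subset_leq_card; apply/subsetP => z.
  rewrite !inE => /and3P [_ _ hz]; case: (boolP (z \in D)) => //= zD.
  apply: contra hz => zA; rewrite h_sym [h y z]h_sym.
  by rewrite (homog z x y) // inE zD.
have cC : de <= 2 * (#|A :\: D| + r).
  apply: leq_trans (degree_large (~~ h c0 x) c0 xy) _; rewrite leq_mul2l /= -cA.
  apply: leq_trans (leq_card_setU _ _); apply: subset_leq_card; apply/subsetP => z.
  rewrite in_set in_setU in_setD in_setC => /andP [_ hz].
  case: (boolP (z \in A)) => zA; rewrite ?orbT // orbF andbT.
  apply: contraTN hz => zD; rewrite (homog c0 z x) //.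
  by case: (h c0 x).
have np := nu_prime num.
pose ds := take s3 (enum D).
have sds : size ds = s3.
  by rewrite size_takel // -cardE; move: np cD; clear; nia.
have uds : uniq ds by apply: take_uniq; apply: enum_uniq.
have dsD d : d \in ds -> d \in D by move/mem_take; rewrite mem_enum.
have [|cs [scs csC rw]] := @many_rows (A :\: D) ds s3 uds.
  have -> : 2 * s3 * size ds ^ 2 = 2 * s3 ^ 3 by rewrite sds; ring.
  by move: np cC; clear; lia.
have := @ps_prime _ _ _ _ _ _ psr (Tuple (introT eqP scs)) (Tuple (introT eqP sds)).
set S := [set _ | _ in _] => H.
have : 2 * #|S| < s3 ^ 2.
  apply: H => [i j|i j j'].
    apply/negP => /eqP E; have := csC _ (mem_tnth i (Tuple (introT eqP scs))).
    by rewrite E in_setD (dsD _ (mem_tnth j (Tuple (introT eqP sds)))).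
  by apply: homog; [exact/csC/mem_tnth | exact/dsD/mem_tnth | exact/dsD/mem_tnth].
rewrite ltnNge; case/negP; rewrite expnS expn1 -{2}sds; apply: leq_trans rw _.
rewrite leq_mul2l /=; apply: subset_leq_card; apply/subsetP => s /imsetP [[u v]].
rewrite inE /= => /andP [us vs] ->.
have /tnthP [i Ei] : u \in Tuple (introT eqP scs) by [].
have /tnthP [j Ej] : v \in Tuple (introT eqP sds) by [].
by apply/imsetP; exists (i, j); rewrite //= -Ei -Ej.
Qed.

Local Notation trans := (trans A h v0 pi).
Local Notation M e U := #|embs_in A h e v0 U|.

(** The vertices mapped into one part form a module, since the rest of the copy sees the part
    uniformly. If two vertices share a part, [no_module] forces the module to be all of [A]. *)
Lemma dichotomy e f : blowup h pi e -> f \in embs A h e v0 -> f \notin trans ->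
  exists y, f \in embs_in A h e v0 (part pi y).
Proof.
move=> blow fE ft; have /embsP [off /is_embP Ef] := fE.
have : ~~ is_emb A h h (pi \o f) by apply: contra ft => H; apply/transP.
rewrite negb_forall_in => /exists_inP [x xA]; rewrite negb_forall_in => /exists_inP [y yA].
rewrite negb_imply => /andP [xy no]; have [fxy efxy] := Ef x y xA yA xy.
have pxy : pi (f x) = pi (f y).
  apply/eqP; apply: contraTT isT => ne; move: no.
  by rewrite /= ne -blow // efxy eqxx.
exists (pi (f x)); rewrite in_embs_in fE.
pose D := [set z in A | pi (f z) == pi (f x)].
have DA : D \subset A by apply/subsetP => z /setIdP [].
have [DE|nD] := eqVneq D A.
  apply/subsetP => _ /imsetP [z zA ->]; rewrite inE.
  by move: zA; rewrite -{1}DE => /setIdP [].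
case: (@no_module D x y DA nD _ _ xy); rewrite ?inE ?xA ?yA ?pxy ?eqxx // => c d d'.
rewrite !inE => /andP [cD cA] /andP [dA /eqP pd] /andP [d'A /eqP pd'].
rewrite cA /= in cD.
have cd : c != d by apply: contraNneq cD => ->; rewrite pd.
have cd' : c != d' by apply: contraNneq cD => ->; rewrite pd'.
have [_ <-] := Ef c d cA dA cd; have [_ <-] := Ef c d' cA d'A cd'.
by rewrite !blow ?pd ?pd'.
Qed.

Lemma card_A_ge2 : 1 < #|A|.
Proof.
have H : 100 * (r + 1) ^ 2 <= K.
  by apply: leq_trans (nu_eta num); rewrite leq_pmulr // expn_gt0.
by have := max_card A; move: H; clear; nia.
Qed.

Lemma trans_inner e y : blowup h pi e -> [disjoint trans & embs_in A h e v0 (part pi y)].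
Proof.
move=> blow; rewrite -setI_eq0; apply/eqP/setP => f; rewrite in_set0 in_setI in_embs_in.
apply/negP => /andP [/transP [_ /is_embP Hf] /andP [_ /subsetP sub]].
have /card_gt1P [x1 [x2 [x1A x2A x12]]] := card_A_ge2.
have [ne _] := Hf x1 x2 x1A x2A x12; case/eqP: ne => /=.
have := sub _ (imset_f f x1A); have := sub _ (imset_f f x2A).
by rewrite !inE => /eqP -> /eqP ->.
Qed.

Lemma inner_uniq e y z f : f \in embs_in A h e v0 (part pi y) ->
  f \in embs_in A h e v0 (part pi z) -> y = z.
Proof.
rewrite !in_embs_in => /andP [_ /subsetP s1] /andP [_ /subsetP s2].
have /card_gt0P [x xA] : 0 < #|A| by apply: ltnW; exact: card_A_ge2.
have := s1 _ (imset_f f xA); have := s2 _ (imset_f f xA).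
by rewrite !inE => /eqP -> /eqP ->.
Qed.

Lemma decomposition e (P : pred {ffun G -> V}) : blowup h pi e ->
  \sum_(f in embs A h e v0) P f =
  \sum_(f in trans) P f + \sum_y \sum_(f in embs_in A h e v0 (part pi y)) P f.
Proof.
move=> blow; rewrite (big_setID trans) /= (setIidPr (trans_embs A v0 blow)); congr (_ + _).
transitivity (\sum_(f in \bigcup_y embs_in A h e v0 (part pi y)) P f).
  apply: eq_bigl => f; apply/setDP/bigcupP => [[fE ft]|[y _ fy]].
    by have [y fy] := dichotomy blow fE ft; exists y.
  split; first by move: fy; rewrite in_embs_in => /andP [].
  by apply/negP => ft; have /pred0P/(_ f) := trans_inner y blow; rewrite /= ft fy.
rewrite partition_disjoint_bigcup //= => y z yz.
rewrite -setI_eq0; apply/eqP/setP => f; rewrite in_set0 in_setI; apply/negP => /andP [f1 f2].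
by rewrite (inner_uniq f1 f2) eqxx in yz.
Qed.

Lemma card_embs_blowup e : blowup h pi e ->
  #|embs A h e v0| = #|trans| + \sum_y M e (part pi y).
Proof.
move=> blow; rewrite -sum1_card -[#|trans|]sum1_card.
under [X in _ + X]eq_bigr do rewrite -sum1_card.
exact: (decomposition xpredT blow).
Qed.

End Primality.

(** * Balance *)

Section Inner.
Variables (G V : finType) (A : {set G}) (h : rel G) (v0 : V).
Local Notation M e U := #|embs_in A h e v0 U|.

Lemma exists_le_average (T : finType) (D : {set T}) (f : T -> nat) :
  0 < #|D| -> exists2 x, x \in D & #|D| * f x <= \sum_(y in D) f y.
Proof.
case/card_gt0P => x0 x0D; case: (arg_minnP f x0D) => x xD Hx; exists x => //.
by rewrite -sum_nat_const; apply: leq_sum => y; apply: Hx.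
Qed.

Lemma sum_inner_deg e (U : {set V}) :
  \sum_(v in U) #|[set f in embs_in A h e v0 U | v \in f @: A]| = #|A| * M e U.
Proof.
under eq_bigr do rewrite card_setId_sum.
rewrite exchange_big mulnC -sum_nat_const; apply: eq_bigr => f; rewrite in_embs_in.
move=> /andP [/embsP [_ Ef] sub]; rewrite -(card_emb_img Ef) -sum_mem [LHS]big_mkcond.
apply: eq_bigr => v _; case: ifP => // /negbT vU; apply/esym/eqP; rewrite eqb0.
by apply: contra vU; apply: (subsetP sub).
Qed.

(** Deleting a vertex of least inner degree loses a share of at most [#|A| / #|U|] of the inner
    copies, and the set being shrunk always has more than [m] vertices. *)
Lemma shrink e (U : {set V}) d m : m + d = #|U| -> exists U' : {set V},
  [/\ U' \subset U, #|U'| = m & m * M e U <= m * M e U' + #|A| * d * M e U].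
Proof.
elim: d U => [|d IH] U mU.
  by exists U; rewrite subxx -mU addn0 leq_addr.
have U0 : 0 < #|U| by rewrite -mU addnS.
have [v vU Hv] := exists_le_average (fun v => #|[set f in embs_in A h e v0 U | v \in f @: A]|) U0.
rewrite sum_inner_deg in Hv.
have cU : m + d = #|U :\ v| by move: mU; rewrite (cardsD1 v) vU; lia.
have [U' [sU' cU' HU']] := IH _ cU.
exists U'; split=> //; first by apply: subset_trans sU' (subD1set _ _).
have E1 : M e U = M e (U :\ v) + #|[set f in embs_in A h e v0 U | v \in f @: A]|.
  rewrite -(cardsID [set f : {ffun G -> V} | v \in f @: A]) addnC; congr (_ + _).
    apply: eq_card => f; rewrite in_setD !in_embs_in in_set subsetD1.
    by case: (f \in embs _ _ _ _); case: (_ \subset _); case: (v \in _).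
  by apply: eq_card => f; rewrite in_setI [in RHS]in_set [X in _ && X]in_set.
have mono : M e (U :\ v) <= M e U by rewrite E1 leq_addr.
have : m * M e U <= m * M e (U :\ v) + #|A| * M e U.
  rewrite {1}E1 mulnDr leq_add2l; apply: leq_trans Hv; rewrite leq_mul2r -mU.
  by apply/orP; right; lia.
move: HU' mono; clear; move: (M e U) (M e (U :\ v)) (M e U') (#|A|) => x y z k; nia.
Qed.

Lemma transplant e (S U : {set V}) : #|S| = #|U| -> symmetric e -> irreflexive e ->
  exists e' : rel V, [/\ symmetric e', irreflexive e' & M e U <= M e' S].
Proof.
move=> cSU e_sym e_irr.
pose b v := nth v0 (enum U) (index v (enum S)).
pose c u := nth v0 (enum S) (index u (enum U)).
have bc u : u \in U -> b (c u) = u.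
  move=> uU; rewrite /b /c index_uniq ?enum_uniq ?nth_index ?mem_enum //.
  by rewrite -cardE cSU cardE index_mem mem_enum.
have cS u : u \in U -> c u \in S.
  by move=> uU; rewrite -mem_enum mem_nth // -cardE cSU cardE index_mem mem_enum.
exists (relpre b e); split; [by move=> s t; apply: e_sym | by move=> s; apply: e_irr |].
pose T (g : {ffun G -> V}) := [ffun x => if x \in A then c (g x) else v0].
have inU g x : g \in embs_in A h e v0 U -> x \in A -> g x \in U.
  by rewrite in_embs_in => /andP [_ /subsetP sub] xA; apply/sub/imset_f.
have T_inj : {in embs_in A h e v0 U &, injective T}.
  move=> f g fU gU /ffunP H; apply/ffunP => x; have := H x; rewrite !ffunE.
  case: ifP => xA; first by move/(congr1 b); rewrite !bc ?inU.
  by move: fU gU; rewrite !in_embs_in => /andP [/embsP [Df _] _] /andP [/embsP [Dg _] _] _; rewrite Df ?Dg ?xA.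
rewrite -(card_in_imset T_inj); apply: subset_leq_card; apply/subsetP => _ /imsetP [g gU ->].
rewrite in_embs_in; apply/andP; split; last first.
  by apply/subsetP => _ /imsetP [x xA ->]; rewrite ffunE xA cS ?inU.
apply/embsP; split=> [x /negbTE xA|]; first by rewrite ffunE xA.
have := gU; rewrite in_embs_in => /andP [/embsP [_ /is_embP Eg] _].
apply/is_embP => x y xA yA xy; have [gxy exy] := Eg x y xA yA xy.
rewrite !ffunE xA yA /= !bc ?inU //; split=> //.
by apply: contraNneq gxy => /(congr1 b); rewrite !bc ?inU // => ->.
Qed.

End Inner.

Section Balance.
Variables (R : realType) (G : finZmodType) (V : finType) (A : {set G}).
Variables (h : rel G) (e : rel V) (v0 : V) (pi : V -> G).
Local Notation K := #|G|.
Local Notation n := #|V|.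
Local Notation r := (#|G| - #|A|).
Variables (q l de rho t s3 E1 th be : nat) (Q0 : {set G}).
Hypothesis hyp : setup A h e q l Q0.
Hypothesis psr : pseudorandom h de rho t s3.
Hypothesis num : numeric K r q l de rho t s3 E1 th be.
Hypothesis e_irr : irreflexive e.
Hypothesis e_max : extremal A h e v0.
Hypothesis QA0 : Q0 \subset A.
Hypothesis cQ0 : #|Q0| <= q.
Hypothesis blow : blowup h pi e.
Hypothesis few_inner : #|embs A h e v0 :\: trans A h v0 pi| * K ^ q <= #|embs A h e v0|.

Local Notation E := (embs A h e v0).
Local Notation Hm := (hembs A h).
Local Notation w y := #|part pi y|.
Local Notation M e U := #|embs_in A h e v0 U|.
Local Notation rp X th' := (rprod A pi X th').

Let e_sym := e_sym hyp.

(** A change inside one part keeps the blow-up, so by [card_embs_blowup] only the inner copies of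
    that part are affected. It serves both the balance argument and the recursion into the parts. *)
Lemma graft (e' : rel V) y : symmetric e' -> irreflexive e' ->
  M e' (part pi y) <= M e (part pi y).
Proof.
move=> s' i'.
pose e2 u v := if (pi u == y) && (pi v == y) then e' u v else e u v.
have e2_sym : symmetric e2 by move=> u v; rewrite /e2 andbC s' e_sym.
have e2_irr : irreflexive e2 by move=> u; rewrite /e2 i' e_irr if_same.
have e2_blow : blowup h pi e2.
  move=> u v uv; rewrite /e2; case: andP => [[/eqP E1' /eqP E2']|_]; last exact: blow.
  by rewrite E1' E2' eqxx in uv.
have same z e3 : (forall u v, pi u = z -> pi v = z -> e2 u v = e3 u v) ->
    M e2 (part pi z) = M e3 (part pi z).
  move=> Hz; apply: eq_card => f; rewrite !in_embs_in andbC [RHS]andbC.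
  case: (boolP (_ \subset _)) => //= /subsetP sub.
  have pz x : x \in A -> pi (f x) = z by move=> xA; have := sub _ (imset_f f xA); rewrite inE => /eqP.
  apply/embsP/embsP => -[off /is_embP H]; split=> //; apply/is_embP => x x' xA x'A xx';
    have [-> <-] := H x x' xA x'A xx'; by rewrite Hz ?pz.
have := e_max e2_sym e2_irr.
rewrite (card_embs_blowup _ psr num e2_blow) (card_embs_blowup _ psr num blow) leq_add2l.
rewrite (bigD1 y) //= [leqRHS](bigD1 y) //= (same y e'); last first.
  by move=> u v pu pv; rewrite /e2 pu pv eqxx.
rewrite [X in _ + X](eq_bigr (fun z => M e (part pi z))) ?leq_add2r // => z zy.
by apply: same => u v pu _; rewrite /e2 pu (negbTE zy).
Qed.

Definition inner_deg v := #|[set f in embs_in A h e v0 (part pi (pi v)) | v \in f @: A]|.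

Lemma deg_split v : deg A h e v0 v =
  \sum_(th' in Hm | pi v \in th' @: A) rp [set pi v] th' + inner_deg v.
Proof.
rewrite /deg card_setId_sum (decomposition v0 psr num _ blow); congr (_ + _).
  rewrite -card_setId_sum.
  transitivity #|[set f in trans A h v0 pi | [set v] \subset f @: A]|.
    by apply: eq_card => f; rewrite [LHS]in_set [RHS]in_set sub1set.
  rewrite trans_count; last by move=> x y /set1P -> /set1P ->.
  by rewrite imset_set1; apply: eq_bigl => th'; rewrite sub1set.
rewrite (bigD1 (pi v)) //= [X in _ + X]big1 ?addn0 ?/inner_deg ?card_setId_sum // => y yv.
apply: big1 => f; rewrite in_embs_in => /andP [_ /subsetP sub].
apply/eqP; rewrite eqb0; apply: contra yv => /sub; by rewrite inE eq_sym.
Qed.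

Lemma codeg_split u v : pi u != pi v -> codeg A h e v0 u v =
  \sum_(th' in Hm | [set pi u; pi v] \subset th' @: A) rp [set pi u; pi v] th'.
Proof.
move=> uv; rewrite /codeg card_setId_sum (decomposition v0 psr num _ blow).
rewrite [X in _ + X]big1 ?addn0; last first.
  move=> y _; apply: big1 => f; rewrite in_embs_in => /andP [_ /subsetP sub].
  apply/eqP; rewrite eqb0; apply: contra uv => /andP [/sub + /sub].
  by rewrite !inE => /eqP -> /eqP ->.
have := @trans_count G V A h v0 pi [set u; v]; rewrite imsetU !imset_set1 => H.
rewrite -H; last first.
  move=> x y /set2P [] -> /set2P [] -> // E'; first by rewrite E' eqxx in uv.
  by rewrite -E' eqxx in uv.
rewrite -card_setId_sum; apply: eq_card => f; rewrite [LHS]in_set [RHS]in_set.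
by rewrite subUset !sub1set.
Qed.

(** [S x z] counts the transversal copies through a fixed vertex of part [x] and a fixed vertex of
    part [z]; [P x z] counts those through a fixed vertex of part [x] that miss part [z]. *)
Local Notation S x z := (\sum_(th' in Hm | [set x; z] \subset th' @: A) rp [set x; z] th').
Local Notation P x z := (\sum_(th' in Hm | (x \in th' @: A) && (z \notin th' @: A)) rp [set x] th').

Lemma sum_rprod1 x z : x != z ->
  \sum_(th' in Hm | x \in th' @: A) rp [set x] th' = w z * S x z + P x z.
Proof.
move=> xz; rewrite (bigID (fun th' : {ffun G -> G} => z \in th' @: A)) /=; congr (_ + _); last first.
  by apply: eq_bigl => th'; rewrite andbA.
rewrite big_distrr /=; apply: eq_big => th'; first by rewrite subUset !sub1set andbA.
move=> /andP [/andP [_ xT] zT]; rewrite /rprod (big_setID [set z]) /=.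
have -> : (th' @: A :\: [set x]) :&: [set z] = [set z].
  by apply/setIidPr; rewrite sub1set !inE eq_sym xz.
by rewrite big_set1; congr (_ * _); apply: eq_bigl => y; rewrite !inE negb_or andbA [(y != z) && _]andbC.
Qed.

Lemma S_sym x z : S x z = S z x.
Proof. by rewrite setUC. Qed.

Lemma mul_S x z : x != z -> w x * w z * S x z =
  \sum_(th' in Hm | [set x; z] \subset th' @: A) wprod A pi th'.
Proof.
move=> xz; rewrite big_distrr /=; apply: eq_bigr => th' /andP [_ sub].
by rewrite (wprodE pi sub) big_setU1 ?inE //= big_set1.
Qed.

Lemma mul_P x z : w x * P x z <= \sum_(th' in Hm | z \notin th' @: A) wprod A pi th'.
Proof.
rewrite big_distrr /= [leqRHS](bigID (fun th' : {ffun G -> G} => x \in th' @: A)) /=.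
apply: leq_trans (leq_addr _ _); rewrite leq_eqVlt; apply/orP; left; apply/eqP.
apply: eq_big => th'; first by rewrite -andbA [(z \notin _) && _]andbC.
by move=> /andP [_ /andP [xT _]]; rewrite (@wprodE _ _ A pi [set x]) ?sub1set // big_set1.
Qed.

(* [y -> x + z - y] is an automorphism of the host graph exchanging [x] and [z]. *)
Lemma reflection x z : x != z -> (forall y, w z <= w y <= w x) ->
  P x z * w z ^ r <= P z x * w x ^ r.
Proof.
move=> xz wb.
pose rf (th' : {ffun G -> G}) : {ffun G -> G} := [ffun y => if y \in A then (x + z - th' y)%R else 0%R].
have rfH th' : th' \in Hm -> rf th' \in Hm.
  case/embsP => D /is_embP H; apply/embsP; split=> [y /negbTE yA|]; first by rewrite ffunE yA.
  apply/is_embP => y y' yA y'A yy'; have [n1 n2] := H y y' yA y'A yy'.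
  rewrite !ffunE yA y'A (inj_eq (subrI _)); split=> //.
  by rewrite ![(x + z - _)%R]addrC (ps_add psr) (ps_opp psr).
have rfK : {in Hm, cancel rf rf}.
  move=> th' /embsP [D _]; apply/ffunP => y; rewrite !ffunE; case yA: (y \in A).
    by rewrite subKr.
  by rewrite D ?yA.
have mem_rf th' y : (y \in rf th' @: A) = ((x + z - y)%R \in th' @: A).
  apply/imsetP/imsetP => -[a' aA E']; exists a' => //.
    by rewrite E' ffunE aA subKr.
  by rewrite ffunE aA -E' subKr.
have xE : (x + z - x = z)%R by rewrite addrAC subrr add0r.
have zE : (x + z - z = x)%R by rewrite addrK.
(* Besides [x] and [z], both [th'] and its reflection miss [r - 1] labels. So both products differ
   from the product over all labels other than [x] and [z] by [r - 1] factors between [w z] and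
   [w x]. *)
have term th' : th' \in Hm -> x \in th' @: A -> z \notin th' @: A ->
    rp [set x] th' * w z ^ r <= rp [set z] (rf th') * w x ^ r.
  move=> tH xT zT; have rH := rfH _ tH.
  have zT' : z \in rf th' @: A by rewrite mem_rf zE.
  have xT' : x \notin rf th' @: A by rewrite mem_rf xE.
  have cC th2 : th2 \in Hm -> #|~: (th2 @: A)| = r.
    by move=> t2H; rewrite -(card_hembs_img t2H) -(cardsC (th2 @: A)) addKn.
  have r0 : 0 < r by rewrite -(cC _ tH); apply/card_gt0P; exists z; rewrite inE.
  have split_all (x' z' : G) th2 : th2 \in Hm -> x' \in th2 @: A -> z' \notin th2 @: A ->
      \prod_(y in ~: [set x'; z']) w y = rp [set x'] th2 * \prod_(y in ~: (th2 @: A) :\ z') w y.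
    move=> t2H xT2 zT2; rewrite (big_setID (th2 @: A)) /=; congr (_ * _); apply: eq_bigl => y.
      rewrite !inE negb_or; case: (eqVneq y x') => //= yx; case: (eqVneq y z') => //= ->.
      by rewrite (negbTE zT2).
    rewrite !inE negb_or; case: (boolP (y \in th2 @: A)) => yT; rewrite ?andbF //=.
    by case: (eqVneq y x') => [yx|_]; rewrite ?andbT //; rewrite yx xT2 in yT.
  have cCz th2 z' : th2 \in Hm -> z' \notin th2 @: A -> #|~: (th2 @: A) :\ z'| = r.-1.
    by move=> t2H zT2; have := cardsD1 z' (~: (th2 @: A)); rewrite inE zT2 cC // => ->.
  have lo : rp [set x] th' * w z ^ r.-1 <= \prod_(y in ~: [set x; z]) w y.
    rewrite (split_all x z th') // leq_mul2l; apply/orP; right.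
    by rewrite -(cCz th' z) // -prod_nat_const; apply: leq_prod => y _; have /andP [] := wb y.
  have hi : \prod_(y in ~: [set x; z]) w y <= rp [set z] (rf th') * w x ^ r.-1.
    rewrite [[set x; z]]setUC (split_all z x (rf th')) // leq_mul2l; apply/orP; right.
    by rewrite -(cCz (rf th') x) // -prod_nat_const; apply: leq_prod => y _; have /andP [] := wb y.
  rewrite -(prednK r0) !expnSr !mulnA leq_mul //; first exact: leq_trans lo hi.
  by have /andP [] := wb x.
rewrite [leqRHS]big_distrl /= [leqRHS](reindex_onto rf rf) /=; last by move=> th' /andP [/rfK].
rewrite [leqRHS](eq_bigl (fun th' : {ffun G -> G} => [&& th' \in Hm, x \in th' @: A & z \notin th' @: A])); last first.
  move=> th'; apply/andP/and3P => [[/and3P [rH zT xT] /eqP E']|[tH xT zT]].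
    have tH : th' \in Hm by rewrite -E' rfH.
    by rewrite mem_rf zE in zT; rewrite mem_rf xE in xT.
  by rewrite rfK // rfH // !mem_rf zE xE xT zT eqxx; split.
rewrite big_distrl /=.
by apply: leq_sum => th' /and3P [tH xT zT]; apply: term.
Qed.

Local Open Scope ring_scope.

(** [X] and [Z] are the extreme part sizes and [m] the number of copies. Cloning bounds
    [(X - Z - 1) * S'] by differences of [P] and of inner degrees. All these errors are proportional
    to [X - Z], which gives [97 * (X - Z - 1) <= 2 * (X - Z)], impossible from [X - Z = 2] on. *)
Lemma balance_arith (X Z S' Px Pz Iu Iv k Mx Mz m : R) :
  0 < m -> 0 < X -> 0 < Z -> 2 <= X - Z -> 0 <= S' -> 0 <= k -> 0 <= Mz -> 0 <= Mx ->
  S' * X + Pz + Iu <= S' * Z + Px + Iv + S' ->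
  97 * m <= 100 * (X * Z * S') ->
  100 * ((Px - Pz) * X * Z) <= (X - Z) * m ->
  X * Iv <= k * Mx -> k * Mz <= Z * Iu -> Z * Mx <= Z * Mz + k * (X - Z) * Mx ->
  100 * (k ^+ 2 * Mx) <= m -> False.
Proof.
move=> m0 X0 Z0 D2 S0 k0 Mz0 Mx0 H1 H2 H3 H4 H5 H6 H7.
have XZ0 : 0 < X * Z by rewrite mulr_gt0.
have J1 : X * Z * S' * (X - Z - 1) <= (Px - Pz) * X * Z + (Iv - Iu) * (X * Z).
  have : X * Z * (S' * (X - Z - 1)) <= X * Z * ((Px - Pz) + (Iv - Iu)).
    by rewrite ler_pM2l //; lra.
  by rewrite !mulrA; lra.
have J2 : (Iv - Iu) * (X * Z) <= k * Z * (Mx - Mz).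
  have a1 : X * Iv * Z <= k * Mx * Z by rewrite ler_pM2r.
  have a2 : k * Mz * X <= Z * Iu * X by rewrite ler_pM2r.
  have a3 : k * Mz * Z <= k * Mz * X by rewrite ler_wpM2l ?mulr_ge0 //; lra.
  have -> : (Iv - Iu) * (X * Z) = X * Iv * Z - Z * Iu * X by ring.
  have -> : k * Z * (Mx - Mz) = k * Mx * Z - k * Mz * Z by ring.
  lra.
have J3 : k * Z * (Mx - Mz) <= k * (k * (X - Z) * Mx).
  by rewrite -mulrA ler_wpM2l //; lra.
have J4 : 100 * (k * (k * (X - Z) * Mx)) <= (X - Z) * m.
  have -> : 100 * (k * (k * (X - Z) * Mx)) = (X - Z) * (100 * (k ^+ 2 * Mx)) by ring.
  by rewrite ler_wpM2l //; lra.
have J5 : 97 * m * (X - Z - 1) <= 100 * (X * Z * S') * (X - Z - 1).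
  by rewrite ler_wpM2r //; lra.
have J6 : 100 * (X * Z * S' * (X - Z - 1)) <= 2 * ((X - Z) * m) by lra.
have J7 : 97 * m * (X - Z - 1) <= 2 * ((X - Z) * m) by move: J5 J6; rewrite !mulrA; lra.
by move: J7; nra.
Qed.

(** Bernoulli gives [(Z / X) ^ k >= 1 - k * (X - Z) / X], so [Px - Pz] is at most [k * (X - Z) / X]
    times [Px]. *)
Lemma reflection_arith (X Z Px Pz m : R) k : 0 < X -> 0 < Z -> Z <= X -> 0 <= Px -> 0 <= Pz ->
  Px * Z ^+ k <= Pz * X ^+ k -> 100 * (k%:R + 1) * (X * Px) <= m -> 0 <= m ->
  100 * ((Px - Pz) * X * Z) <= (X - Z) * m.
Proof.
move=> X0 Z0 ZX Px0 Pz0 H1 H2 m0.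
have D0 : 0 <= X - Z by lra.
have [PP|PP] := leP Px Pz.
  apply: le_trans (_ : 0 <= _); last by rewrite mulr_ge0.
  by rewrite -mulrA mulrCA mulr_le0_ge0 ?subr_le0 // !mulr_ge0 // ltW.
have B : 1 - k%:R * ((X - Z) / X) <= (Z / X) ^+ k.
  have := @bernoulli R (- ((X - Z) / X)) k; rewrite mulrN.
  have -> : 1 + - ((X - Z) / X) = Z / X by field; rewrite gt_eqF.
  apply; rewrite lerN2 ler_pdivrMr // mul1r; lra.
have H3 : Px * (Z / X) ^+ k <= Pz.
  by rewrite expr_div_n mulrA ler_pdivrMr ?exprn_gt0.
have H4 : (Px - Pz) * X <= k%:R * (X - Z) * Px.
  have := ler_wpM2l Px0 B => H5.
  have H6 : Px - Pz <= Px * (k%:R * ((X - Z) / X)) by lra.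
  apply: le_trans (ler_wpM2r (ltW X0) H6) _.
  by rewrite le_eqVlt; apply/orP; left; apply/eqP; field; rewrite gt_eqF.
have k0 : 0 <= k%:R :> R by [].
have H7 : (Px - Pz) * X * Z <= k%:R * (X - Z) * Px * X.
  apply: le_trans (_ : (Px - Pz) * X * X <= _).
    by rewrite ler_wpM2l // mulr_ge0 ?subr_ge0 // ltW.
  by rewrite ler_wpM2r // ltW.
have H8 : 100 * (k%:R * (X - Z) * Px * X) <= (X - Z) * (100 * (k%:R + 1) * (X * Px)).
  have -> : (X - Z) * (100 * (k%:R + 1) * (X * Px)) = 100 * (k%:R * (X - Z) * Px * X) + 100 * ((X - Z) * X * Px) by ring.
  by rewrite lerDl !mulr_ge0 // ltW.
apply: le_trans (_ : 100 * (k%:R * (X - Z) * Px * X) <= _); first by rewrite ler_pM2l.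
by apply: le_trans H8 _; rewrite ler_wpM2l.
Qed.

Local Open Scope nat_scope.

Lemma balanced x z : w x <= w z + 1.
Proof.
have Kb := K_big hyp; have rq := r_q hyp; have K0 : 0 < K by apply: leq_trans Kb.
have M0 : 0 < #|E| := embs_gt0 hyp (opt_le R hyp psr e_max).
case: (arg_maxnP (fun y => w y) (isT : xpredT x)) => x1 _ /= max1.
case: (arg_minnP (fun y => w y) (isT : xpredT x)) => z1 _ /= min1.
apply: leq_trans (_ : w z1 + 1 <= _); last by rewrite leq_add2r min1.
apply: leq_trans (max1 x isT) _; rewrite leqNgt; apply/negP => big.
have xz : x1 != z1 by apply: contraTneq big => ->; rewrite -leqNgt leq_addr.
have wb y : w z1 <= w y <= w x1 by rewrite min1 ?max1.
have large : 97 * #|E| <= 100 * (w x1 * w z1 * S x1 z1).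
  have a1 := avoid_small R hyp psr num e_max pi x1.
  have a2 := avoid_small R hyp psr num e_max pi z1.
  have : #|E| <= #|trans A h v0 pi| + #|E :\: trans A h v0 pi|.
    by rewrite -(cardsID (trans A h v0 pi) E) leq_add2r subset_leq_card // subsetIr.
  have : 100 * #|E :\: trans A h v0 pi| <= #|E|.
    apply: leq_trans few_inner; rewrite mulnC leq_mul2l; apply/orP; right.
    apply: leq_trans (_ : 2 ^ 10 <= _) => //; apply: leq_trans Kb _.
    by rewrite -{1}(expn1 K) leq_pexp2l //; clear -rq; lia.
  have : #|trans A h v0 pi| <= w x1 * w z1 * S x1 z1
     + \sum_(th' in Hm | x1 \notin th' @: A) wprod A pi th'
     + \sum_(th' in Hm | z1 \notin th' @: A) wprod A pi th'.
    rewrite mul_S // card_trans [X in _ <= X + _ + _]big_mkcondr /=.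
    rewrite ![X in _ <= _ + X]big_mkcondr /= [X in _ <= _ + X + _]big_mkcondr /= -!big_split /=.
    apply: leq_sum => th' tH; rewrite subUset !sub1set.
    by case: (x1 \in th' @: A); case: (z1 \in th' @: A); rewrite /= ?addn0 ?leq_addl.
  move: a1 a2; set s1 := \sum_(th' in Hm | x1 \notin _) _; set s2 := \sum_(th' in Hm | z1 \notin _) _.
  move: s1 s2 => s1 s2 a1 a2.
  have : 100 * s1 <= #|E| by apply: leq_trans a1; rewrite leq_mul2r leq_pmulr ?orbT // addn1.
  have : 100 * s2 <= #|E| by apply: leq_trans a2; rewrite leq_mul2r leq_pmulr ?orbT // addn1.
  by clear; lia.
have wz0 : 0 < w z1.
  rewrite lt0n; apply: contraTneq large => ->; rewrite muln0 mul0n muln0 -ltnNge.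
  by rewrite muln_gt0.
have wx0 : 0 < w x1 by apply: leq_trans wz0 (min1 x1 isT).
have innerE y : \sum_(v in part pi y) inner_deg v = #|A| * M e (part pi y).
  rewrite -sum_inner_deg; apply: eq_bigr => v; rewrite inE => /eqP vy.
  by rewrite /inner_deg vy.
(* [v], of least inner degree in the largest part, becomes a clone of [u], of greatest inner degree
   in the smallest part. These choices bound both inner degrees by averages. *)
have [v vx Hv] := exists_le_average inner_deg wx0; rewrite innerE in Hv.
have [u uz Hu] := exists_ge_average inner_deg wz0; rewrite innerE in Hu.
have pv : pi v = x1 by move: vx; rewrite inE => /eqP.
have pu : pi u = z1 by move: uz; rewrite inE => /eqP.
have uv : u != v by apply: contraNneq xz => E'; rewrite -pv -pu E'.
have puv : pi u != pi v by rewrite pu pv eq_sym.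
have zyk := zykov e_sym e_irr e_max uv.
have zx : z1 != x1 by rewrite eq_sym.
rewrite !deg_split codeg_split // pu pv (sum_rprod1 zx) (sum_rprod1 xz) (S_sym z1 x1) in zyk.
have [U' [sU cU HU]] : exists U' : {set V}, [/\ U' \subset part pi x1, #|U'| = w z1 &
    w z1 * M e (part pi x1) <= w z1 * M e U' + #|A| * (w x1 - w z1) * M e (part pi x1)].
  by apply: shrink; rewrite subnKC // min1.
(* The smallest part is extremal inside by [graft], so it has at least as many inner copies as the
   largest part shrunk to its size. *)
have Mz : M e U' <= M e (part pi z1).
  have [e' [s' i' H']] := transplant A h v0 (esym cU) e_sym e_irr.
  exact: leq_trans H' (graft _ s' i').
have HM : w z1 * M e (part pi x1) <= w z1 * M e (part pi z1) + #|A| * (w x1 - w z1) * M e (part pi x1).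
  by apply: leq_trans HU _; rewrite leq_add2r leq_mul2l Mz orbT.
have Msmall : 100 * (#|A| ^ 2 * M e (part pi x1)) <= #|E|.
  apply: leq_trans few_inner.
  have sub : M e (part pi x1) <= #|E :\: trans A h v0 pi|.
    apply: subset_leq_card; apply/subsetP => f fx; apply/setDP; split.
      by move: fx; rewrite in_embs_in => /andP [].
    apply/negP => ft; suff /pred0P/(_ f) : [disjoint trans A h v0 pi & embs_in A h e v0 (part pi x1)].
      by rewrite /= ft fx.
    exact: (trans_inner v0 num x1 blow).
  rewrite mulnA mulnC leq_mul //.
  apply: leq_trans (_ : K * K ^ 2 <= _); last by rewrite -expnS leq_pexp2l //; clear -rq; lia.
  apply: leq_mul; first exact: leq_trans Kb.
  by rewrite leq_sqr max_card.
have refl := reflection xz wb.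
have mP := mul_P x1 z1; have aP := avoid_small R hyp psr num e_max pi z1.
have D2 : (2 <= (w x1)%:R - (w z1)%:R :> R)%R.
  by rewrite lerBrDl -natrD ler_nat; move: big; clear; lia.
have E0 : (0 < #|E|%:R :> R)%R by rewrite ltr0n.
have X0 : (0 < (w x1)%:R :> R)%R by rewrite ltr0n.
have Z0 : (0 < (w z1)%:R :> R)%R by rewrite ltr0n.
apply: (@balance_arith (w x1)%:R (w z1)%:R (S x1 z1)%:R (P x1 z1)%:R (P z1 x1)%:R
  (inner_deg u)%:R (inner_deg v)%:R #|A|%:R (M e (part pi x1))%:R (M e (part pi z1))%:R #|E|%:R) => //.
- rewrite -!natrM -!natrD ler_nat; move: zyk; clear.
  move: (S x1 z1) (P x1 z1) (P z1 x1) (inner_deg u) (inner_deg v) (w x1) (w z1).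
  by move=> *; lia.
- by rewrite -!natrM ler_nat.
- apply: (@reflection_arith _ _ _ _ _ r) => //.
  + by move: D2; lra.
  + by rewrite -!natrX -!natrM ler_nat.
  + by rewrite natr1 -!natrM ler_nat; apply: leq_trans aP; rewrite addn1 leq_mul2l mP orbT.
- by rewrite -!natrM ler_nat.
- by rewrite -!natrM ler_nat.
- by rewrite -natrB ?min1 // -!natrM -!natrD ler_nat.
- by rewrite -!natrX -!natrM ler_nat.
Qed.

End Balance.

(** * Extremal graphs *)

(** Greedy choice: a pair of labels is separated by at least [de - r] elements of [A], so some [z]
    separates a share [(de - r) / K] of the pairs left. After [q] rounds fewer than one of the
    [K ^ 2] pairs remains. *)
Lemma exists_separating (G : finZmodType) (h : rel G) de rho t s3 (A : {set G}) q :
  pseudorandom h de rho t s3 ->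
  #|G| ^ 2 * (#|G| - (de - (#|G| - #|A|))) ^ q < #|G| ^ q ->
  exists Q : {set G}, [/\ Q \subset A, #|Q| <= q & forall x y, x \in A :\: Q ->
    y \in A :\: Q -> x != y -> exists2 z, z \in Q & h x z != h y z].
Proof.
move=> psr; set d := de - _ => small.
pose U (Q : {set G}) := [set p : G * G | [&& p.1 \in A :\: Q, p.2 \in A :\: Q, p.1 != p.2 &
  [forall z in Q, h p.1 z == h p.2 z]]].
have step i : exists Q : {set G}, [/\ Q \subset A, #|Q| <= i &
    #|U Q| * #|G| ^ i <= #|G| ^ 2 * (#|G| - d) ^ i].
  elim: i => [|i [Q [QA cQ HQ]]].
    exists set0; rewrite sub0set cards0 !expn0 !muln1; split=> //.
    by apply: leq_trans (max_card _) _; rewrite card_prod mulnn.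
  have [A0|Apos] := posnP #|A|.
    exists Q; split=> //; first exact: leqW.
    have -> : #|U Q| = 0; last by rewrite mul0n.
    apply: eq_card0 => p; rewrite inE; move/eqP: A0; rewrite cards_eq0 => /eqP ->.
    by rewrite inE in_set0 andbF.
  pose sp z (p : G * G) := (z \in A) && (h p.1 z != h p.2 z).
  have [z zA Hz] := exists_ge_average (fun z => \sum_(p in U Q) sp z p) Apos.
  exists (z |: Q); split.
  - by rewrite subUset sub1set zA.
  - by rewrite cardsU1; case: (z \notin Q) => //=; apply: leqW.
  have cnt : #|U (z |: Q)| + \sum_(p in U Q) sp z p <= #|U Q|.
    have sUQ : U (z |: Q) \subset U Q.
      apply/subsetP => p; rewrite !inE !negb_or => /and4P [/andP [/andP [_ ->] ->] /andP [/andP [_ ->] ->] -> /forall_inP H] /=.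
      by apply/forall_inP => z' z'Q; apply: H; rewrite !inE z'Q orbT.
    rewrite -(cardsID (U (z |: Q)) (U Q)) (setIidPr sUQ) leq_add2l -sum1_card.
    rewrite (big_setID (U (z |: Q))) /= (setIidPr sUQ) big1 ?add0n; last first.
      move=> p; rewrite inE => /and4P [_ _ _ /forall_inP H]; apply/eqP; rewrite eqb0 /sp.
      by rewrite (eqP (H z _)) ?eqxx ?andbF // !inE eqxx.
    by apply: leq_sum => p _; apply: leq_b1.
  have tot : d * #|U Q| <= \sum_(z in A) \sum_(p in U Q) sp z p.
    rewrite exchange_big mulnC -sum_nat_const; apply: leq_sum => p.
    rewrite inE => /and4P [_ _ xy _]; rewrite leq_subLR.
    apply: leq_trans (ps_sep psr xy) _.
    have -> : #|G| - #|A| = #|~: A| by rewrite -(cardsC A) addKn.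
    rewrite -(cardsID A) addnC; apply: leq_add; first by apply: subset_leq_card; apply/subsetP => z'; rewrite !inE => /andP [].
    rewrite -sum_mem [leqRHS]big_mkcond; apply: leq_sum => z' _; rewrite !inE /sp.
    by case: (z' \in A); case: (h p.1 z' != h p.2 z'); rewrite ?andbF ?andbT //=; case: (_ && _).
  have cA : #|A| <= #|G| := max_card _.
  have : #|U (z |: Q)| * #|G| <= #|U Q| * (#|G| - d).
    have h1 : d * #|U Q| <= #|G| * \sum_(p in U Q) sp z p.
      by apply: leq_trans (leq_trans tot Hz) _; rewrite leq_mul2r cA orbT.
    rewrite mulnBr leq_subRL; last by move: h1 cnt; rewrite mulnC => h1 cnt; apply: leq_trans h1 _; rewrite mulnC leq_mul2r (leq_trans _ cnt) ?leq_addl ?orbT.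
    by move: h1 (leq_mul cnt (leqnn #|G|)); clear; nia.
  move=> /leq_mul/(_ (leqnn (#|G| ^ i))) H.
  rewrite [#|G| ^ i.+1]expnS [(_ - d) ^ i.+1]expnS.
  have -> : #|U (z |: Q)| * (#|G| * #|G| ^ i) = #|U (z |: Q)| * #|G| * #|G| ^ i by rewrite mulnA.
  apply: leq_trans H _.
  have -> : #|U Q| * (#|G| - d) * #|G| ^ i = #|U Q| * #|G| ^ i * (#|G| - d) by rewrite mulnAC.
  by apply: leq_trans (leq_mul HQ (leqnn _)) _; rewrite -mulnA [_ ^ i * _]mulnC.
have [Q [QA cQ HQ]] := step q.
exists Q; split=> // x y xX yX xy; apply/exists_inP; apply: contraT; rewrite negb_exists_in.
move=> /forall_inP H; have : 0 < #|U Q|.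
  apply/card_gt0P; exists (x, y); rewrite inE xX yX xy /=; apply/forall_inP => z zQ.
  by have := H z zQ; rewrite negbK.
case: #|U Q| HQ => // m HQ _.
by have := leq_ltn_trans HQ small; rewrite mulSn ltnNge leq_addr.
Qed.

Section Host.
Variables (R : realType) (G : finZmodType) (L : {set G}).
Variable L_opp : forall x, x \in L -> (- x)%R \in L.
Local Notation F := (cayley L_opp).
Local Notation h := (cayley_adj L).
Variables (A : {set F}) (q l de rho t s3 E1 th be : nat).
Local Notation K := #|G|.
Local Notation r := (#|G| - #|A|).
Hypothesis psr : pseudorandom h de rho t s3.
Hypothesis num : numeric K r q l de rho t s3 E1 th be.
Hypotheses (K_l : K <= 2 ^ l) (K_big : 2 ^ 10 <= K) (r_q : r + 10 <= q).
Hypothesis K_sep : K ^ 2 * (K - (de - r)) ^ q < K ^ q.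

Lemma induced_copies_le (Gam Gam' : sgraph) (V : finType) (e e' : rel V) (v0 : V)
    (i : Gam -> V) (i' : Gam' -> V) : injective i -> injective i' ->
  (forall u v, e (i u) (i v) = adj u v) -> (forall u v, e' (i' u) (i' v) = adj u v) ->
  (#|embs_in A h e' v0 (i' @: setT)| <= #|embs_in A h e v0 (i @: setT)|) =
  (induced_copies (induced A) Gam' <= induced_copies (induced A) Gam).
Proof.
move=> inj inj' He He'.
rewrite (@card_embs_in F A 0%R Gam V e v0 i) // (@card_embs_in F A 0%R Gam' V e' v0 i') //.
by rewrite leq_mul2l eqn0Ngt auts_gt0.
Qed.

Lemma max_extremal (Gam : sgraph) (v0 : Gam) :
  max_induced_copies (induced A) Gam -> extremal A h (@adj Gam) v0.
Proof.
move=> mx e' s' i'.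
have := mx (SGraph s' i') erefl.
rewrite -(@induced_copies_le Gam (SGraph s' i') Gam (@adj Gam) e' v0 id id) //.
by rewrite !imset_id !embs_in_setT.
Qed.

Lemma max_inner (Gam : sgraph) (v0 : Gam) (W : {set Gam}) :
  (forall e' : rel Gam, symmetric e' -> irreflexive e' ->
     #|embs_in A h e' v0 W| <= #|embs_in A h (@adj Gam) v0 W|) ->
  0 < #|W| -> max_induced_copies (induced A) (induced W).
Proof.
move=> Hmax W0 Gam' cG'.
have cW : #|Gam'| = #|W| by rewrite cG' card_sig.
have [g0 _] : exists g0 : Gam', true.
  by have /card_gt0P [g0 _] : 0 < #|Gam'| by rewrite cW.
(* The competitor is transported onto [W] along the two enumerations; [j] takes a default outside
   [W], where the edges are never inspected. *)
pose i u := nth v0 (enum W) (index u (enum Gam')).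
pose j s := nth g0 (enum Gam') (index s (enum W)).
have iW u : i u \in W by rewrite -mem_enum mem_nth // -cardE -cW cardE index_mem mem_enum.
have jK : cancel i j.
  move=> u; rewrite /i /j index_uniq ?enum_uniq ?nth_index ?mem_enum //.
  by rewrite -cardE -cW cardE index_mem mem_enum.
have i_inj := can_inj jK.
have imi : i @: setT = W.
  apply/eqP; rewrite eqEcard card_imset // cardsT cW leqnn andbT.
  by apply/subsetP => _ /imsetP [u _ ->].
have imv : val @: [set: induced W] = W.
  apply/setP => s; apply/imsetP/idP => [[u _ ->]|sW]; first exact: valP.
  by exists (exist _ s sW).
rewrite -(@induced_copies_le (induced W) Gam' Gam (@adj Gam) (relpre j (@adj Gam')) v0 val i) //.
- rewrite imi imv; apply: Hmax => [s s'|s]; first exact: adj_sym.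
  exact: adj_irrefl.
- exact: val_inj.
- by move=> u v /=; rewrite !jK.
Qed.

Theorem extremal_balanced_iterated n (Gam : sgraph) : #|Gam| = n ->
  max_induced_copies (induced A) Gam -> balanced_iterated_blow_up F Gam.
Proof.
elim: {n}_.+1 {-2}n (ltnSn n) Gam => // m IH n nm Gam cG mx.
have [small|Kn] := ltnP #|Gam| K; first exact: BIB_small.
have K0 : 0 < K by apply: leq_trans K_big.
have [v0 _] : exists v0 : Gam, true.
  by have /card_gt0P [v0 _] : 0 < #|Gam| by apply: leq_trans Kn.
have e_sym := @adj_sym Gam; have e_irr := @adj_irrefl Gam.
have [Q0 [QA0 cQ0 sep]] := exists_separating psr K_sep.
have hyp : setup A h (@adj Gam) q l Q0 by split=> //; exact: (ps_sym psr).
have e_max := max_extremal v0 mx.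
have [pi blow few] := extremal_blow_up R hyp psr num e_irr e_max QA0 cQ0.
have bal := balanced R hyp psr num e_irr e_max blow few.
(* With an empty part, balance leaves at most one vertex in each other part, fewer than [K] in
   total. *)
have pos y : 0 < #|part pi y|.
  rewrite lt0n; apply/eqP => y0; have := Kn; rewrite -(sum_part pi) leqNgt; case/negP.
  rewrite (bigD1 y) //= y0 add0n.
  apply: leq_ltn_trans (_ : \sum_(z | z != y) 1 < _).
    by apply: leq_sum => z _; have := bal z y; rewrite y0.
  by rewrite sum1_card cardC1 prednK.
apply: (@BIB_split F Gam (part pi)).
- split.
  + by move=> y; rewrite -card_gt0 pos.
  + move=> y z yz; rewrite -setI_eq0; apply/eqP/setP => v; rewrite !inE.
    by apply/negP => /andP [/eqP -> /eqP E]; rewrite E eqxx in yz.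
  + by apply/setP => v; rewrite inE; apply/bigcupP; exists (pi v); rewrite // inE.
  + move=> y z yz u v; rewrite !inE => /eqP pu /eqP pv.
    by rewrite blow ?pu ?pv.
- by move=> y z; apply: bal.
- move=> y; have cI : #|induced (part pi y)| = #|part pi y| by rewrite card_sig.
  apply: (IH #|part pi y|) => //.
    have [z zy] : exists z, z != y.
      apply/existsP; apply: contraT; rewrite negb_exists => /forallP H.
      have : #|[set y]| = K by apply: eq_card => z; rewrite !inE; have := H z; rewrite negbK => ->.
      by rewrite cards1 => E; move: K_big; rewrite -E.
    apply: (@leq_trans n); last by rewrite -ltnS.
    rewrite -cG -(sum_part pi) (bigD1 y) //= (bigD1 z) //=.
    by rewrite -addn1 leq_add2l ltn_addr // pos.
  apply: (@max_inner Gam v0) => // e' s' i'.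
  exact: (graft hyp psr num e_irr e_max blow _ s' i').
Qed.

End Host.

(** * Probability *)

Local Open Scope ring_scope.

Section Bits.
Variables (R : realType) (T : finType) (p : R).
Hypotheses (p_gt0 : 0 < p) (p_lt1 : p < 1).
Let pm := Num.min p (1 - p).

Definition weight (S : {set T}) : R := \prod_(x : T) (if x \in S then p else 1 - p).
Let weight' d (S : {set T}) : R := \prod_(x : T | x != d) (if x \in S then p else 1 - p).

Lemma weight_ge0 S : 0 <= weight S.
Proof. by apply: prodr_ge0 => x _; case: ifP => _; rewrite ?subr_ge0 ltW. Qed.

Lemma split_bit d (g : {set T} -> R) :
  \sum_S weight S * g S =
  \sum_(S : {set T} | d \notin S) weight' d S * (p * g (d |: S) + (1 - p) * g S).
Proof.
rewrite (bigID (fun S : {set T} => d \in S)) /=.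
rewrite (reindex_onto (fun S => d |: S) (fun S => S :\ d)) /=; last first.
  by move=> S dS; rewrite setD1K.
rewrite (eq_bigl (fun S : {set T} => d \notin S)); last first.
  move=> S; rewrite setU11 /=; apply/eqP/idP => [<-|dS]; first by rewrite !inE eqxx.
  by rewrite setU1K.
rewrite -big_split /=; apply: eq_bigr => S dS.
have W1 : weight (d |: S) = p * weight' d S.
  rewrite /weight (bigD1 d) //= setU11; congr (_ * _); apply: eq_bigr => x xd.
  by rewrite !inE (negbTE xd).
have W2 : weight S = (1 - p) * weight' d S.
  by rewrite /weight (bigD1 d) //= (negbTE dS).
by rewrite W1 W2; ring.
Qed.

Lemma sum_weight : \sum_S weight S = 1.
Proof.
transitivity (\prod_(x : T) (p + (1 - p))).
  by rewrite bigA_distr; apply: eq_bigl => S; rewrite inE.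
by rewrite big1 // => x _; rewrite addrC subrK.
Qed.

Lemma pm_bounds : 0 < pm /\ pm <= 1 / 2 /\ pm <= p /\ pm <= 1 - p.
Proof.
have h1 : pm <= p by rewrite ge_min lexx.
have h2 : pm <= 1 - p by rewrite ge_min lexx orbT.
have h3 : 0 < pm by rewrite lt_min p_gt0 subr_gt0.
by split=> //; split; [lra | split].
Qed.

Definition differs (F : T -> T) (S : {set T}) d := (d \in S) != (F d \in S).

(** The bits in [I] are averaged out one at a time. As [F] leads out of [I], the bit [d] enters no
    other factor, and it differs from the bit [F d] with probability at least [pm]. *)
Lemma mgf (I : {set T}) (F : T -> T) : (forall d, d \in I -> F d \notin I) ->
  \sum_S weight S * \prod_(d in I) (if differs F S d then 1 / 2 else 1) <= (1 - pm / 2) ^+ #|I|.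
Proof.
have [pm0 [pm2 [pmp pmq]]] := pm_bounds.
elim: {I}_.+1 {-2}I (ltnSn #|I|) => // m IH I Im FI.
have [->|[d dI]] := set_0Vmem I.
  rewrite cards0 expr0; under eq_bigr do rewrite big_set0 mulr1.
  by rewrite sum_weight.
have cI : #|I| = #|I :\ d|.+1 by rewrite (cardsD1 d) dI.
have FI' d' : d' \in I :\ d -> F d' \notin I :\ d.
  by rewrite inE => /andP [_ d'I]; rewrite inE negb_and (FI _ d'I) orbT.
have := IH (I :\ d); rewrite -cI => /(_ Im FI') {}IH.
have Fd d' : d' \in I :\ d -> F d' != d.
  by rewrite inE => /andP [_ d'I]; apply: contraNneq (FI _ d'I) => ->.
pose g (S : {set T}) : R := \prod_(d' in I :\ d) (if differs F S d' then 1 / 2 else 1).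
have g_inv S : g (d |: S) = g S.
  apply: eq_bigr => d' d'I; rewrite /differs !inE (negbTE (Fd _ d'I)).
  by move: d'I; rewrite !inE => /andP [/negbTE -> _].
have g0 S : 0 <= g S by apply: prodr_ge0 => d' _; case: ifP => _; lra.
rewrite cI exprS; apply: le_trans (ler_wpM2l _ IH); last by lra.
rewrite (split_bit d) (split_bit d g) big_distrr /=; apply: ler_sum => S dS.
rewrite (big_setD1 d) //= (big_setD1 d (A := I) dI) //= -/(g S) -/(g (d |: S)) g_inv.
have w0 : 0 <= weight' d S by apply: prodr_ge0 => x _; case: ifP => _; lra.
rewrite [leRHS]mulrCA ler_wpM2l //.
have -> : p * g S + (1 - p) * g S = g S by ring.
rewrite !mulrA -mulrDl ler_wpM2r //.
have Fdd : F d != d by apply: contraNneq (FI _ dI) => ->.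
rewrite /differs setU11 !inE (negbTE dS) (negbTE Fdd) /=.
by case: (F d \in S) => /=; lra.
Qed.

(* A map without fixed points has a fibre of size at most 1 over some point
   of [I]; removing that point, its image and its preimage, and iterating,
   leaves a third of [I]. *)
Lemma indep_subset (I : {set T}) (F : T -> T) : (forall d, d \in I -> F d != d) ->
  exists2 J : {set T}, J \subset I &
    (forall d, d \in J -> F d \notin J) /\ (#|I| <= 3 * #|J|)%N.
Proof.
elim: {I}_.+1 {-2}I (ltnSn #|I|) => // m IH I Im FI.
have [->|[d0 d0I]] := set_0Vmem I.
  by exists set0; rewrite ?sub0set //; split=> [d|]; rewrite ?cards0 ?inE.
have [d dI fib] : exists2 d, d \in I & (#|[set x in I | F x == d]| <= 1)%N.
  apply/exists_inP; apply: contraT; rewrite negb_exists_in => /forall_inP H.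
  have : (\sum_(d in I) 2 <= \sum_(d in I) #|[set x in I | F x == d]|)%N.
    by apply: leq_sum => d dI; have := H d dI; rewrite -ltnNge.
  under [X in (_ <= X)%N -> _]eq_bigr do rewrite card_setId_sum.
  rewrite exchange_big sum_nat_const /= => H2.
  have : (\sum_(x in I) \sum_(d in I) (F x == d) <= \sum_(x in I) 1)%N.
    apply: leq_sum => x xI; case: (boolP (F x \in I)) => FxI.
      by rewrite (bigD1 (F x)) //= eqxx big1 // => d /andP [_ /negbTE]; rewrite eq_sym => ->.
    by rewrite big1 // => d dI; case: eqP => // E; rewrite E dI in FxI.
  rewrite sum_nat_const muln1; move: H2; have : (0 < #|I|)%N by apply/card_gt0P; exists d0.
  lia.
pose I' := I :\: (d |: (F d |: [set x in I | F x == d])).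
have c3 : (#|I| <= #|I'| + 3)%N.
  rewrite -(cardsID (d |: (F d |: [set x in I | F x == d])) I) addnC leq_add2l.
  apply: leq_trans (subset_leq_card (subsetIr _ _)) _.
  have := (leq_card_setU [set d] (F d |: [set x in I | F x == d])).1.
  have := (leq_card_setU [set F d] [set x in I | F x == d]).1.
  by rewrite !cards1; lia.
have lt : (#|I'| < #|I|)%N.
  by apply: proper_card; apply/properP; split; [exact: subsetDl | exists d; rewrite ?inE ?eqxx].
have [||J JI' [indJ cJ]] := IH I'; first by lia.
  by move=> x /setDP [xI _]; apply: FI.
have JI : J \subset I by apply: subset_trans JI' (subsetDl _ _).
have dJ : d \notin J by apply/negP => /(subsetP JI'); rewrite !inE eqxx.
exists (d |: J); first by rewrite subUset sub1set dI.
split=> [x|]; last by rewrite cardsU1 dJ; lia.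
rewrite !inE => /orP [/eqP ->|xJ].
  rewrite negb_or FI //=; apply/negP => /(subsetP JI').
  by rewrite !inE eqxx orbT.
rewrite negb_or indJ // andbT.
by apply/negP => Fx; have := subsetP JI' x xJ; rewrite !inE Fx (subsetP JI _ xJ) !orbT.
Qed.

(** Markov's inequality for [2 ^ (- number of differences)] on an independent third of [I];
    [6 = 2 * 3] combines the [pm / 2] of [mgf] with that third. *)
Lemma differs_tail (I : {set T}) (F : T -> T) m : (forall d, d \in I -> F d != d) ->
  \sum_(S : {set T} | (#|[set d in I | differs F S d]| <= m)%N) weight S
  <= expR (m%:R - pm * #|I|%:R / 6).
Proof.
move=> FI; have [pm0 [pm2 _]] := pm_bounds.
have [J JI [indJ cJ]] := indep_subset FI.
apply: le_trans (_ : 2 ^+ m * (1 - pm / 2) ^+ #|J| <= _); last first.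
  rewrite expRD ler_pM ?exprn_ge0 //; first by lra.
    rewrite -[X in expR X]mulr1 expRM_natl lerXn2r ?nnegrE ?expR_ge0 //.
    by apply: le_trans (expR_ge1Dx 1); lra.
  apply: le_trans (_ : expR (- (pm / 2)) ^+ #|J| <= _).
    by rewrite lerXn2r ?nnegrE ?expR_ge0 //; [lra | apply: expR_ge1Dx].
  rewrite -expRM_natl ler_expR.
  have : #|I|%:R <= 3 * #|J|%:R :> R by rewrite -natrM ler_nat.
  by nra.
rewrite -ler_pdivrMl ?exprn_gt0 //; apply: le_trans (mgf indJ).
rewrite big_distrr /= [leLHS]big_mkcond /=; apply: ler_sum => S _.
have g0 : 0 <= \prod_(d in J) (if differs F S d then 1 / 2 else 1) :> R.
  by apply: prodr_ge0 => d _; case: ifP => _; lra.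
case: ifP => Sm; last by rewrite mulr_ge0 ?weight_ge0.
rewrite mulrC ler_wpM2l ?weight_ge0 //.
rewrite -big_mkcondr /= prodr_const.
have cm : (#|[pred d | (d \in J) && differs F S d]| <= m)%N.
  apply: leq_trans Sm; apply: subset_leq_card; apply/subsetP => d; rewrite !inE.
  by move=> /andP [/(subsetP JI) -> ->].
have -> : (2 ^+ m)^-1 = (1 / 2) ^+ m :> R by rewrite mul1r exprVn.
by apply: ler_wiXn2l => //; lra.
Qed.

Lemma prob_union (J : finType) (A : pred J) (ev : J -> pred {set T}) (b : R) :
  (forall j, A j -> \sum_(S | ev j S) weight S <= b) ->
  \sum_(S : {set T} | [exists j, A j && ev j S]) weight S <= #|A|%:R * b.
Proof.
move=> H; apply: le_trans (_ : \sum_(j | A j) \sum_(S | ev j S) weight S <= _).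
  rewrite (exchange_big_dep xpredT) //= [leLHS]big_mkcond /=; apply: ler_sum => S _.
  case: ifP => [/existsP [j /andP [Aj ej]]|_]; last by apply: sumr_ge0 => j _; apply: weight_ge0.
  rewrite (bigD1 j) /=; last by rewrite Aj ej.
  by rewrite lerDl; apply: sumr_ge0 => i _; apply: weight_ge0.
rewrite mulr_natl -sumr_const; exact: ler_sum.
Qed.

End Bits.

(** * Failure probabilities for a random Cayley graph *)

Section RandomCayley.
Variables (R : realType) (G : finZmodType) (p : R).
Hypotheses (p_gt0 : 0 < p) (p_lt1 : p < 1).
Local Notation K := #|G|.
Local Notation T := (opp_pair G).
Local Notation pm := (Num.min p (1 - p)).
Hypothesis K4 : (4 <= K)%N.

Let has_pair : exists P : T, true.
Proof.
have [g g0] : exists g : G, g != 0.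
  apply/existsP; apply: contraT; rewrite negb_exists => /forallP H.
  have : #|[set (0 : G)]| = K by apply: eq_card => z; rewrite !inE; have := H z; rewrite negbK => ->.
  by rewrite cards1 => E; move: K4; rewrite -E.
have gP : cl g \in opp_pairs G by apply/imsetP; exists g; rewrite // !inE.
by exists (exist (fun P : {set G} => P \in opp_pairs G) (cl g) gP).
Qed.
Definition pair0 : T := sval (cid has_pair).
Definition cls (d : G) : T := insubd pair0 (cl d).

Lemma val_cls d : d != 0 -> val (cls d) = cl d.
Proof. by move=> d0; rewrite insubdK //; apply/imsetP; exists d; rewrite // !inE. Qed.

Lemma cls_eq d d' : d != 0 -> d' != 0 -> (cls d == cls d') = (cl d == cl d').
Proof. by move=> d0 d0'; rewrite -(inj_eq val_inj) !val_cls. Qed.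

Lemma mem_connection (S : {set T}) d : d != 0 -> (d \in connection_set S) = (cls d \in S).
Proof.
move=> d0; apply/bigcupP/idP => [[P PS dP]|dS]; last first.
  by exists (cls d) => //; rewrite val_cls // !inE eqxx.
have /imsetP [g _ defP] := valP P.
have -> : cls d = P; last by [].
apply: val_inj; rewrite val_cls // defP; apply/eqP; move: dP; rewrite defP.
rewrite in_set2 => dP; rewrite -/(cl g) cl_eq.
by case/orP: dP => /eqP ->; rewrite ?opprK eqxx ?orbT.
Qed.

Local Notation h S := (cayley_adj (connection_set S)).

Lemma adjE (S : {set T}) x y : x != y -> h S x y = (cls (x - y) \in S).
Proof. by move=> xy; rewrite /cayley_adj /= xy mem_connection ?subr_eq0. Qed.

Lemma adj_irr (S : {set T}) : irreflexive (h S).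
Proof. by move=> x; rewrite /cayley_adj /= eqxx. Qed.

Lemma adj_symm (S : {set T}) : symmetric (h S).
Proof. exact: cayley_adj_sym (@connection_set_opp G S). Qed.

Lemma adj_add (S : {set T}) c x y : h S (x + c) (y + c) = h S x y.
Proof. by rewrite /cayley_adj /= (inj_eq (addIr c)) opprD addrACA subrr addr0. Qed.

Lemma adj_opp (S : {set T}) x y : h S (- x) (- y) = h S x y.
Proof.
rewrite /cayley_adj /= eqr_opp opprK -opprB [- (_ - _)]opprB addrC -[x - y]opprB.
congr (_ && _); apply/idP/idP => /connection_set_opp; rewrite ?opprK //.
Qed.

Definition not_sep de (x y : G) (S : {set T}) := (#|[set z : G | [&& z != x, z != y & h S x z != h S y z]]| < de)%N.

(** For [z + z = x + y] the elements [x - z] and [y - z] are opposite and share one random bit, so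
    such [z] are useless for separation. If some [w + w] is nonzero, translation by [w] maps them to
    useful ones; otherwise [x + y] is nonzero while all [z + z] vanish. *)
Lemma many_halves (x y : G) : x != y ->
  (K <= 2 * #|[set z : G | (z + z != x + y)%R]|)%N.
Proof.
move=> xy; set N := [set z : G | _].
have [/existsP [w w2]|] := boolP [exists w : G, w + w != 0]; last first.
  rewrite negb_exists => /forallP H; have tw (w : G) : w + w = 0 by apply/eqP; have := H w; rewrite negbK.
  have -> : N = setT; last by rewrite cardsT leq_pmull.
  apply/setP => z; rewrite !inE tw eq_sym; apply: contra xy => /eqP E.
  by apply/eqP/(addIr y); rewrite E tw.
have : (#|~: N| <= #|N|)%N.
  rewrite -(card_imset _ (addIr w)); apply: subset_leq_card; apply/subsetP => _ /imsetP [z + ->].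
  rewrite !inE negbK => /eqP E; rewrite addrACA E -subr_eq0 addrAC subrr add0r.
  exact: w2.
by rewrite -(cardsC N) mul2n -addnn leq_add2l.
Qed.

(** At least half of the group minus two elements is useful, and a bit serves two values of [z]:
    this leaves [(K - 4) / 4] bits, whence [24 = 4 * 6]. *)
Lemma not_sep_prob de (x y : G) : x != y ->
  \sum_(S | not_sep de x y S) weight p S <= expR (de%:R - pm * (K%:R - 4) / 24).
Proof.
move=> xy.
pose Z := [set z : G | [&& z != x, z != y & (z + z != x + y)%R]].
pose I := [set cls (x - z) | z in Z].
have cI : (K <= 4 * #|I| + 4)%N.
  have c1 : (#|Z| <= 2 * #|I|)%N.
    apply: card_imset_le2 => z; rewrite inE => /and3P [zx zy _].
    apply: leq_trans (_ : #|[set z; (x - (z - x))%R]| <= _)%N; last by rewrite cards2; case: (_ != _).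
    apply: subset_leq_card; apply/subsetP => z'; rewrite !inE => /andP [/and3P [z'x _ _]].
    rewrite cls_eq ?subr_eq0 1?eq_sym // cl_eq => /orP [] /eqP E.
      by rewrite (can_inj (subKr x) E) eqxx.
    by rewrite -(opprB x z) -E subKr eqxx orbT.
  have : (#|[set z : G | (z + z != x + y)%R]| <= #|Z| + 2)%N.
    apply: leq_trans (_ : #|Z :|: [set x; y]| <= _)%N.
      by apply: subset_leq_card; apply/subsetP => z; rewrite !inE => ->; do 2 case: eqP.
    by apply: leq_trans (leq_card_setU _ _) _; rewrite leq_add2l cards2; case: (_ != _).
  by have := many_halves xy; lia.
pose zz (d : T) : G := odflt 0 [pick z in Z | cls (x - z) == d].
have zzP d : d \in I -> zz d \in Z /\ cls (x - zz d) = d.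
  case/imsetP => z zZ ->; rewrite /zz; case: pickP => /= [z' /andP [? /eqP] //|/(_ z)].
  by rewrite zZ eqxx.
pose Fm d := cls (y - zz d).
have FI d : d \in I -> Fm d != d.
  move=> dI; have [+ E] := zzP d dI; rewrite inE => /and3P [zx zy z2].
  rewrite -{2}E /Fm cls_eq ?subr_eq0 1?eq_sym // cl_eq negb_or.
  rewrite (inj_eq (addIr _)) [y == x]eq_sym xy /= opprB; apply: contra z2 => /eqP E2.
  by rewrite -(subrK (zz d) y) E2 addrA [x + (_ - x)]addrC subrK.
apply: le_trans (_ : \sum_(S : {set T} | (#|[set d in I | differs Fm S d]| <= de)%N) weight p S <= _).
  rewrite [leLHS]big_mkcond [leRHS]big_mkcond /=; apply: ler_sum => S _.
  case: ifP => ns; last by case: ifP => _ //; apply: weight_ge0.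
  rewrite ifT //; apply: leq_trans (ltnW ns).
  have inj : {in [set d in I | differs Fm S d] &, injective zz}.
    move=> d d' /setIdP [dI _] /setIdP [d'I _] E.
    by have [_ <-] := zzP d dI; have [_ <-] := zzP d' d'I; rewrite E.
  rewrite -(card_in_imset inj); apply: subset_leq_card; apply/subsetP => _ /imsetP [d /setIdP [dI df] ->].
  have [+ E] := zzP d dI; rewrite !inE => /and3P [zx zy _]; rewrite zx zy /=.
  have xz : x != zz d by rewrite eq_sym.
  have yz : y != zz d by rewrite eq_sym.
  by rewrite !adjE // E.
apply: le_trans (differs_tail p_gt0 p_lt1 de FI) _; rewrite ler_expR lerD2l lerN2.
have [pm0 _] := pm_bounds p_gt0 p_lt1.
have : K%:R <= 4 * #|I|%:R + 4 :> R by rewrite -natrM -natrD ler_nat.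
by nra.
Qed.

Definition not_rigid t (s : seq (G * G)) (S : {set T}) := consistent (h S) s && (t <= #|NGc s|)%N.

(** Consistency forces the bit of each class in [NGc s] to equal the bit of a different class. So no
    difference occurs at all, and [differs_tail] applies with [m = 0]. *)
Lemma not_rigid_prob t s :
  \sum_(S | not_rigid t s S) weight p S <= expR (- (pm * t%:R / 6)).
Proof.
have [pm0 _] := pm_bounds p_gt0 p_lt1.
have [few|many] := ltnP #|NGc s| t.
  rewrite big1 ?expR_ge0 // => S /andP [_]; by rewrite leqNgt few.
have NG0 (u v : G * G) : NG u v -> (u.1 - v.1 != 0) * (u.2 - v.2 != 0).
  by case/and4P => n1 n2 _ _; rewrite !subr_eq0.
pose I := [set d : T | val d \in NGc s].
have cI : #|I| = #|NGc s|.
  rewrite -(card_imset _ val_inj); apply: eq_card => c; apply/imsetP/idP => [[d + ->]|cN].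
    by rewrite inE.
  have [u [v [us vs uv E]]] := NGcP _ _ cN.
  have [d0 _] := NG0 _ _ uv; exists (cls (u.1 - v.1)); last by rewrite (val_cls d0).
  by rewrite in_set (val_cls d0) -E.
have wit d : exists uv : (G * G) * (G * G), d \in I ->
    [/\ uv.1 \in s, uv.2 \in s, NG uv.1 uv.2 & d = cls (uv.1.1 - uv.2.1)].
  have [dI|_] := boolP (d \in I); last by exists ((0, 0), (0, 0)).
  have : val d \in NGc s by rewrite inE in dI.
  case/NGcP => u [v [us vs uv E]]; exists (u, v) => _; split=> //.
  by apply: val_inj; rewrite val_cls ?(NG0 _ _ uv).
pose wt d := sval (cid (wit d)).
have wtP d : d \in I -> [/\ (wt d).1 \in s, (wt d).2 \in s, NG (wt d).1 (wt d).2 & d = cls ((wt d).1.1 - (wt d).2.1)].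
  by rewrite /wt; case: cid.
pose Fm d := cls ((wt d).1.2 - (wt d).2.2).
have FI d : d \in I -> Fm d != d.
  move=> dI; have [_ _ uv E] := wtP d dI.
  rewrite {2}E /Fm cls_eq ?(NG0 _ _ uv) // cl_eq; case/and4P: uv => _ _ n1 n2.
  by rewrite eq_sym (negbTE n1) /= -eqr_opp opprK opprB eq_sym.
apply: le_trans (_ : \sum_(S : {set T} | (#|[set d in I | differs Fm S d]| <= 0)%N) weight p S <= _).
  rewrite [leLHS]big_mkcond [leRHS]big_mkcond /=; apply: ler_sum => S _.
  case: ifP => [/andP [cs _]|_]; last by case: ifP => _ //; apply: weight_ge0.
  rewrite ifT //; rewrite leqn0 cards_eq0; apply/eqP/setP => d; rewrite in_set0.
  apply/negP => /setIdP [dI]; have [us vs uv E] := wtP d dI.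
  have /and4P [n1 n2 _ _] := uv.
  move/allP: cs => /(_ _ us) /allP /(_ _ vs); rewrite /inc n1 n2 /= negbK => /eqP H.
  by rewrite /differs {1}E -!adjE // H eqxx.
apply: le_trans (differs_tail p_gt0 p_lt1 0 FI) _; rewrite add0r ler_expR lerN2 cI.
have : t%:R <= #|NGc s|%:R :> R by rewrite ler_nat.
by nra.
Qed.

Definition not_prime s (xs ys : s.-tuple G) (S : {set T}) :=
  [&& [forall i, forall j, tnth xs i != tnth ys j],
      [forall i, forall j, forall j', h S (tnth xs i) (tnth ys j) == h S (tnth xs i) (tnth ys j')]
    & (s ^ 2 <= 2 * #|[set cl (tnth xs q.1 - tnth ys q.2)%R | q : 'I_s * 'I_s]|)%N].

(** Each difference is compared with the one in column [j0] of the same row. Classes occurring in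
    that column are removed so that [Fm] has no fixed point, which costs at most [s] of them. *)
Lemma not_prime_prob s (xs ys : s.-tuple G) : (0 < s)%N ->
  \sum_(S | not_prime xs ys S) weight p S <= expR (- (pm * ((s ^ 2)%:R / 2 - s%:R) / 6)).
Proof.
move=> s0; have [pm0 _] := pm_bounds p_gt0 p_lt1.
have [/andP [/forallP dis many]|no] := boolP ([forall i, forall j, tnth xs i != tnth ys j] &&
   (s ^ 2 <= 2 * #|[set cl (tnth xs q.1 - tnth ys q.2)%R | q : 'I_s * 'I_s]|)%N); last first.
  rewrite big1 ?expR_ge0 // => S /and3P [h1 _ h3].
  by rewrite h1 h3 in no.
have ne i j : tnth xs i != tnth ys j by move/forallP: (dis i).
have ne0 i j : tnth xs i - tnth ys j != 0 by rewrite subr_eq0.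
pose j0 : 'I_s := Ordinal s0.
pose B := [set cls (tnth xs i - tnth ys j0) | i : 'I_s].
pose C := [set cls (tnth xs q.1 - tnth ys q.2) | q : 'I_s * 'I_s].
pose I := C :\: B.
have cC : #|C| = #|[set cl (tnth xs q.1 - tnth ys q.2)%R | q : 'I_s * 'I_s]|.
  rewrite -(card_imset _ val_inj) -imset_comp; congr #|pred_of_set _|.
  by apply: eq_imset => q /=; rewrite val_cls.
have cI : (s ^ 2 <= 2 * #|I| + 2 * s)%N.
  apply: leq_trans many _; rewrite -cC -mulnDr leq_mul2l /= -(cardsID B C) addnC leq_add2l.
  apply: leq_trans (subset_leq_card (subsetIr _ _)) _.
  by apply: leq_trans (leq_imset_card _ _) _; rewrite card_ord.
have wit d : exists q : 'I_s * 'I_s, d \in I -> d = cls (tnth xs q.1 - tnth ys q.2).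
  have [/setDP [/imsetP [q _ ->] _]|_] := boolP (d \in I); first by exists q.
  by exists (j0, j0).
pose wt d := sval (cid (wit d)).
have wtP d : d \in I -> d = cls (tnth xs (wt d).1 - tnth ys (wt d).2) by rewrite /wt; case: cid.
pose Fm d := cls (tnth xs (wt d).1 - tnth ys j0).
have FI d : d \in I -> Fm d != d.
  move=> /setDP [_ dB]; apply: contraNneq dB => <-; exact: imset_f.
apply: le_trans (_ : \sum_(S : {set T} | (#|[set d in I | differs Fm S d]| <= 0)%N) weight p S <= _).
  rewrite [leLHS]big_mkcond [leRHS]big_mkcond /=; apply: ler_sum => S _.
  case: ifP => [/and3P [_ /forallP hom _]|_]; last by case: ifP => _ //; apply: weight_ge0.
  rewrite ifT //; rewrite leqn0 cards_eq0; apply/eqP/setP => d; rewrite in_set0.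
  apply/negP => /setIdP [dI].
  have /forallP/(_ (wt d).2)/forallP/(_ j0)/eqP H := hom (wt d).1.
  by rewrite /differs {1}(wtP d dI) -!adjE // H eqxx.
apply: le_trans (differs_tail p_gt0 p_lt1 0 FI) _; rewrite add0r ler_expR lerN2.
have : (s ^ 2)%:R <= 2 * #|I|%:R + 2 * s%:R :> R by rewrite -!natrM -natrD ler_nat.
by nra.
Qed.

Lemma not_pseudorandom_prob de rho t s : (0 < s)%N ->
  \sum_(S : {set T} | ~~ `[< pseudorandom (h S) de rho t s >]) weight p S <=
    (K ^ 2)%:R * expR (de%:R - pm * (K%:R - 4) / 24)
  + (K ^ (2 * rho))%:R * expR (- (pm * t%:R / 6))
  + (K ^ (2 * s))%:R * expR (- (pm * ((s ^ 2)%:R / 2 - s%:R) / 6)).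
Proof.
move=> s0.
pose e1 S := [exists q : G * G, (q.1 != q.2) && not_sep de q.1 q.2 S].
pose e2 S := [exists u : rho.-tuple (G * G), xpredT u && not_rigid t u S].
pose e3 S := [exists q : s.-tuple G * s.-tuple G, xpredT q && not_prime q.1 q.2 S].
have cover S : ~~ `[< pseudorandom (h S) de rho t s >] -> [|| e1 S, e2 S | e3 S].
  apply: contraR; rewrite !negb_or => /and3P [n1 n2 n3]; apply/asboolP; split.
  - exact: adj_symm.
  - exact: adj_irr.
  - exact: adj_add.
  - exact: adj_opp.
  - move=> x y xy; rewrite leqNgt; apply: contra n1 => H; apply/existsP; exists (x, y).
    by rewrite xy.
  - move=> u su cu; rewrite ltnNge; apply: contra n2 => H; apply/existsP.
    exists (Tuple (introT eqP su)); rewrite /= /not_rigid /=.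
    by rewrite cu.
  - move=> xs ys dis hom; rewrite ltnNge; apply: contra n3 => H; apply/existsP.
    exists (xs, ys); rewrite /= /not_prime H andbT; apply/andP; split.
      by apply/forallP => i; apply/forallP => j; apply: dis.
    by apply/forallP => i; apply/forallP => j; apply/forallP => j'; rewrite (hom i j j').
apply: le_trans (_ : \sum_(S | e1 S) weight p S + \sum_(S | e2 S) weight p S + \sum_(S | e3 S) weight p S <= _).
  rewrite ![\sum_(S | e1 S) _]big_mkcond [\sum_(S | e2 S) _]big_mkcond [\sum_(S | e3 S) _]big_mkcond /=.
  rewrite -!big_split [leLHS]big_mkcond /=; apply: ler_sum => S _.
  have w0 := weight_ge0 p_gt0 p_lt1 S.
  case: ifP => [/cover|_]; do 3 case: ifP => _ //=; lra.
apply: lerD; first apply: lerD.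
- apply: le_trans (prob_union p_gt0 p_lt1 (fun q xq => not_sep_prob de xq)) _.
  rewrite ler_wpM2r ?expR_ge0 // ler_nat; apply: leq_trans (max_card _) _.
  by rewrite card_prod mulnn.
- apply: le_trans (@prob_union R T p p_gt0 p_lt1 (rho.-tuple (G * G))%type xpredT (fun u S => not_rigid t u S) _ (fun u _ => not_rigid_prob t u)) _.
  rewrite ler_wpM2r ?expR_ge0 // ler_nat; apply: leq_trans (max_card _) _.
  by rewrite card_tuple card_prod mulnn -expnM.
- apply: le_trans (@prob_union R T p p_gt0 p_lt1 (s.-tuple G * s.-tuple G)%type xpredT (fun q S => not_prime q.1 q.2 S) _ (fun q _ => not_prime_prob q.1 q.2 s0)) _.
  rewrite ler_wpM2r ?expR_ge0 // ler_nat; apply: leq_trans (max_card _) _.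
  by rewrite card_prod !card_tuple -expnD addnn mul2n.
Qed.

End RandomCayley.

(** * Choice of the parameters *)

Lemma ln2_ge_half (R : realType) : 1 / 2 <= ln (2 : R).
Proof.
have e : expR (1 / 2 : R) <= 2.
  rewrite -[1 / 2]opprK expRN -[2]invrK lef_pV2 ?posrE ?expR_gt0 ?invr_gt0 //.
  by apply: le_trans (expR_ge1Dx _); lra.
by rewrite -[X in X <= _]expRK ler_ln ?posrE ?expR_gt0.
Qed.

Lemma ln_ge_half (R : realType) n K : 2 ^+ n <= K%:R :> R -> n%:R / 2 <= ln (K%:R : R).
Proof.
move=> nK; have := nK; rewrite -ler_ln ?posrE ?(lt_le_trans _ nK) ?exprn_gt0 // lnXn // => H; apply: le_trans H.
rewrite -mulr_natl; have n0 : 0 <= n%:R :> R by [].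
by have := ln2_ge_half R; nra.
Qed.

Definition dense (R : realType) (K : nat) (P : R) := [/\ (2 <= K)%N, 0 < P, P <= 1 / 2 &
  10 ^+ 6 * ln (K%:R : R) `^ (6 / 5) * (K%:R : R) `^ (- (1 / 5)) <= P].

Lemma fifth_power (R : realType) K (P : R) : dense K P -> 10 ^+ 30 * ln (K%:R : R) ^+ 6 <= P ^+ 5 * K%:R.
Proof.
case=> K2 P0 _ P_large; set L := ln _.
have K0 : 0 < K%:R :> R by rewrite ltr0n ltnW.
have L0 : 0 <= L by apply: ln_ge0; rewrite ler1n ltnW.
have X5 : (L `^ (6 / 5)) ^+ 5 = L ^+ 6.
  by rewrite -powR_mulrn ?powR_ge0 // -powRrM -[RHS]powR_mulrn //; congr (_ `^ _); field.
have Y5 : ((K%:R : R) `^ (- (1 / 5))) ^+ 5 = K%:R^-1.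
  by rewrite -powR_mulrn ?powR_ge0 // -powRrM -[RHS]powR_inv1 ?ltW //; congr (_ `^ _); field.
have : (10 ^+ 6 * L `^ (6 / 5) * (K%:R : R) `^ (- (1 / 5))) ^+ 5 <= P ^+ 5.
  by apply: lerXn2r P_large; rewrite nnegrE ?mulr_ge0 ?powR_ge0 ?exprn_ge0 // ltW.
rewrite exprMn [(_ * _) ^+ 5]exprMn X5 Y5. by rewrite -exprM ler_pdivrMr.
Qed.

(** A bootstrap. Since [P <= 1 / 2], [fifth_power] forces [K >= 2 ^ 5 * 10 ^ 30 * L ^ 6]; from
    [L >= 1 / 2] this gives [K >= 2 ^ 94], then [L >= 47], and then [K >= 2 ^ 128]. *)
Lemma ln_ge64 (R : realType) K (P : R) : dense K P -> 64 <= ln (K%:R : R).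
Proof.
move=> dns; have fifth := fifth_power dns; have [K2 P_gt0 P_half _] := dns; clear dns.
have lnh n : 2 ^+ n <= K%:R :> R -> n%:R / 2 <= ln (K%:R : R) := @ln_ge_half R n K.
set L := ln _ in fifth lnh *; have K0 : 0 < K%:R :> R by rewrite ltr0n ltnW.
have P5 : P ^+ 5 <= (1 / 2) ^+ 5.
  by apply: lerXn2r; rewrite // nnegrE; lra.
have K32 : 2 ^+ 5 * (10 ^+ 30 * L ^+ 6) <= K%:R.
  apply: le_trans (ler_wpM2l _ fifth) _; first exact: exprn_ge0.
  apply: le_trans (ler_wpM2l _ (ler_wpM2r (ltW K0) P5)) _; first exact: exprn_ge0.
  have two : 2 * (1 / 2) = 1 :> R by field.
  by rewrite mulrA -exprMn two expr1n mul1r.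
have ten : 2 ^+ 95 <= 10 ^+ 30 :> R.
  have /(lerXn2r 5) H : 2 ^+ 19 <= 10 ^+ 6 :> R by lra.
  by rewrite -[95%N]/(19 * 5)%N -[30%N]/(6 * 5)%N !exprM; apply: H; rewrite nnegrE exprn_ge0.
have step m n : 2 ^+ m <= L ^+ 6 * 2 ^+ n -> 2 ^+ (100 + m) <= K%:R * 2 ^+ n :> R.
  move=> H; have p2 k : 0 <= 2 ^+ k :> R by apply: exprn_ge0.
  have /= KK := ler_wpM2r (p2 n) K32.
  apply: (le_trans _ KK).
  rewrite -[(100 + m)%N]/(5 + (95 + m))%N exprD -(mulrA (2 ^+ 5)) ler_wpM2l // exprD -(mulrA (10 ^+ 30)).
  exact: ler_pM (p2 _) (p2 _) ten H.
have L1 : 1 / 2 <= L by have := lnh 1%N; rewrite expr1 mul1r; apply; rewrite ler_nat.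
have L2 : 94%:R / 2 <= L.
  apply: lnh; have := step 0%N 6%N; rewrite expr0 -exprMn => H.
  have /H : 1 <= (L * 2) ^+ 6 by apply: exprn_ege1; lra.
  by rewrite -[(100 + 0)%N]/(94 + 6)%N exprD ler_pM2r // exprn_gt0.
have L3 : 128%:R / 2 <= L.
  apply: lnh; have := step 30%N 0%N; rewrite expr0 !mulr1 => H.
  have /H : 2 ^+ 30 <= L ^+ 6.
    rewrite -[30%N]/(5 * 6)%N exprM; apply: lerXn2r; rewrite ?nnegrE ?exprn_ge0 //; lra.
  by apply: le_trans; apply: ler_weXn2l => //; rewrite ler1n.
by apply: le_trans L3; lra.
Qed.

Lemma pow_tail (R : realType) K a (b : R) : (0 < K)%N ->
  a%:R * ln (K%:R : R) + 2 * ln (K%:R : R) <= b -> (K ^ a)%:R * expR (- b) <= (K%:R ^+ 2)^-1.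
Proof.
move=> K0; set L := ln _ => H.
have E n : (K%:R : R) ^+ n = expR (n%:R * L) by rewrite expRM_natl lnK // posrE ltr0n.
by rewrite natrX !E -expRD -expRN ler_expR; lra.
Qed.

Lemma nat_between (R : realType) (x : R) : 0 <= x -> exists n : nat, n%:R <= x < n%:R + 1.
Proof. by move=> /truncn_itv H; exists (Num.trunc x); rewrite natr1. Qed.

(** As [8 <= exp 3], the power [8 ^ r] is at most [exp (3 * L / 4)]; the remaining [exp (L / 4)], at
    least [(1 + L / 64) ^ 16], covers [100 * (r + 1) ^ 2]. *)
Lemma poly_le_exp (R : realType) K r : 64 <= ln (K%:R : R) -> r%:R <= ln (K%:R : R) / 4 ->
  (100 * (r + 1) ^ 2 * 8 ^ r <= K)%N.
Proof.
have [->|K0] := posnP K; first by rewrite ln0 //; lra.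
set L := ln _ => L64 rL; have expL : expR L = K%:R by rewrite lnK // posrE ltr0n.
 have r0 : 0 <= r%:R :> R by [].
rewrite -(ler_nat R) !natrM !natrX natrD -expL.
have -> : L = L / 4 + 3 * (L / 4) by field.
rewrite expRD; apply: ler_pM; rewrite ?mulr_ge0 ?exprn_ge0 ?addr_ge0 //.
- have -> : L / 4 = (8 * 2)%:R * (L / 64) by rewrite natrM; field.
  rewrite expRM_natl exprM -[X in X%:R * _]/(10 * 10)%N natrM -expr2 -exprMn.
  apply: lerXn2r; rewrite ?nnegrE ?mulr_ge0 ?addr_ge0 ?exprn_ge0 ?expR_ge0 //.
  set w := 1 + L / 64; have w2 : 2 <= w by rewrite /w; lra.
  apply: (@le_trans _ _ (w ^+ 8)); last by apply: lerXn2r; rewrite ?nnegrE ?expR_ge0 ?expR_ge1Dx //; lra.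
  have w6 : 2 ^+ 6 <= w ^+ 6 by apply: lerXn2r; rewrite // nnegrE; lra.
  rewrite -[8%N]/(6 + 2)%N exprD; apply: (@le_trans _ _ (2 ^+ 6 * w ^+ 2)); last first.
    by rewrite ler_wpM2r // sqr_ge0.
  have : r%:R <= 16 * w - 16 by rewrite /w; lra.
  by nra.
- have e3 : 8 <= expR (3 : R).
    have -> : 3 = 3%:R * 1 :> R by rewrite mulr1.
    rewrite expRM_natl; have -> : 8 = 2 ^+ 3 :> R by ring.
    apply: lerXn2r; rewrite ?nnegrE ?expR_ge0 //.
    by apply: le_trans (expR_ge1Dx _); lra.
  apply: (@le_trans _ _ (expR 3 ^+ r)); first by apply: lerXn2r; rewrite ?nnegrE ?expR_ge0.
  rewrite -expRM_natl ler_expR; lra.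
Qed.

Lemma parameters (R : realType) K (P : R) : dense K P -> exists q l de rho t s3 E1 th be : nat,
  (forall r, r%:R <= ln (K%:R : R) / 4 -> numeric K r q l de rho t s3 E1 th be /\ (r + 10 <= q)%N /\
     (K ^ 2 * (K - (de - r)) ^ q < K ^ q)%N) /\
  [/\ (K <= 2 ^ l)%N, (2 ^ 10 <= K)%N, (0 < s3)%N &
   (K ^ 2)%:R * expR (de%:R - P * (K%:R - 4) / 24)
  + (K ^ (2 * rho))%:R * expR (- (P * t%:R / 6))
  + (K ^ (2 * s3))%:R * expR (- (P * ((s3 ^ 2)%:R / 2 - s3%:R) / 6)) <= K%:R^-1].
Proof.
move=> dns; have L64 := ln_ge64 dns; have fifth := fifth_power dns.
have [K2 P_gt0 P_half _] := dns; clear dns; have lnh n := @ln_ge_half R n K.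
have polyr := poly_le_exp L64; have tail := @pow_tail R K.
set L := ln _ in L64 fifth lnh polyr tail *.
have K0 : 0 < K%:R :> R by rewrite ltr0n ltnW.
have expL : expR L = K%:R by rewrite lnK.
(* In these variables [K = Q * u], the constraints become polynomial, and [fifth_power] reads
   [10 ^ 30 * y ^ 4 * L ^ 2 <= Q]. *)
pose u := P^-1; pose y := L * u; pose Q := P * K%:R.
have u2 : 2 <= u by rewrite /u -[2]invrK lef_pV2 ?posrE ?invr_gt0 // -div1r.
have Pu : P * u = 1 by rewrite mulfV // gt_eqF.
have Py : P * y = L by rewrite mulrCA Pu mulr1.
have PK : P * K%:R = Q by [].
have KQ : K%:R = Q * u by rewrite mulrAC Pu mul1r.
have yE : y = L * u by [].
have Q1 : 10 ^+ 30 * (y ^+ 4 * L ^+ 2) <= Q.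
  have u4 : 0 <= u ^+ 4 by apply: exprn_ge0; lra.
  have := ler_wpM2r u4 fifth.
  have -> : P ^+ 5 * K%:R * u ^+ 4 = (P * u) ^+ 4 * (P * K%:R) by ring.
  have -> : 10 ^+ 30 * L ^+ 6 * u ^+ 4 = 10 ^+ 30 * ((L * u) ^+ 4 * L ^+ 2) by ring.
  by rewrite Pu expr1n mul1r.
clearbody Q y u.
have Ly : 2 * L <= y by rewrite yE; clear - u2 L64; nra.
have uy : 64 * u <= y by rewrite yE; clear - u2 L64; nra.
have y1 : 128 <= y by clear - Ly L64; lra.
have yy : y <= y ^+ 2 by clear - y1; nra.
have y23 : y ^+ 2 <= y ^+ 3 by rewrite exprS; have : 0 <= y ^+ 2 := sqr_ge0 y; clear - y1; nra.
have y34 : y ^+ 3 <= y ^+ 4.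
  by rewrite [y ^+ 4]exprS; have : 0 <= y ^+ 3 by [apply: exprn_ge0; clear - y1; lra]; clear - y1; nra.
have Qy : 10 ^+ 33 * y ^+ 4 <= Q.
  apply: le_trans Q1; rewrite -[33%N]/(30 + 3)%N exprD -mulrA ler_wpM2l ?exprn_ge0 // mulrC.
  apply: ler_wpM2l; first by clear - y1 y34 y23 yy; lra.
  by clear - L64; nra.
have half c : 0 <= c -> 0 <= Q / c by move=> c0; apply: divr_ge0 => //; clear - Qy y34 y23 yy y1; lra.
(* [de] stays below the [Q / 24] of the separation bound, [60 * E1] is about [Q / 100] and so below
   [de], and [8 * th] is about [Q / 7000] and so below [E1]. *)
have [de /andP [de1 de2]] := nat_between (half 60 (ler0n _ _)).
have [E1 /andP [E1a E1b]] := nat_between (half (6 * 10 ^+ 3) (mulr_ge0 (ler0n _ _) (exprn_ge0 _ (ler0n _ _)))).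
have [th /andP [th1 th2]] := nat_between (half (56 * 10 ^+ 3) (mulr_ge0 (ler0n _ _) (exprn_ge0 _ (ler0n _ _)))).
have ceil (x : R) : 0 <= x -> exists n : nat, x <= n%:R <= x + 1.
  move=> x0; have [n /andP [n1 n2]] := nat_between x0; exists n.+1; rewrite -natr1; clear - n1 n2; apply/andP; split; lra.
(* [161 > 2 * 80]: as [de - r >= Q / 80], the exponent [q * (de - r) / K] exceeds [2 * L] and
   outweighs the [K ^ 2] pairs. *)
have [q /andP [q1 q2]] : exists n : nat, 161 * y <= n%:R <= 161 * y + 1 by apply: ceil; clear - y1; lra.
(* Forced by [nu_bad]: [K] is [Q * u], [q * l] has order [y * L], [E1] has order [Q], and
   [u * L = y]. *)
have [be /andP [be1 be2]] : exists n : nat, 10 ^+ 12 * y ^+ 2 <= n%:R <= 10 ^+ 12 * y ^+ 2 + 1.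
  by apply: ceil; clear - yy y1; lra.
(* Forced by [nu_large]: [K * t] has order [Q * u * rho * y], against [th * rho ^ 2] with [th] of
   order [Q]. *)
have [rho /andP [rho1 rho2]] : exists n : nat, 10 ^+ 9 * (y * u) <= n%:R <= 10 ^+ 9 * (y * u) + 1.
  by apply: ceil; clear - u2 y1; nra.
(* [P * t / 6 >= 3 * rho * L] pays for the [K ^ (2 * rho)] tuples and a further [K ^ 2]. *)
have [t /andP [t1 t2]] : exists n : nat, 18 * (rho%:R * y) <= n%:R <= 18 * (rho%:R * y) + 1.
  by apply: ceil; rewrite !mulr_ge0 //; clear - y1; lra.
(* [P * s3 >= 72 * L], so the leading term [P * s3 ^ 2 / 12] is at least [6 * s3 * L], against
   [2 * s3 * L] from the number of pairs of tuples. *)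
have [s3 /andP [s1 s2]] : exists n : nat, 72 * y <= n%:R <= 72 * y + 1 by apply: ceil; clear - y1; lra.
pose l := (trunc_log 2 K).+1.
have lL : l%:R <= 3 * L.
  have /lnh H : 2 ^+ trunc_log 2 K <= K%:R :> R.
    by rewrite -natrX ler_nat trunc_logP // ltnW.
  by rewrite /l -[(trunc_log 2 K).+1%:R]natr1; move: H; clear - L64; lra.
have Kl : (K <= 2 ^ l)%N by rewrite ltnW // trunc_log_ltn.
clearbody l.
have uy2 : 64 * (y * u) <= y ^+ 2 by clear - uy y1; nra.
have rho0 := ler0n R rho; have be0 := ler0n R be; have l0 := ler0n R l; have q0 := ler0n R q.
have s0 := ler0n R s3.
have rr : rho%:R ^+ 2 <= 10 ^+ 16 * y ^+ 4.
  have -> : 10 ^+ 16 * y ^+ 4 = (10 ^+ 8 * y ^+ 2) ^+ 2 by ring.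
  apply: lerXn2r; rewrite ?nnegrE //; first by clear - yy y1; lra.
  by clear - rho2 uy2 yy y1; lra.
have rb : rho%:R * be%:R <= 10 ^+ 21 * y ^+ 4.
  have -> : 10 ^+ 21 * y ^+ 4 = (10 ^+ 8 * y ^+ 2) * (10 ^+ 13 * y ^+ 2) by ring.
  by apply: ler_pM => //; clear - rho2 be2 uy2 yy y1; lra.
have ql : q%:R * l%:R <= 486 * (y * L).
  have -> : 486 * (y * L) = (162 * y) * (3 * L) by ring.
  by apply: ler_pM => //; clear - q2 y1; lra.
have ql2 : q%:R * l%:R <= 243 * y ^+ 2 by apply: le_trans ql _; clear - Ly y1; nra.
have sss : s3%:R ^+ 3 <= (73 * y) ^+ 3.
  by apply: lerXn2r; rewrite ?nnegrE //; clear - s2 y1; lra.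
have s3e : (73 * y) ^+ 3 <= 10 ^+ 6 * y ^+ 3.
  rewrite exprMn; apply: ler_wpM2r; last by clear; lra.
  by apply: exprn_ge0; clear - y1; lra.
have Qp : 10 ^+ 33 * y <= Q by clear - Qy y34 y23 yy; lra.
have Kbig : (2 ^ 10 <= K)%N.
  by rewrite -(ler_nat R) natrX KQ; clear - Qp u2 y1; nra.
have rhobig : 10 ^+ 9 * (y * u) >= 2 by clear - y1 u2; nra.
exists q, l, de, rho, t, s3, E1, th, be; split; last split=> //.
- move=> r rL; have r0 := ler0n R r; split; last split.
  + split.
    * by rewrite -(ltr0n R); clear - rho1 rhobig; lra.
    * by rewrite -(ltr0n R); clear - be1 yy y1; lra.
    * by rewrite -(ler_nat R) natrM; clear - th1 E1b Qp y1; lra.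
    * rewrite -(ler_nat R) !(natrM, natrD, natrX); clear - rr rb th2 Qy y34 y23 yy y1; lra.
    * have C2 : 'C(rho, 2)%:R * 2 = rho%:R * (rho%:R - 1) :> R.
        have rpos : (0 < rho)%N by rewrite -(ltr0n R); clear - rho1 rhobig; lra.
        by rewrite -natrM -[2%N]/(2`!) bin_ffact ffactnS ffactn1 natrM -subn1 natrB.
      have ut : 10 ^+ 9 * (u * t%:R) <= 19 * rho%:R ^+ 2.
        have h1 : u * t%:R <= u * (18 * (rho%:R * y) + 1) by apply: ler_wpM2l t2; clear - u2; lra.
        have h2 : rho%:R * (10 ^+ 9 * (y * u)) <= rho%:R * rho%:R by apply: ler_wpM2l.
        have h3 : 10 ^+ 9 * u <= rho%:R ^+ 2.
          apply: (@le_trans _ _ rho%:R); first by move: rho1; clear - u2 y1; nra.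
          by move: rho1 rhobig; clear; nra.
        by move: h1 h2 h3; clear; lra.
      have Q0 : 0 <= Q by clear - Qp y1; lra.
      have h1 := ler_wpM2l Q0 ut.
      have h2 : Q / (60 * 10 ^+ 3) * (rho%:R ^+ 2 / 2) <= th%:R * (rho%:R * (rho%:R - 1)).
        apply: ler_pM; rewrite ?divr_ge0 ?mulr_ge0 ?exprn_ge0 //; first by clear - th2 Qp y1; lra.
        by move: rho1 rhobig; clear; nra.
      rewrite -(ler_nat R) !natrM KQ -C2 in h2 *.
      have : 0 <= Q * rho%:R ^+ 2 by rewrite mulr_ge0 ?exprn_ge0.
      by move: h1 h2; clear; lra.
    * have Q0 : 0 <= Q by clear - Qp y1; lra.
      have h1 : u * (q%:R * l%:R) <= 486 * y ^+ 2.
        have u0 : 0 <= u by clear - u2; lra.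
        by have := ler_wpM2l u0 ql; rewrite yE; clear; lra.
      have h2 := ler_wpM2l Q0 h1.
      have h3 : (10 ^+ 12 * y ^+ 2) * (Q / (7 * 10 ^+ 3)) <= be%:R * E1%:R.
        have y0 : 0 <= 10 ^+ 12 * y ^+ 2 by rewrite mulr_ge0 ?sqr_ge0 ?exprn_ge0.
        apply: (ler_pM y0 _ be1); first by rewrite divr_ge0 ?mulr_ge0 ?exprn_ge0.
        by clear - E1b Qp y1; lra.
      have -> : 8192%N = (2 ^ 13)%N by vm_compute.
      rewrite -(ler_nat R) !(natrM, natrX) KQ.
      have : 0 <= Q * y ^+ 2 by rewrite mulr_ge0 ?sqr_ge0.
      by move: h2 h3; clear; lra.
    * rewrite -(ler_nat R) !(natrM, natrD) -mulrA; clear - ql2 E1b Qy y34 y23 yy y1; lra.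
    * rewrite -(ltr_nat R) !(natrM, natrD) -mulrA; clear - ql2 E1a de2 q2 rL Ly Qy y34 y23 yy y1; lra.
    * by rewrite -(ltr0n R); clear - s1 y1; lra.
    * rewrite -(ltr_nat R) !(natrM, natrD, natrX); clear - sss s3e s2 de2 rL Ly Qy y34 y23 yy y1; lra.
    * exact: polyr.
  + by rewrite -(ler_nat R) natrD; clear - rL Ly q1 y1; lra.
  + have dr : Q / 80 <= (de - r)%:R.
      have : (de <= (de - r) + r)%N by clear; lia.
      by rewrite -(ler_nat R) natrD; clear - de2 Qp rL Ly y1; lra.
    set D := (de - r)%N in dr *.
    have KD : (K - D)%:R <= K%:R * expR (- (D%:R / K%:R)) :> R.
      have [DK|/ltnW DK] := leqP D K; last first.
        by move: DK; rewrite -subn_eq0 => /eqP ->; rewrite mulr_ge0 ?expR_ge0 // ltW.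
      rewrite natrB //; apply: le_trans (ler_wpM2l (ltW K0) (expR_ge1Dx _)).
      by rewrite mulrDr mulr1 mulrN mulrCA mulfV ?mulr1 // gt_eqF.
    rewrite -(ltr_nat R) natrM !natrX.
    have KDq := lerXn2r q (ler0n R _ : _ \is Num.nneg) (mulr_ge0 (ltW K0) (expR_ge0 _) : _ \is Num.nneg) KD.
    apply: le_lt_trans (ler_wpM2l (exprn_ge0 2 (ltW K0)) KDq) _.
    rewrite exprMn mulrCA -[X in _ < X]mulr1 ltr_pM2l ?exprn_gt0 //.
    rewrite -expL -!expRM_natl -expRD expR_lt1 expL.
    have h1 : P / 80 <= D%:R / K%:R by rewrite ler_pdivlMr //; move: PK dr; clear; lra.
    have h2 : 161 * y * (P / 80) <= q%:R * (D%:R / K%:R).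
      by apply: ler_pM => //; move: P_gt0 q1; clear - y1; lra.
    by move: h2 Py L64; clear; lra.
- by rewrite -(ltr0n R); clear - s1 y1; lra.
- have L0 : 0 <= L by clear - L64; lra.
  have -> : de%:R - P * (K%:R - 4) / 24 = - (P * (K%:R - 4) / 24 - de%:R) by rewrite opprB.
  have T1 : (K ^ 2)%:R * expR (- (P * (K%:R - 4) / 24 - de%:R)) <= (K%:R ^+ 2)^-1.
    apply: tail; first exact: ltnW.
    by move: PK de1 Qp Ly y1 L0 P_half; clear; lra.
  have T2 : (K ^ (2 * rho))%:R * expR (- (P * t%:R / 6)) <= (K%:R ^+ 2)^-1.
    apply: tail; first exact: ltnW.
    have h1 : P * (18 * (rho%:R * y)) <= P * t%:R by rewrite ler_wpM2l // ltW.
    have h2 : 2 * L <= rho%:R * L by apply: ler_wpM2r => //; move: rho1 rhobig; clear; lra.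
    have h3 : P * (18 * (rho%:R * y)) = 18 * (rho%:R * L) by rewrite -Py; ring.
    by rewrite natrM; move: h1 h2 h3; clear; lra.
  have T3 : (K ^ (2 * s3))%:R * expR (- (P * ((s3 ^ 2)%:R / 2 - s3%:R) / 6)) <= (K%:R ^+ 2)^-1.
    apply: tail; first exact: ltnW.
    have h1 : 72 * L <= P * s3%:R.
      by have := ler_wpM2l (ltW P_gt0) s1; rewrite mulrCA Py.
    have h2 := ler_wpM2l s0 h1.
    have h3 : 72 <= s3%:R :> R by move: s1 y1; clear; lra.
    have h4 : 72 * L <= s3%:R * L by apply: ler_wpM2r.
    have h5 : P * s3%:R <= 1 / 2 * s3%:R by apply: ler_wpM2r.
    have h6 : 64 * s3%:R <= s3%:R * L by rewrite mulrC ler_wpM2l.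
    by rewrite natrM natrX; move: h2 h4 h5 h6 h3 L64; clear; lra.
  apply: le_trans (lerD (lerD T1 T2) T3) _.
  have K3 : 1024 <= K%:R :> R by move: Kbig; rewrite -(ler_nat R).
  have vK : K%:R^-1 * K%:R = 1 :> R by rewrite mulVf // gt_eqF.
  have v0 : 0 < K%:R^-1 :> R by rewrite invr_gt0.
  rewrite -exprVn; set v := K%:R^-1 in vK v0 *.
  have v3 : v * (1024 * v) <= v * 1.
    by rewrite ler_wpM2l ?(ltW v0) // -[X in _ <= X]vK [X in _ <= X]mulrC ler_wpM2r ?(ltW v0).
  by move: v3 v0; clearbody v; clear; nra.
Qed.

Theorem random_cayley_fractalizes (R : realType) (G : finZmodType) (p : R) :
  0 < p -> p < 1 -> dense #|G| (Num.min p (1 - p)) ->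
  1 - #|G|%:R^-1 <= outcome_prob p (fun S : {set opp_pair G} =>
    forall A : {set random_cayley S},
      (#|G|%:R : R) - ln (#|G|%:R : R) / 4 <= #|A|%:R ->
    forall n : nat, (0 < n)%N ->
    forall Gam : sgraph, #|Gam| = n ->
      max_induced_copies (induced A) Gam ->
      balanced_iterated_blow_up (random_cayley S) Gam).
Proof.
move=> p0 p1 dns.
have [q [l [de [rho [t [s3 [E1 [th [be [num [Kl Kbig s0 tail]]]]]]]]]]] := parameters dns.
have K4 : (4 <= #|G|)%N by apply: leq_trans Kbig.
pose bad (S : {set opp_pair G}) :=
  ~~ `[< pseudorandom (cayley_adj (connection_set S)) de rho t s3 >].
apply: le_trans (_ : 1 - \sum_(S | bad S) weight p S <= _).
  by rewrite lerD2l lerN2; apply: le_trans (not_pseudorandom_prob p0 p1 K4 de rho t s0) tail.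
rewrite -[X in X - _](sum_weight (opp_pair G) p) [X in X - _](bigID bad) /= addrAC subrr add0r /outcome_prob.
rewrite [leLHS]big_mkcond [leRHS]big_mkcond /=; apply: ler_sum => S _.
have w0 : 0 <= weight p S by apply: weight_ge0.
case: ifP => [/negbNE/asboolP psr|_]; last by case: ifP.
rewrite ifT //; apply/asboolP => A cA n _ Gam cG.
have rA : (#|G| - #|A|)%:R <= ln (#|G|%:R : R) / 4.
  by rewrite natrB; [lra | exact: max_card].
have [nm [rq sep]] := num _ rA.
exact: (@extremal_balanced_iterated R G _ (@connection_set_opp G S) A q l de rho t s3 E1 th be psr nm Kl Kbig rq sep n Gam cG).
Qed.

From mathcomp Require Import classical_sets topology normedtype.
Import numFieldNormedType.Exports.

Theorem theorem1p3 (R : realType) :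
  exists eps : nat -> R,
    (forall m : nat, 0 <= eps m <= 1) /\
    (eps @ \oo --> (0 : R))%classic /\
    (forall (G : finZmodType) (p : R),
       0 < p -> p < 1 ->
       10 ^+ 6 * ln (#|G|%:R : R) `^ (6 / 5) * (#|G|%:R : R) `^ (- (1 / 5))
         <= Num.min p (1 - p) ->
       1 - eps #|G| <= outcome_prob p (fun S : {set opp_pair G} =>
         forall A : {set random_cayley S},
           (#|G|%:R : R) - ln (#|G|%:R : R) / 4 <= #|A|%:R ->
         forall n : nat, (0 < n)%N ->
         forall Gam : sgraph, #|Gam| = n ->
           max_induced_copies (induced A) Gam ->
           balanced_iterated_blow_up (random_cayley S) Gam)).
Proof.
(* The value 1 at [m = 1] settles the trivial group, which [dense] excludes; at [m = 0] the inverse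
   is 0 by convention. *)
exists (fun m => m%:R^-1); split; last split.
- move=> [|m]; first by rewrite invr0 lexx ler01.
  by rewrite invr_ge0 ler0n invf_le1 ?ltr0n // ler1n.
- by rewrite -cvg_shiftS; exact: cvg_harmonic.
- move=> G p p0 p1 pK; have [K1|K2] := leqP #|G| 1.
    have -> : #|G| = 1%N by apply/eqP; rewrite eqn_leq K1; apply/card_gt0P; exists 0.
    rewrite invr1 subrr; apply: sumr_ge0 => S _; exact: (weight_ge0 p0 p1 S).
  apply: random_cayley_fractalizes => //; split=> //.
  + by rewrite lt_min p0 subr_gt0.
  + by rewrite ge_min; case: (lerP p (1 / 2)) => //= ?; lra.
Qed.
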